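(* Let $B_1,B_2\subset\mathbb{Z}_{\geqslant 0}$ be sets with $d_i:=\min B_i>0$ for $i=1,2$. For $r\in\mathbb{Z}_{\geqslant 0}$ put $j_r:=\gcd\bigl((B_1\cap[d_1,d_1+r])\cup(B_2\cap[d_2,d_2+r])\bigr)$, and assume $j_\infty:=\gcd(B_1\cup B_2)=1$. Set $$\delta_{B_1,B_2}:=\frac{(d_1-1)(d_2-1)}{2}+\sum_{r=0}^{\infty}\frac{j_r-1}{2}$$ (a finite sum, since $j_r=1$ for large $r$). Then: 1) For a generic pair $(f_1,f_2)\in\mathbb{C}^{B_1}\oplus\mathbb{C}^{B_2}$, the curve singularity $f=(f_1,f_2):(\mathbb{C},0)\to(\mathbb{C}^2,0)$ has $\delta$-invariant equal to $\delta_{B_1,B_2}$, and hence Milnor number $2\delta_{B_1,B_2}$. 2) A germ $f=(f_1,f_2)$ with $f_i\in\mathbb{C}^{B_i}$ whose coefficient of $t^{d_i}$ in $f_i$ is nonzero ($i=1,2$) has $\delta$-invariant equal to $\delta_{B_1,B_2}$ if and only if it is $0$-nondegenerate, and has $\delta$-invariant strictly greater than $\delta_{B_1,B_2}$ otherwise. 3) All $0$-nondegenerate germs $f=(f_1,f_2)$ with $f_i\in\mathbb{C}^{B_i}$ (i.e. supported at $(B_1,B_2)$) are topologically equivalent to each other.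
   Context: For $B\subset\mathbb{Z}_{\geqslant 0}$, $\mathbb{C}^B$ denotes the space of power series $\sum_{b\in B}c_bt^b$ convergent near $0$ (a series supported at $B$). For $f_i=\sum_b c_{i,b}t^b\in\mathbb{C}^{B_i}$ we put $c_{i,b}=0$ for $b\notin B_i$. The pair $(f_1,f_2)$ (with $c_{i,d_i}\neq0$) is called $0$-nondegenerate if for every common divisor $k>1$ of $d_1$ and $d_2$, setting $r_k:=\min\bigl(((B_1-d_1)\cup(B_2-d_2))\setminus k\mathbb{Z}\bigr)$, one has $$\frac{c_{1,d_1+r_k}}{c_{1,d_1}\cdot d_1}\neq\frac{c_{2,d_2+r_k}}{c_{2,d_2}\cdot d_2}.$$ The $\delta$-invariant and Milnor number are those of the plane curve germ given by the image of $f$. ''Generic'' means outside a proper (analytic/algebraic) subset of the coefficient space.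
   Formalization: The δ-invariant of f is taken as dim C{t}/f*C{x,y}, infinite if f covers its image several times; with δ of the reduced image, part 2 fails for f=(t^2,t^4), B_1={2,3}, B_2={4,5}, where the image is smooth (δ=0) but δ_{B_1,B_2}=2. *)

(* Defs.v *)
From HB Require Import structures.
From mathcomp Require Import all_boot all_order all_algebra.
From mathcomp Require Import complex.
From mathcomp Require Import all_classical all_reals all_analysis.
From mathcomp Require mpoly.
From mathcomp Require Import Rstruct Rstruct_topology.
Set Implicit Arguments. Unset Strict Implicit. Unset Printing Implicit Defensive.
Import Order.TTheory GRing.Theory Num.Theory.
Import numFieldNormedType.Exports.
Local Open Scope classical_set_scope.
Local Open Scope ring_scope.

Definition C : numClosedFieldType := (Rdefinitions.R)[i].

Definition series1 := nat -> C.
Definition series2 := nat -> nat -> C.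

Definition conv1 (a : series1) : Prop :=
  exists M rho : C, 0 < M /\ 0 < rho /\ forall n, `|a n| <= M * rho ^+ n.
Definition conv2 (g : series2) : Prop :=
  exists M rho : C, 0 < M /\ 0 < rho /\
    forall i j, `|g i j| <= M * rho ^+ (i + j).

Definition supported (B : pred nat) (a : series1) : Prop :=
  forall b, ~~ B b -> a b = 0.
Definition in_CB (B : pred nat) (a : series1) : Prop := conv1 a /\ supported B a.

Definition mul1 (a b : series1) : series1 :=
  fun n => \sum_(k < n.+1) a k * b (n - k)%N.
Definition one1 : series1 := fun n => (n == 0%N)%:R.
Definition pow1 (a : series1) (m : nat) : series1 := iter m (mul1 a) one1.

(* composition g(f1(t), f2(t)) of a two-variable series with series without
   constant term (f1 0 = f2 0 = 0): only monomials x^p y^q with p,q <= n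
   contribute to the coefficient of t^n. *)
Definition comp (g : series2) (f1 f2 : series1) : series1 :=
  fun n => \sum_(p < n.+1) \sum_(q < n.+1)
             g p q * mul1 (pow1 f1 p) (pow1 f2 q) n.

Definition pullback (f1 f2 : series1) : series1 -> Prop :=
  fun h => exists g, conv2 g /\ h = comp g f1 f2.

Definition codim1_le (S : series1 -> Prop) (n : nat) : Prop :=
  exists v : 'I_n -> series1, (forall i, conv1 (v i)) /\
    forall h, conv1 h -> exists lam : 'I_n -> C, exists s, S s /\
      h = (fun m => \sum_(i < n) lam i * v i m + s m).

(* delta-invariant of the germ f = (f1,f2):
   delta(f) = dim_C  C{t} / f^* C{x,y}   (possibly infinite).
   delta_is f1 f2 n  <->  delta(f) = n. *)
Definition delta_is (f1 f2 : series1) (n : nat) : Prop :=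
  codim1_le (pullback f1 f2) n /\
  forall m, (m < n)%N -> ~ codim1_le (pullback f1 f2) m.

(* Milnor number of the image curve {g = 0}, g a generator of the      *)
(* kernel of f^* : C{x,y} -> C{t}:  mu = dim C{x,y}/(g_x, g_y).        *)
Definition mul2 (g h : series2) : series2 :=
  fun i j => \sum_(a < i.+1) \sum_(b < j.+1) g a b * h (i - a)%N (j - b)%N.
Definition dx (g : series2) : series2 := fun i j => (i.+1)%:R * g i.+1 j.
Definition dy (g : series2) : series2 := fun i j => (j.+1)%:R * g i j.+1.

Definition jacobian_ideal (g : series2) : series2 -> Prop :=
  fun k => exists u v, conv2 u /\ conv2 v /\
    k = (fun i j => mul2 u (dx g) i j + mul2 v (dy g) i j).

Definition codim2_le (S : series2 -> Prop) (n : nat) : Prop :=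
  exists v : 'I_n -> series2, (forall i, conv2 (v i)) /\
    forall h, conv2 h -> exists lam : 'I_n -> C, exists s, S s /\
      h = (fun a b => \sum_(i < n) lam i * v i a b + s a b).

Definition codim2_is (S : series2 -> Prop) (n : nat) : Prop :=
  codim2_le S n /\ forall m, (m < n)%N -> ~ codim2_le S m.

Definition image_equation (f1 f2 : series1) (g : series2) : Prop :=
  conv2 g /\ comp g f1 f2 = (fun _ => 0) /\
  forall h, conv2 h -> comp h f1 f2 = (fun _ => 0) ->
    exists u, conv2 u /\ h = mul2 u g.

Definition milnor_is (f1 f2 : series1) (m : nat) : Prop :=
  exists g, image_equation f1 f2 g /\ codim2_is (jacobian_ideal g) m.

Definition jr (B1 B2 : pred nat) (d1 d2 r : nat) : nat :=
  gcdn (\big[gcdn/0%N]_(d1 <= b < (d1 + r).+1 | B1 b) b)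
       (\big[gcdn/0%N]_(d2 <= b < (d2 + r).+1 | B2 b) b).

(* delta_{B1,B2} = (d1-1)(d2-1)/2 + sum_{r<N} (j_r - 1)/2, where N is such
   that j_r = 1 for all r >= N (so the remaining terms vanish). *)
Definition deltaB (B1 B2 : pred nat) (d1 d2 N : nat) : rat :=
  ((d1 - 1) * (d2 - 1))%N%:R / 2%:R +
  \sum_(r < N) (((jr B1 B2 d1 d2 r)%:R - 1) / 2%:R).

Definition is_rk (B1 B2 : pred nat) (d1 d2 k r : nat) : Prop :=
  let inS s := B1 (d1 + s)%N || B2 (d2 + s)%N in
  inS r /\ ~~ (k %| r)%N /\ forall s, (s < r)%N -> inS s -> (k %| s)%N.

Definition nondeg0 (B1 B2 : pred nat) (d1 d2 : nat) (f1 f2 : series1) : Prop :=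
  f1 d1 != 0 /\ f2 d2 != 0 /\
  forall k, (1 < k)%N -> (k %| d1)%N -> (k %| d2)%N ->
    forall r, is_rk B1 B2 d1 d2 k r ->
      f1 (d1 + r)%N / (f1 d1 * d1%:R) != f2 (d2 + r)%N / (f2 d2 * d2%:R).

(* Genericity: outside a proper algebraic subset of the coefficient
   space C^{B1} (+) C^{B2}, cut out by a polynomial in finitely many
   coefficients (those of t^0..t^(N-1) of f1 and of f2).              *)
Definition coefvec (N : nat) (f1 f2 : series1) : 'I_(N + N) -> C :=
  fun i => match fintype.split i with inl k => f1 k | inr k => f2 k end.
Arguments coefvec N f1 f2 : clear implicits.

Definition generic (B1 B2 : pred nat) (P : series1 -> series1 -> Prop) : Prop :=
  exists N (p : mpoly.mpoly (N + N) C),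
    (exists f1 f2, in_CB B1 f1 /\ in_CB B2 f2 /\
       mpoly.meval (coefvec N f1 f2) p != 0) /\
    forall f1 f2, in_CB B1 f1 -> in_CB B2 f2 ->
       mpoly.meval (coefvec N f1 f2) p != 0 -> P f1 f2.

Definition eval1 (a : series1) (z : C) : C :=
  limn (fun N => \sum_(n < N) a n * z ^+ n).

Definition homeo_germ {T : topologicalType} (h : T -> T) (x0 : T) : Prop :=
  h x0 = x0 /\
  exists (U V : set T) (h' : T -> T),
    open U /\ open V /\ U x0 /\ V x0 /\
    (forall x, U x -> V (h x) /\ h' (h x) = x) /\
    (forall y, V y -> U (h' y) /\ h (h' y) = y) /\
    {within U, continuous h} /\ {within V, continuous h'}.

Definition topo_equiv (f1 f2 g1 g2 : series1) : Prop :=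
  exists (phi : C -> C) (psi : (C * C)%type -> (C * C)%type),
    homeo_germ phi 0 /\ homeo_germ psi (0, 0) /\
    \forall z \near (0 : C),
      psi (eval1 f1 z, eval1 f2 z) = (eval1 g1 (phi z), eval1 g2 (phi z)).

(* Main.v *)
(** A change of parameter brings the germ to the form (t^n, F) with n = d1. Let e be a primitive
n-th root of unity and m_j the order of F(e^j t) - F(t). The lattice spanned by 1, F, ..., F^(n-1)
over C{t^n} is the image of the pullback, and Smith normal form with a Vandermonde determinant gives
2 delta = sum_(0 < j < n) (m_j - 1). If k is the order of e^j, the support conditions force
m_j >= d2 + r_k (with r_k = 0 when k does not divide d2), with equality for all j exactly when the
germ is 0-nondegenerate; summing over j gives delta_{B1,B2}. The equation of the curve is the
polynomial g(x, y) with roots F(e^j s) in y, where s^n = x; multiplication by g_x modulo g_y has a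
determinant which Puiseux factorization of g_y evaluates, and its order, the Milnor number, is
2 delta.

Two nondegenerate germs (t^n, F0) and (t^n, F1) with n <= d2 have the same orders m_j. Put
H = F1 - F0 and F_l = F0 + l H. The orders m_j of F_l jump only for finitely many complex l, and a
path from 0 to 1 avoids these. At the other l, comparing t with the nearest e^j s yields
|H(t) - H(s)| <= B (|t^n - s^n| + |F_l(t) - F_l(s)|), so H is a Lipschitz function on the image
curve. If E extends it to the plane, the shears (x, y) |-> (x, y + mu E(x, y)) with small mu are
homeomorphisms that carry (t^n, F_l) to (t^n, F_(l + mu)), and a compactness argument chains them
along the path. *)

(* The factor 2 in the formula for delta has two sources: the Vandermonde determinant of the e^j t
   has order n(n-1)/2, and the symmetry m_j = m_(n-j) turns a sum over pairs of branches into n/2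
   times a sum over j. The roots of g_y are not conjugates of F, but only orders matter, so formal
   Puiseux roots suffice. Along such a root b the chain rule leaves d/ds g(s^L, b(s)) = L s^(L-1)
   g_x, which trades orders of g_x for orders of g; and the product of g over the roots of g_y is,
   up to constants, the product of g_y over the roots of g, which the m_j determine. The Lipschitz
   bound rests on n <= d2: t^n - s^n controls |t - e^j s| only after multiplication by the (n-1)-st
   power of the size of the points, and series of order at least n supply this power. When d2 < d1
   the coordinates are exchanged. Codimensions are bounded below by independent linear forms, which
   also covers infinite delta. The analysis is done over an abstract field with three properties of
   the complex numbers: geometrically dominated series converge, the field is Archimedean, and
   bounded sets of reals have suprema. *)
From Pilot Require Import Defs.
From HB Require Import structures.
From mathcomp Require Import all_boot all_order all_algebra.
From mathcomp Require Import complex.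
From mathcomp Require Import all_classical all_reals all_analysis.
From mathcomp Require Import perm cyclic separable cyclotomic ring zify.
From mathcomp Require mpoly.
From mathcomp Require Import Rstruct Rstruct_topology.
Import Order.TTheory GRing.Theory Num.Theory.
Import numFieldNormedType.Exports.
Import Pilot.Defs.
Local Open Scope ring_scope.

Set Implicit Arguments.
Unset Strict Implicit.
Unset Printing Implicit Defensive.

(** * Formal power series *)

Definition ps (R : Type) : Type := nat -> R.

HB.instance Definition _ (R : Type) := gen_eqMixin (ps R).
HB.instance Definition _ (R : Type) := gen_choiceMixin (ps R).

Section PsZmod.
Variable R : zmodType.
Implicit Types a b : ps R.

Definition psadd a b : ps R := fun n => a n + b n.
Definition psopp a : ps R := fun n => - a n.
Definition pszero : ps R := fun _ => 0.

Lemma psaddA : associative psadd.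
Proof. by move=> a b c; apply/funext => n; exact: addrA. Qed.
Lemma psaddC : commutative psadd.
Proof. by move=> a b; apply/funext => n; exact: addrC. Qed.
Lemma psadd0 : left_id pszero psadd.
Proof. by move=> a; apply/funext => n; exact: add0r. Qed.
Lemma psaddN : left_inverse pszero psopp psadd.
Proof. by move=> a; apply/funext => n; exact: addNr. Qed.

HB.instance Definition _ := GRing.isZmodule.Build (ps R) psaddA psaddC psadd0 psaddN.

Lemma psD a b n : (a + b) n = a n + b n. Proof. by []. Qed.
Lemma psN a n : (- a) n = - a n. Proof. by []. Qed.
Lemma psB a b n : (a - b) n = a n - b n. Proof. by []. Qed.
Lemma ps0 n : (0 : ps R) n = 0. Proof. by []. Qed.
Lemma ps_sum (I : Type) (r : seq I) (P : pred I) (F : I -> ps R) n :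
  (\sum_(i <- r | P i) F i) n = \sum_(i <- r | P i) F i n.
Proof. by elim/big_rec2: _ => //= i x y _ <-. Qed.

Definition psC (c : R) : ps R := fun n => if n is 0%N then c else 0.

End PsZmod.

Section PsRing.
Variable R : comNzRingType.
Implicit Types a b : ps R.

Definition psmul a b : ps R := fun n => \sum_(k < n.+1) a k * b (n - k)%N.
Definition psone : ps R := fun n => (n == 0%N)%:R.

Definition trunc_poly n a : {poly R} := \poly_(i < n) a i.

Lemma coef_trunc_poly n a i : (i < n)%N -> (trunc_poly n a)`_i = a i.
Proof. by move=> h; rewrite coef_poly h. Qed.

(** Coefficient n of a product depends only on truncations, so the ring laws of series are inherited
    from polynomials. *)
Lemma psmul_coef a b (p q : {poly R}) n :
  (forall i, (i <= n)%N -> p`_i = a i) -> (forall i, (i <= n)%N -> q`_i = b i) ->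
  psmul a b n = (p * q)`_n.
Proof.
move=> hp hq; rewrite coefM; apply: eq_bigr => k _.
by rewrite hp ?hq ?leq_subr // -ltnS.
Qed.

Lemma psmulA : associative psmul.
Proof.
move=> a b c; apply/funext => n.
pose T x := trunc_poly n.+1 x.
have hT x i : (i <= n)%N -> (T x)`_i = x i by move=> h; rewrite coef_trunc_poly.
rewrite (@psmul_coef _ _ (T a) (T b * T c)) ?(@psmul_coef _ _ (T a * T b) (T c)) ?mulrA //.
- by move=> i hi; rewrite -(@psmul_coef a b) // => k hk; rewrite hT // (leq_trans hk).
- by move=> i; exact: hT.
- by move=> i; exact: hT.
- by move=> i hi; rewrite -(@psmul_coef b c) // => k hk; rewrite hT // (leq_trans hk).
Qed.

Lemma psmulC : commutative psmul.
Proof.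
move=> a b; apply/funext => n.
rewrite (@psmul_coef _ _ (trunc_poly n.+1 a) (trunc_poly n.+1 b)) 1?mulrC;
  try by move=> i hi; rewrite coef_trunc_poly.
by rewrite -(@psmul_coef b a) // => i hi; rewrite coef_trunc_poly.
Qed.

Lemma psmul1 : left_id psone psmul.
Proof.
move=> a; apply/funext => n; rewrite /psmul big_ord_recl /= /psone mul1r subn0.
by rewrite big1 ?addr0 // => i _; rewrite mul0r.
Qed.

Lemma psmulDl : left_distributive psmul (@psadd R).
Proof.
move=> a b c; apply/funext => n; rewrite /psmul /psadd -big_split /=.
by apply: eq_bigr => i _; rewrite mulrDl.
Qed.

Lemma psone_neq0 : psone != 0.
Proof. by apply/eqP => /(congr1 (fun f => f 0%N)) /eqP; rewrite /psone /= oner_eq0. Qed.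

HB.instance Definition _ := GRing.Zmodule_isComNzRing.Build (ps R)
  psmulA psmulC psmul1 psmulDl psone_neq0.

Lemma psM a b n : (a * b) n = \sum_(k < n.+1) a k * b (n - k)%N. Proof. by []. Qed.
Lemma ps1 n : (1 : ps R) n = (n == 0%N)%:R. Proof. by []. Qed.
Lemma psM_0 a b : (a * b) 0%N = a 0%N * b 0%N.
Proof. by rewrite psM big_ord_recl big_ord0 addr0. Qed.

Lemma psC_additive : additive (@psC R).
Proof. by move=> a b; apply/funext => -[|n]; rewrite psB //= subr0. Qed.
HB.instance Definition _ := GRing.isAdditive.Build R (ps R) (@psC R) psC_additive.

Lemma psCM c a n : (psC c * a) n = c * a n.
Proof.
rewrite psM big_ord_recl /= subn0 big1 ?addr0 // => i _.
by rewrite mul0r.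
Qed.

Lemma psC_multiplicative : multiplicative (@psC R).
Proof.
split=> [a b|]; apply/funext => -[|n]; rewrite ?psCM //= ?mulr0 //.
Qed.
HB.instance Definition _ := GRing.isMultiplicative.Build R (ps R) (@psC R) psC_multiplicative.

Definition psX : ps R := fun n => (n == 1%N)%:R.
Definition psshift a : ps R := fun n => a n.+1.

Lemma psXM0 a : (psX * a) 0%N = 0.
Proof. by rewrite psM_0 mul0r. Qed.
Lemma psXMS a n : (psX * a) n.+1 = a n.
Proof.
rewrite psM big_ord_recl big_ord_recl /= /psX /= mul0r add0r mul1r subSS subn0.
by rewrite big1 ?addr0 // => i _; rewrite /bump /= mul0r.
Qed.

Lemma ps_shiftE a : a = psC (a 0%N) + psX * psshift a.
Proof.
apply/funext => -[|n]; rewrite psD; first by rewrite psXM0 addr0.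
by rewrite psXMS add0r.
Qed.

Lemma psXnM m a n : (psX ^+ m * a) n = if (n < m)%N then 0 else a (n - m)%N.
Proof.
elim: m n => [|m IH] n; first by rewrite expr0 mul1r subn0.
by rewrite exprS -mulrA; case: n => [|n]; rewrite ?psXM0 // psXMS IH ltnS subSS.
Qed.

Lemma psXn m n : (psX ^+ m) n = (n == m)%:R.
Proof.
rewrite -[_ ^+ m]mulr1 psXnM ps1 subn_eq0.
by case: ltngtP.
Qed.

Definition ordge m a := forall i, (i < m)%N -> a i = 0.

Lemma ordgeD m a b : ordge m a -> ordge m b -> ordge m (a + b).
Proof. by move=> ha hb i hi; rewrite psD ha // hb // addr0. Qed.
Lemma ordgeN m a : ordge m a -> ordge m (- a).
Proof. by move=> ha i hi; rewrite psN ha // oppr0. Qed.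
Lemma ordgeB m a b : ordge m a -> ordge m b -> ordge m (a - b).
Proof. by move=> ha hb; apply/ordgeD/ordgeN. Qed.
Lemma ordge_sum m (I : Type) (r : seq I) (P : pred I) (F : I -> ps R) :
  (forall i, P i -> ordge m (F i)) -> ordge m (\sum_(i <- r | P i) F i).
Proof. by move=> h; elim/big_rec: _ => // i x hi; apply: ordgeD; exact: h. Qed.
Lemma ordge_le m k a : (k <= m)%N -> ordge m a -> ordge k a.
Proof. by move=> hk ha i hi; rewrite ha // (leq_trans hi). Qed.

Lemma ordge_XnM m a : ordge m (psX ^+ m * a).
Proof. by move=> i hi; rewrite psXnM hi. Qed.

Lemma ordgeP m a : ordge m a -> a = psX ^+ m * (fun n => a (n + m)%N : R).
Proof.
move=> h; apply/funext => n; rewrite psXnM; case: ltnP => hn; first by rewrite h.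
by rewrite subnK.
Qed.

Lemma ordgeM m k a b : ordge m a -> ordge k b -> ordge (m + k) (a * b).
Proof.
move=> /ordgeP -> /ordgeP ->; rewrite mulrACA -exprD; exact: ordge_XnM.
Qed.

Lemma ordgeMl m a b : ordge m a -> ordge m (a * b).
Proof. by move=> h; rewrite -[m]addn0; apply: ordgeM. Qed.
Lemma ordgeMr m a b : ordge m b -> ordge m (a * b).
Proof. by rewrite mulrC; exact: ordgeMl. Qed.

Lemma coef_ordgeM m k a b : ordge m a -> ordge k b ->
  (a * b) (m + k)%N = a m * b k.
Proof.
move=> /[dup] h1 /ordgeP e1 /[dup] h2 /ordgeP e2.
rewrite {1}e1 {1}e2 mulrACA -exprD psXnM ltnn subnn psM_0.
by [].
Qed.

Lemma ordgeX m k a : ordge m a -> ordge (m * k) (a ^+ k).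
Proof. by move=> h; elim: k => [|k IH] //; rewrite ?muln0 // mulnS exprS; apply: ordgeM. Qed.

Lemma ordge_all a : (forall m, ordge m a) -> a = 0.
Proof. by move=> h; apply/funext => n; rewrite (h n.+1). Qed.

Lemma psM_agree m a a' b b' : (forall i, (i < m)%N -> a i = a' i) ->
  (forall i, (i < m)%N -> b i = b' i) ->
  forall i, (i < m)%N -> (a * b) i = (a' * b') i.
Proof.
move=> ha hb i hi; rewrite !psM; apply: eq_bigr => k _.
by rewrite ha ?hb // (leq_ltn_trans _ hi) ?leq_subr // -ltnS.
Qed.

End PsRing.
Arguments psX {R}.
Arguments ordge {R} m a.

Section PsMap.
Variables (R S : comNzRingType) (f : {rmorphism R -> S}).

Definition psmap (a : ps R) : ps S := fun n => f (a n).

Lemma psmap_additive : additive psmap.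
Proof. by move=> a b; apply/funext => n; exact: rmorphB. Qed.
HB.instance Definition _ := GRing.isAdditive.Build (ps R) (ps S) psmap psmap_additive.
Lemma psmap_multiplicative : multiplicative psmap.
Proof.
split=> [a b|]; apply/funext => n; rewrite /psmap; last exact: rmorph_nat.
by rewrite !psM rmorph_sum; apply: eq_bigr => i _; rewrite rmorphM.
Qed.
HB.instance Definition _ := GRing.isMultiplicative.Build (ps R) (ps S) psmap psmap_multiplicative.

Lemma psmapC c : psmap (psC c) = psC (f c).
Proof. by apply/funext => -[|n] //; exact: rmorph0. Qed.
Lemma psmapX : psmap psX = psX.
Proof. by apply/funext => n; exact: rmorph_nat. Qed.

End PsMap.

(* A morphism that sends X into the maximal ideal is determined by X and the constants:
   writing a = a(0) + X a', the difference of two such morphisms gains one order at each step. *)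
Lemma ps_morph_ext (R S : comNzRingType) (f g : {rmorphism ps R -> ps S}) :
  (forall c, f (psC c) = g (psC c)) -> f psX = g psX -> f psX 0%N = 0 -> f =1 g.
Proof.
move=> hC hX h0 a; apply/eqP; rewrite -subr_eq0; apply/eqP/ordge_all => m.
have hf : ordge 1 (f psX) by case.
elim: m a => [|m IH] a //.
rewrite (ps_shiftE a) !rmorphD !rmorphM /= -hC -hX opprD addrACA subrr add0r -mulrBr.
by rewrite -add1n; apply: ordgeM.
Qed.

Section Subst.
Variable R : comNzRingType.
Implicit Types (f : ps R) (G : ps (ps R)).

Definition psv f : ps R := f - psC (f 0%N).
Lemma psv_id f : f 0%N = 0 -> psv f = f.
Proof. by move=> h; rewrite /psv h raddf0 subr0. Qed.
Lemma ordge_psv f : ordge 1 (psv f).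
Proof. by case=> // _; rewrite /psv psB subrr. Qed.

(* [subst f] substitutes [psv f], i.e. [f] without its constant term, for the variable. *)
Definition subst f G : ps R := fun n => (trunc_poly n.+1 G).[psv f] n.

Lemma horner_ordge f (p : {poly ps R}) n :
  (forall i, (i < n)%N -> p`_i = 0) -> ordge n p.[psv f].
Proof.
move=> hp; rewrite horner_coef; apply: ordge_sum => i _.
case: (ltnP i n) => hi; first by rewrite hp // mul0r.
apply/ordgeMr/(ordge_le hi); rewrite -[X in ordge X _]mul1n.
by apply: ordgeX; exact: ordge_psv.
Qed.

(** Since [psv f] has order at least 1, degrees above n in the outer variable cannot reach
    coefficient n. The freedom in the choice of p lets sums and products of truncations stand for
    truncations of sums and products. *)
Lemma substE f G (p : {poly ps R}) n :
  (forall i, (i <= n)%N -> p`_i = G i) -> subst f G n = p.[psv f] n.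
Proof.
move=> hp; apply/eqP; rewrite -subr_eq0 /subst -psB -hornerN -hornerD; apply/eqP.
apply: (@horner_ordge f _ n.+1) => // i hi.
by rewrite coefB coef_trunc_poly // hp // subrr.
Qed.

Lemma subst_additive f : additive (subst f).
Proof.
move=> G H; apply/funext => n; rewrite psB.
rewrite (@substE f (G - H) (trunc_poly n.+1 G - trunc_poly n.+1 H)).
  by rewrite hornerD hornerN psB.
by move=> i hi; rewrite coefB !coef_trunc_poly.
Qed.
HB.instance Definition _ f := GRing.isAdditive.Build (ps (ps R)) (ps R) (subst f) (subst_additive f).

Lemma subst_multiplicative f : multiplicative (subst f).
Proof.
split=> [G H|]; apply/funext => n.
  pose T (F : ps (ps R)) := trunc_poly n.+1 F.
  have hT F i : (i <= n)%N -> (T F)`_i = F i by move=> h; rewrite coef_trunc_poly.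
  rewrite (@substE f (G * H) (T G * T H)); last first.
    by move=> i hi; rewrite -(@psmul_coef _ G H) // => k hk; rewrite hT // (leq_trans hk).
  rewrite hornerM; apply: (@psM_agree _ n.+1) => // i hi;
  by apply/esym/substE => k hk; rewrite hT // (leq_trans hk).
by rewrite (@substE f 1 1) ?hornerC // => i _; rewrite coef1.
Qed.
HB.instance Definition _ f :=
  GRing.isMultiplicative.Build (ps (ps R)) (ps R) (subst f) (subst_multiplicative f).

Lemma substC f a : subst f (psC a) = a.
Proof.
apply/funext => n; rewrite (@substE f _ a%:P) ?hornerC // => i _.
by rewrite coefC; case: i.
Qed.
Lemma substX f : subst f psX = psv f.
Proof.
apply/funext => n; rewrite (@substE f _ 'X) ?hornerX // => i _.
by rewrite coefX.
Qed.
Lemma subst_0 f G : subst f G 0%N = G 0%N 0%N.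
Proof. by rewrite (ps_shiftE G) rmorphD rmorphM /= substC substX !psD psM_0 ordge_psv // mul0r psXM0. Qed.

Lemma subst_sum f G n m : (n <= m)%N -> subst f G n = \sum_(k < m.+1) (G k * psv f ^+ k) n.
Proof.
move=> h; rewrite (@substE f _ (trunc_poly m.+1 G)).
  by rewrite /trunc_poly horner_poly ps_sum.
by move=> i hi; rewrite coef_trunc_poly // ltnS (leq_trans hi).
Qed.

Definition scomp f : ps R -> ps R := subst f \o psmap (@psC R).
HB.instance Definition _ f := GRing.RMorphism.copy (scomp f) (subst f \o psmap (@psC R)).

(** An element of [ps (ps R)] is a series in x whose coefficients are series in y: f2 enters the
    coefficients first, then f1 replaces x. *)
Definition comp2 f1 f2 : ps (ps R) -> ps R := subst f1 \o psmap (scomp f2).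
HB.instance Definition _ f1 f2 := GRing.RMorphism.copy (comp2 f1 f2) (subst f1 \o psmap (scomp f2)).

Arguments scomp : simpl never.
Arguments comp2 : simpl never.

Lemma scompC f c : scomp f (psC c) = psC c.
Proof. by rewrite /scomp /= psmapC substC. Qed.
Lemma scompX f : scomp f psX = psv f.
Proof. by rewrite /scomp /= psmapX substX. Qed.
Lemma scomp_0 f a : scomp f a 0%N = a 0%N.
Proof. by rewrite /scomp /= subst_0. Qed.

Lemma comp2C f1 f2 a : comp2 f1 f2 (psC a) = scomp f2 a.
Proof. by rewrite /comp2 /= psmapC substC. Qed.
Lemma comp2X f1 f2 : comp2 f1 f2 psX = psv f1.
Proof. by rewrite /comp2 /= psmapX substX. Qed.
Lemma comp2_0 f1 f2 G : comp2 f1 f2 G 0%N = G 0%N 0%N.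
Proof. by rewrite /comp2 /= subst_0; exact: scomp_0. Qed.

Lemma scomp_id a : scomp psX a = a.
Proof.
apply: (@ps_morph_ext _ _ (scomp psX) idfun) => [c||] /=.
- by rewrite scompC.
- by rewrite scompX psv_id.
- by rewrite scompX psv_id.
Qed.

Lemma psv_scomp f g : psv (scomp g f) = scomp g (psv f).
Proof. by rewrite /psv rmorphB /= scompC scomp_0. Qed.

Lemma scompA f g a : scomp g (scomp f a) = scomp (scomp g f) a.
Proof.
apply: (@ps_morph_ext _ _ (scomp g \o scomp f) (scomp (scomp g f))) => [c||] /=.
- by rewrite !scompC.
- by rewrite !scompX psv_scomp.
- by rewrite scompX scomp_0 ordge_psv.
Qed.

Lemma scomp_comp2 f1 f2 g G : scomp g (comp2 f1 f2 G) = comp2 (scomp g f1) (scomp g f2) G.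
Proof.
apply: (@ps_morph_ext _ _ (scomp g \o comp2 f1 f2) (comp2 (scomp g f1) (scomp g f2))) => [c||] /=.
- by rewrite !comp2C scompA.
- by rewrite !comp2X psv_scomp.
- by rewrite comp2X scomp_0 ordge_psv.
Qed.

Lemma scomp_ordge f a m k : ordge m f -> ordge k a -> (0 < m)%N -> ordge (m * k) (scomp f a).
Proof.
move=> hf /ordgeP -> hm; rewrite rmorphM rmorphXn /= scompX psv_id ?hf //.
by apply/ordgeMl/ordgeX.
Qed.

Lemma scomp_lead f a m k : ordge m f -> ordge k a -> (0 < m)%N ->
  scomp f a (m * k)%N = f m ^+ k * a k.
Proof.
move=> hf /[dup] ha /ordgeP e hm; rewrite {1}e rmorphM rmorphXn /= scompX psv_id; last exact: hf.
rewrite -[(m * k)%N]addn0 coef_ordgeM //; last by apply: ordgeX.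
rewrite scomp_0 add0n; congr (_ * _).
elim: k {ha e} => [|k IH]; first by rewrite muln0 expr0 expr0 ps1.
by rewrite mulnS !exprS coef_ordgeM ?IH //; apply: ordgeX.
Qed.

End Subst.
Arguments scomp : simpl never.
Arguments comp2 : simpl never.

(** * Norms and convergence *)

Lemma sum_triangle (V : zmodType) (F : nat -> nat -> V) m :
  \sum_(n < m) \sum_(k < n.+1) F k (n - k)%N = \sum_(k < m) \sum_(l < m - k) F k l.
Proof.
elim: m => [|m IH]; first by rewrite !big_ord0.
rewrite big_ord_recr /= IH [RHS]big_ord_recr /= subSnn [X in _ = _ + X]big_ord_recr big_ord0 /= add0r.
rewrite [X in _ + X = _]big_ord_recr /= subnn addrA -big_split /=; congr (_ + _).
by apply: eq_bigr => k _; rewrite subSn ?(ltnW (ltn_ord k)) // big_ord_recr.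
Qed.

Lemma geometric_sum_le2 (K : numFieldType) (x : K) n :
  0 <= x -> 2 * x <= 1 -> \sum_(k < n) x ^+ k <= 2.
Proof.
move=> x0 x1; elim: n => [|n IH]; first by rewrite big_ord0.
rewrite big_ord_recl expr0; under eq_bigr do rewrite exprS.
rewrite -mulr_sumr -[leRHS]/(1 + 1) lerD2l (le_trans _ x1) // [leRHS]mulrC.
by rewrite ler_wpM2l.
Qed.

Lemma ler_sum_ord (K : numDomainType) m n (F : nat -> K) : (m <= n)%N ->
  (forall i, (i < n)%N -> 0 <= F i) -> \sum_(i < m) F i <= \sum_(i < n) F i.
Proof.
move=> h; rewrite -(subnKC h) big_split_ord /= lerDl => F0; apply: sumr_ge0 => i _.
by apply: F0; rewrite ltn_add2l.
Qed.

(* [N x c] reads: the seminorm of x is at most c. *)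
Record subnorm (K : numFieldType) (R : comNzRingType) (N : R -> K -> Prop) : Prop := {
  subnorm_ge0 : forall x c, N x c -> 0 <= c;
  subnorm_0 : N 0 0;
  subnorm_1 : N 1 1;
  subnorm_D : forall x y c d, N x c -> N y d -> N (x + y) (c + d);
  subnorm_M : forall x y c d, N x c -> N y d -> N (x * y) (c * d);
  subnorm_N : forall x c, N x c -> N (- x) c;
  subnorm_le : forall x c d, N x c -> c <= d -> N x d }.

Section Norms.
Variables (K : numFieldType) (R : comNzRingType) (N : R -> K -> Prop).
Hypothesis hN : subnorm N.

Lemma subnorm_sum (I : Type) (r : seq I) (P : pred I) (F : I -> R) (c : I -> K) :
  (forall i, P i -> N (F i) (c i)) -> N (\sum_(i <- r | P i) F i) (\sum_(i <- r | P i) c i).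
Proof.
move=> h; elim/big_rec2: _ => [|i x y hi]; first exact: subnorm_0.
by apply: subnorm_D => //; exact: h.
Qed.

Lemma subnorm_X x c n : N x c -> N (x ^+ n) (c ^+ n).
Proof.
move=> h; elim: n => [|n IH]; first by rewrite !expr0; exact: subnorm_1.
by rewrite !exprS; apply: subnorm_M.
Qed.

(* [psnorm s a A]: the sum of the norms of [a n] times [s ^ n] is at most [A]. *)
Definition psnorm (s : K) (a : ps R) (A : K) : Prop :=
  forall n, exists c : nat -> K, (forall k, (k < n)%N -> N (a k) (c k)) /\
    \sum_(k < n) c k * s ^+ k <= A.

Lemma psnorm_agree s a A : (forall n, exists2 b, psnorm s b A & forall k, (k < n)%N -> a k = b k) ->
  psnorm s a A.
Proof.
move=> h n; have [b hb e] := h n; have [c [hc hA]] := hb n.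
by exists c; split=> // k hk; rewrite e //; exact: hc.
Qed.

Lemma psnorm_C s x c : N x c -> psnorm s (psC x) c.
Proof.
move=> h n; exists (fun k => if k is 0%N then c else 0); split.
  by case=> // k _; exact: subnorm_0.
case: n => [|n]; first by rewrite big_ord0 (subnorm_ge0 hN h).
by rewrite big_ord_recl /= mulr1 big1 ?addr0 // => i _; rewrite mul0r.
Qed.

Lemma psnorm_coef s a A k : 0 < s -> psnorm s a A -> N (a k) (A / s ^+ k).
Proof.
move=> s0 /(_ k.+1) [c [hc hA]]; apply: (subnorm_le hN (hc k _)) => //.
rewrite ler_pdivlMr ?exprn_gt0 //; apply: le_trans hA.
rewrite big_ord_recr /= lerDr; apply: sumr_ge0 => i _.
by rewrite mulr_ge0 ?exprn_ge0 ?(ltW s0) // (subnorm_ge0 hN (hc i (ltnW (ltn_ord i)))).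
Qed.

Lemma psnorm_geo s a A t : 0 <= s -> 0 <= A -> 0 <= t -> 2 * (t * s) <= 1 ->
  (forall k, N (a k) (A * t ^+ k)) -> psnorm s a (A * 2).
Proof.
move=> s0 A0 t0 h ha n; exists (fun k => A * t ^+ k); split=> [k _|]; first exact: ha.
under eq_bigr do rewrite -mulrA -exprMn.
by rewrite -mulr_sumr ler_wpM2l // geometric_sum_le2 // mulr_ge0.
Qed.

(** Without a constant term every summand carries at least one factor s'/s. This makes the norm of
    an inner series as small as desired by shrinking the radius. *)
Lemma psnorm_shrink s s' a A : 0 < s -> 0 <= s' -> s' <= s -> a 0%N = 0 ->
  psnorm s a A -> psnorm s' a (A * (s' / s)).
Proof.
move=> s0 s'0 ss a0 ha n; have [c [hc hA]] := ha n.
exists (fun k => if k is 0%N then 0 else c k); split.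
  by case=> [|k] hk; [rewrite a0; exact: subnorm_0|exact: hc].
case: n hc hA => [|n] hc hA.
  by rewrite big_ord0 mulr_ge0 ?divr_ge0 ?(ltW s0) //; move: hA; rewrite big_ord0.
have hc0 k : (k < n.+1)%N -> 0 <= c k by move=> hk; exact: subnorm_ge0 (hc k hk).
apply: (@le_trans _ _ ((\sum_(k < n.+1) c k * s ^+ k) * (s' / s))); last first.
  by rewrite ler_wpM2r // divr_ge0 // ltW.
rewrite !big_ord_recl mul0r add0r mulrDl [leLHS](_ : _ = 0 + \sum_(i < n) c (lift ord0 i) * s' ^+ lift ord0 i); last by rewrite add0r.
apply: lerD; first by rewrite mulr_ge0 ?mulr_ge0 ?exprn_ge0 ?hc0 ?invr_ge0 ?(ltW s0).
rewrite mulr_suml; apply: ler_sum => i _; rewrite -mulrA ler_wpM2l ?hc0 //.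
rewrite /= /bump /= add1n !exprSr -mulrA [s * _]mulrC divfK ?gt_eqF // ler_wpM2r //.
by rewrite lerXn2r // nnegrE ltW.
Qed.

Lemma psnorm_ler s s' a A : 0 <= s' -> s' <= s -> psnorm s a A -> psnorm s' a A.
Proof.
move=> s'0 ss ha n; have [c [hc hA]] := ha n.
exists c; split=> //; apply: le_trans hA; apply: ler_sum => i _.
by rewrite ler_wpM2l ?(subnorm_ge0 hN (hc i _)) // lerXn2r // nnegrE // (le_trans s'0).
Qed.

(** The norm can therefore be iterated: two-variable convergence is [psnorm] over [psnorm], and
    every estimate below serves both cases. *)
Lemma subnorm_psnorm s : 0 <= s -> subnorm (psnorm s).
Proof.
move=> s0; split.
- by move=> x c /(_ 0%N) [d []] _; rewrite big_ord0.
- move=> n; exists (fun _ => 0); split=> [k _|]; first exact: subnorm_0.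
  by rewrite big1 // => i _; rewrite mul0r.
- by rewrite -(rmorph1 (@psC R)); apply: psnorm_C; exact: subnorm_1.
- move=> x y c d hx hy n; have [u [hu hc]] := hx n; have [v [hv hd]] := hy n.
  exists (fun k => u k + v k); split=> [k hk|].
    by rewrite psD; apply: subnorm_D => //; [exact: hu|exact: hv].
  by under eq_bigr do rewrite mulrDl; rewrite big_split lerD.
- move=> x y c d hx hy n; have [u [hu hc]] := hx n; have [v [hv hd]] := hy n.
  exists (fun k => \sum_(i < k.+1) u i * v (k - i)%N); split=> [k hk|].
    rewrite psM; apply: subnorm_sum => i _; apply: subnorm_M => //; [apply: hu|apply: hv].
      by rewrite (leq_ltn_trans _ hk) // -ltnS.
    by rewrite (leq_ltn_trans _ hk) // leq_subr.
  pose F i j : K := (u i * s ^+ i) * (v j * s ^+ j).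
  rewrite (eq_bigr (fun m : 'I_n => \sum_(k < m.+1) F k (m - k)%N)); last first.
    move=> m _; rewrite mulr_suml; apply: eq_bigr => k _.
    by rewrite /F mulrACA -exprD subnKC // -ltnS.
  have u0 k : (k < n)%N -> 0 <= u k * s ^+ k.
    by move=> hk; rewrite mulr_ge0 ?exprn_ge0 // (subnorm_ge0 hN (hu k hk)).
  have v0 k : (k < n)%N -> 0 <= v k * s ^+ k.
    by move=> hk; rewrite mulr_ge0 ?exprn_ge0 // (subnorm_ge0 hN (hv k hk)).
  rewrite sum_triangle; apply: (@le_trans _ _ ((\sum_(k < n) u k * s ^+ k) * (\sum_(k < n) v k * s ^+ k))).
    rewrite mulr_suml; apply: ler_sum => k _; rewrite /F -mulr_sumr ler_wpM2l ?u0 //.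
    by apply: (@ler_sum_ord _ _ _ (fun l => v l * s ^+ l)); rewrite ?leq_subr.
  by apply: ler_pM => //; apply: sumr_ge0 => i _; [exact: u0|exact: v0].
- move=> x c hx n; have [u [hu hc]] := hx n.
  by exists u; split=> // k hk; rewrite psN; apply: subnorm_N => //; exact: hu.
- move=> x c d hx cd n; have [u [hu hc]] := hx n.
  by exists u; split=> //; exact: le_trans cd.
Qed.

End Norms.

(** Each coefficient of the composite is a finite sum of terms [G k * psv f ^+ k], of norm at most
    the k-th summand of the norm of G at radius t. *)
Lemma psnorm_subst (K : numFieldType) (R : comNzRingType) (N : R -> K -> Prop)
    (hN : subnorm N) (s t A : K) (f : ps R) (G : ps (ps R)) : 0 <= s ->
  psnorm N s (psv f) t -> psnorm (psnorm N s) t G A -> psnorm N s (subst f G) A.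
Proof.
move=> s0 hf hG; have hP := subnorm_psnorm hN s0; apply: psnorm_agree => n.
exists (\sum_(k < n) G k * psv f ^+ k); last first.
  move=> k hk; rewrite ps_sum; case: n hk => // n hk.
  by rewrite (@subst_sum _ _ _ _ n) // ps_sum.
have [c [hc hA]] := hG n; apply: (subnorm_le hP _ hA).
apply: (subnorm_sum hP) => i _; apply: (subnorm_M hP); first exact: hc.
by apply: (subnorm_X hP).
Qed.

Section Convergence.
Variable K : numFieldType.
Implicit Types (a b f : ps K) (g : ps (ps K)).

Definition absnorm (x c : K) : Prop := `|x| <= c.

Lemma subnorm_absnorm : subnorm absnorm.
Proof.
split; rewrite /absnorm; try by rewrite ?normr0 ?normr1.
- by move=> x c; apply: le_trans.
- by move=> x y c d hx hy; rewrite (le_trans (ler_normD _ _)) // lerD.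
- by move=> x y c d hx hy; rewrite normrM ler_pM.
- by move=> x c; rewrite normrN.
- by move=> x c d; apply: le_trans.
Qed.
Hint Resolve subnorm_absnorm : core.

Lemma subnorm_abs2 s : 0 < s -> subnorm (psnorm absnorm s).
Proof. by move=> s0; apply: subnorm_psnorm => //; exact: ltW. Qed.

(** Spelled as [conv1] and, below, [conv2], so that over the complex numbers the notions are
    convertible. *)
Definition convergent a : Prop :=
  exists M rho : K, 0 < M /\ 0 < rho /\ forall n, `|a n| <= M * rho ^+ n.
Definition convergent2 g : Prop :=
  exists M rho : K, 0 < M /\ 0 < rho /\ forall i j, `|g i j| <= M * rho ^+ (i + j).

Lemma convergentP a : convergent a <-> exists s A, 0 < s /\ psnorm absnorm s a A.
Proof.
split=> [[M [rho [M0 [r0 h]]]]|[s [A [s0 h]]]].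
  exists (2 * rho)^-1, (M * 2); have s0 : 0 < (2 * rho)^-1 by rewrite invr_gt0 mulr_gt0.
  split=> //; apply: psnorm_geo h; rewrite ?(ltW M0) ?(ltW r0) ?(ltW s0) //.
  by rewrite mulrA divff // gt_eqF // mulr_gt0.
have A0 := subnorm_ge0 (subnorm_abs2 s0) h.
exists (A + 1), s^-1; rewrite ltr_wpDl // invr_gt0; split=> //; split=> // n.
apply: (le_trans (psnorm_coef subnorm_absnorm n s0 h)).
by rewrite exprVn ler_wpM2r ?lerDl // invr_ge0 exprn_ge0 ?ltW.
Qed.

Lemma convergent2P g : convergent2 g <->
  exists s t A, [/\ 0 < s, 0 < t & psnorm (psnorm absnorm t) s g A].
Proof.
split=> [[M [rho [M0 [r0 h]]]]|[s [t [A [s0 t0 h]]]]].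
  have s0 : 0 < (2 * rho)^-1 by rewrite invr_gt0 mulr_gt0.
  have e : 2 * (rho * (2 * rho)^-1) <= 1.
    by rewrite mulrA divff // gt_eqF // mulr_gt0.
  exists (2 * rho)^-1, (2 * rho)^-1, (M * 2 * 2); split=> //.
  apply: (@psnorm_geo _ _ _ _ _ _ rho); rewrite ?mulr_ge0 ?(ltW M0) ?(ltW r0) ?(ltW s0) //.
  move=> i; rewrite mulrAC; apply: (@psnorm_geo _ _ _ _ _ _ rho);
    rewrite ?mulr_ge0 ?exprn_ge0 ?(ltW M0) ?(ltW r0) ?(ltW s0) // => j.
  by rewrite /absnorm -mulrA -exprD.
have A0 := subnorm_ge0 (subnorm_psnorm (subnorm_abs2 t0) (ltW s0)) h.
exists (A + 1), (s^-1 + t^-1); rewrite ltr_wpDl // addr_gt0 ?invr_gt0 //; split=> //; split=> // i j.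
have := psnorm_coef (subnorm_abs2 t0) i s0 h.
move=> /(psnorm_coef subnorm_absnorm j t0) /le_trans; apply.
rewrite -mulrA -!exprVn exprD; apply: ler_pM; rewrite ?lerDl ?mulr_ge0 ?exprn_ge0 ?invr_ge0 ?(ltW s0) ?(ltW t0) //.
by apply: ler_pM; rewrite ?exprn_ge0 ?invr_ge0 ?(ltW s0) ?(ltW t0) //; apply: lerXn2r;
  rewrite ?nnegrE ?addr_ge0 ?invr_ge0 ?(ltW s0) ?(ltW t0) // ?lerDl ?lerDr invr_ge0 ltW.
Qed.

Lemma min_pos (s t : K) : 0 < s -> 0 < t -> exists r, [/\ 0 < r, r <= s & r <= t].
Proof.
move=> s0 t0; have st : 0 < s + t by rewrite addr_gt0.
(* This quotient lies below both numbers, which avoids comparing them in a partially ordered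
   field. *)
exists (s * t / (s + t)); split; first by rewrite divr_gt0 // mulr_gt0.
  by rewrite ler_pdivrMr // ler_pM2l // lerDr ltW.
by rewrite ler_pdivrMr // [leLHS]mulrC ler_pM2l // lerDl ltW.
Qed.

Lemma convergent_common a b : convergent a -> convergent b ->
  exists s A B, [/\ 0 < s, psnorm absnorm s a A & psnorm absnorm s b B].
Proof.
move=> /convergentP [s [A [s0 ha]]] /convergentP [t [B [t0 hb]]].
have [r [r0 rs rt]] := min_pos s0 t0; exists r, A, B; split=> //.
  by apply: psnorm_ler rs ha; rewrite // ltW.
by apply: psnorm_ler rt hb; rewrite // ltW.
Qed.

Lemma convergentD a b : convergent a -> convergent b -> convergent (a + b).
Proof.
move=> ha hb; have [s [A [B [s0 hA hB]]]] := convergent_common ha hb.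
by apply/convergentP; exists s, (A + B); split=> //; apply: (subnorm_D (subnorm_abs2 s0)).
Qed.
Lemma convergentM a b : convergent a -> convergent b -> convergent (a * b).
Proof.
move=> ha hb; have [s [A [B [s0 hA hB]]]] := convergent_common ha hb.
by apply/convergentP; exists s, (A * B); split=> //; apply: (subnorm_M (subnorm_abs2 s0)).
Qed.
Lemma convergentN a : convergent a -> convergent (- a).
Proof.
move=> /convergentP [s [A [s0 hA]]].
by apply/convergentP; exists s, A; split=> //; apply: (subnorm_N (subnorm_abs2 s0)).
Qed.
Lemma convergentC c : convergent (psC c).
Proof. by apply/convergentP; exists 1, `|c|; split=> //; apply: psnorm_C => //; exact: lexx. Qed.
Lemma convergentX : convergent psX.
Proof.
exists 1, 1; split=> //; split=> // n; rewrite expr1n mulr1 /psX normr_nat.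
by case: eqP; rewrite ?ler01.
Qed.

Lemma convergent2_common g h : convergent2 g -> convergent2 h ->
  exists s t A B, [/\ 0 < s, 0 < t, psnorm (psnorm absnorm t) s g A
     & psnorm (psnorm absnorm t) s h B].
Proof.
have W x y (x' y' : K) G A : 0 < x -> 0 < y -> x <= x' -> y <= y' ->
    psnorm (psnorm absnorm y') x' G A -> psnorm (psnorm absnorm y) x G A.
  move=> x0 y0 hx hy hG; apply: (psnorm_ler (subnorm_abs2 y0) (ltW x0) hx).
  move=> n; have [c [hc hA]] := hG n; exists c; split=> // k hk.
  by apply: psnorm_ler hy (hc k hk); rewrite // ltW.
move=> /convergent2P [s [t [A [s0 t0 ha]]]] /convergent2P [s' [t' [B [s'0 t'0 hb]]]].
have [x [x0 xs xs']] := min_pos s0 s'0; have [y [y0 yt yt']] := min_pos t0 t'0.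
exists x, y, A, B; split=> //; [exact: W ha|exact: W hb].
Qed.

Lemma subnorm_abs3 s t : 0 < s -> 0 < t -> subnorm (psnorm (psnorm absnorm t) s).
Proof. by move=> s0 t0; apply: subnorm_psnorm; [exact: subnorm_abs2|exact: ltW]. Qed.

Lemma convergent2D g h : convergent2 g -> convergent2 h -> convergent2 (g + h).
Proof.
move=> ha hb; have [s [t [A [B [s0 t0 hA hB]]]]] := convergent2_common ha hb.
by apply/convergent2P; exists s, t, (A + B); split=> //; apply: (subnorm_D (subnorm_abs3 s0 t0)).
Qed.
Lemma convergent2M g h : convergent2 g -> convergent2 h -> convergent2 (g * h).
Proof.
move=> ha hb; have [s [t [A [B [s0 t0 hA hB]]]]] := convergent2_common ha hb.
by apply/convergent2P; exists s, t, (A * B); split=> //; apply: (subnorm_M (subnorm_abs3 s0 t0)).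
Qed.
Lemma convergent2N g : convergent2 g -> convergent2 (- g).
Proof.
move=> /convergent2P [s [t [A [s0 t0 hA]]]].
by apply/convergent2P; exists s, t, A; split=> //; apply: (subnorm_N (subnorm_abs3 s0 t0)).
Qed.
Lemma convergent2C a : convergent a -> convergent2 (psC a).
Proof.
move=> /convergentP [s [A [s0 hA]]]; apply/convergent2P; exists 1, s, A; split=> //.
by apply: psnorm_C => //; exact: subnorm_abs2.
Qed.
Lemma convergent2_map a : convergent a -> convergent2 (psmap (@psC K) a).
Proof.
move=> [M [r [M0 [r0 h]]]]; exists M, r; split=> //; split=> // i [|j]; first by rewrite addn0 h.
by rewrite normr0 mulr_ge0 ?exprn_ge0 ?ltW.
Qed.

Lemma psnorm_psv f t : convergent f -> 0 < t ->
  exists2 s0, 0 < s0 & forall s, 0 < s -> s <= s0 -> psnorm absnorm s (psv f) t.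
Proof.
move=> hf t0; have /convergentP [s [A [s0 hA]]] : convergent (psv f).
  by apply: convergentD => //; apply/convergentN/convergentC.
have A0 := subnorm_ge0 (subnorm_abs2 s0) hA.
have At : 0 < A + t by rewrite ltr_wpDl.
(* At this radius [psnorm_shrink] turns the bound A into A t / (A + t), which is at most t. *)
exists (s * (t / (A + t))) => [|r r0 hr]; first by rewrite mulr_gt0 // divr_gt0.
have rs : r <= s.
  apply: (le_trans hr); rewrite ler_piMr ?(ltW s0) // ler_pdivrMr // mul1r lerDr //.
apply: (subnorm_le (subnorm_abs2 r0) (psnorm_shrink subnorm_absnorm s0 (ltW r0) rs (@ordge_psv _ f 0%N (ltnSn 0)) hA)).
apply: (@le_trans _ _ (A * (t / (A + t)))).
  by rewrite ler_wpM2l // ler_pdivrMr // mulrC.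
by rewrite mulrA ler_pdivrMr // [leRHS]mulrC ler_pM2r // lerDl ltW.
Qed.

Lemma psnorm_scomp s t f a A : 0 < s -> psnorm absnorm s (psv f) t ->
  psnorm absnorm t a A -> psnorm absnorm s (scomp f a) A.
Proof.
move=> s0 hf ha; rewrite /scomp /=; apply: psnorm_subst hf _ => //; first exact: ltW.
move=> n; have [c [hc hA]] := ha n; exists c; split=> // k hk.
by apply: psnorm_C => //; exact: hc.
Qed.

Lemma convergent_scomp f a : convergent f -> convergent a -> convergent (scomp f a).
Proof.
move=> hf /convergentP [t [A [t0 ha]]]; have [s s0 hs] := psnorm_psv hf t0.
by apply/convergentP; exists s, A; split=> //; apply: psnorm_scomp ha => //; apply: hs.
Qed.

Lemma convergent_comp2 f1 f2 g : convergent f1 -> convergent f2 -> convergent2 g ->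
  convergent (comp2 f1 f2 g).
Proof.
move=> h1 h2 /convergent2P [s [t [A [s0 t0 hA]]]].
have [x x0 hx] := psnorm_psv h1 s0; have [y y0 hy] := psnorm_psv h2 t0.
have [r [r0 rx ry]] := min_pos x0 y0.
apply/convergentP; exists r, A; split=> //; rewrite /comp2 /=.
apply: (psnorm_subst subnorm_absnorm (ltW r0) (hx r r0 rx)).
move=> n; have [c [hc hs]] := hA n; exists c; split=> // k hk.
exact: (psnorm_scomp r0 (hy r r0 ry) (hc k hk)).
Qed.

End Convergence.
#[global] Hint Resolve subnorm_absnorm : core.

(** * Weierstrass division and reparametrization *)

Section Recursion.
Variables (R : comNzRingType) (L : R -> R) (p h : ps R).

(** Course-of-values recursion, with two uses: for R = K and L the division by a constant term it
    inverts a series; for R a ring of series in y and L the division by y^N times a unit it gives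
    the Weierstrass quotient. *)
Fixpoint rec_seq n : seq R :=
  if n is m.+1 then
    let s := rec_seq m in rcons s (L (h m - \sum_(i < m) p (m - i)%N * s`_i))
  else [::].

Definition rec_sol : ps R := fun n => (rec_seq n.+1)`_n.

Lemma size_rec_seq n : size (rec_seq n) = n.
Proof. by elim: n => //= n IH; rewrite size_rcons IH. Qed.

Lemma nth_rec_seq n i : (i < n)%N -> (rec_seq n)`_i = rec_sol i.
Proof.
elim: n => // n IH; rewrite ltnS leq_eqVlt => /orP[/eqP -> //|hi].
by rewrite /= nth_rcons size_rec_seq hi IH.
Qed.

Lemma rec_solE n : rec_sol n = L (h n - \sum_(i < n) p (n - i)%N * rec_sol i).
Proof.
rewrite {1}/rec_sol /= nth_rcons size_rec_seq ltnn eqxx; congr (L (_ - _)).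
by apply: eq_bigr => i _; rewrite nth_rec_seq.
Qed.

Variables (K : numFieldType) (N : R -> K -> Prop) (hN : subnorm N).

Lemma rec_sol_norm (s E P H : K) : 0 < s -> 0 <= E ->
  (forall x c, N x c -> N (L x) (E * c)) ->
  psnorm N s p P -> psnorm N s h H -> exists2 r, 0 < r & psnorm N r rec_sol (E * H * 2).
Proof.
move=> s0 E0 hL hp hh.
have P0 : 0 <= P := subnorm_ge0 (subnorm_psnorm hN (ltW s0)) hp.
have H0 : 0 <= H := subnorm_ge0 (subnorm_psnorm hN (ltW s0)) hh.
(* The n-th value will be bounded by E H (q/s)^n. The induction closes exactly because q - 1 = E P
   and q^n = 1 + (q - 1) (1 + q + ... + q^(n-1)). *)
set q := 1 + E * P; set t := s^-1 * q.
have t0 : 0 < t by rewrite mulr_gt0 ?invr_gt0 // ltr_pwDl // mulr_ge0.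
have hu n : N (rec_sol n) (E * H * t ^+ n).
  elim/ltn_ind: n => n IH; rewrite rec_solE.
  have e : H / s ^+ n + \sum_(i < n) P / s ^+ (n - i) * (E * H * t ^+ i) = H * t ^+ n.
    have hq : q ^+ n = 1 + E * P * \sum_(i < n) q ^+ i.
      have -> : E * P = q - 1 by rewrite addrC addKr.
      by rewrite -subrX1 addrC subrK.
    rewrite /t exprMn exprVn hq [s ^- n * _]mulrDr mulr1 [RHS]mulrDr; congr (_ + _).
    rewrite !mulr_sumr; apply: eq_bigr => i _.
    have -> : s ^- n = s ^- (n - i) * s^-1 ^+ i.
      by rewrite exprVn -invfM -exprD subnK // ltnW.
    rewrite exprMn; move: (s ^- (n - i)) (s^-1 ^+ i) (q ^+ i) => x y z; ring.
  rewrite -mulrA -e; apply: hL; apply: (subnorm_D hN); first exact: (psnorm_coef hN n s0 hh).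
  apply: (subnorm_N hN); apply: (subnorm_sum hN) => i _; apply: (subnorm_M hN).
  - exact: (psnorm_coef hN _ s0 hp).
  - exact: IH.
have r0 : 0 < (2 * t)^-1 by rewrite invr_gt0 mulr_gt0.
exists (2 * t)^-1 => //; apply: psnorm_geo hu; rewrite ?(ltW r0) ?(ltW t0) //.
  by rewrite mulr_ge0.
by rewrite mulrA divff // gt_eqF // mulr_gt0.
Qed.

End Recursion.

Section Inverse.
Variable K : fieldType.

Definition psinv (a : ps K) : ps K := rec_sol (fun x => (a 0%N)^-1 * x) a 1.

Lemma psmulV (a : ps K) : a 0%N != 0 -> a * psinv a = 1.
Proof.
move=> a0; rewrite mulrC; apply/funext => n; rewrite psM big_ord_recr /= subnn.
rewrite {2}/psinv rec_solE mulrAC mulVf // mul1r addrC.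
by under [X in _ - X + _]eq_bigr do rewrite mulrC; rewrite subrK.
Qed.

End Inverse.

Section FormalWeierstrass.
Variable K : fieldType.
Implicit Types (x : ps K) (g h : ps (ps K)).

Definition psdrop N x : ps K := fun j => x (j + N)%N.

Lemma psdropE N x : x = psX ^+ N * psdrop N x + (fun j => if (j < N)%N then x j else 0 : K).
Proof.
apply/funext => j; rewrite psD psXnM; case: ltnP => hj; first by rewrite add0r.
by rewrite addr0 /psdrop subnK.
Qed.

(** Write g(0, y) = y^N e(y) with e a unit. The coefficient of x^i of the quotient is what the
    earlier ones leave of h at x^i, divided by e and by y^N with the remainder dropped; these
    dropped parts form the remainder of degree below N in y. *)
Definition wquo N g h : ps (ps K) :=
  rec_sol (fun x => psinv (psdrop N (g 0%N)) * psdrop N x) g h.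

Lemma wquoP N g h : (forall j, (j < N)%N -> g 0%N j = 0) -> g 0%N N != 0 ->
  forall i j, (N <= j)%N -> (h - g * wquo N g h) i j = 0.
Proof.
move=> g0 gN i j hj; set u := wquo N g h; set e := psdrop N (g 0%N).
have e0 : e 0%N != 0 by [].
have ge : g 0%N = psX ^+ N * e.
  rewrite {1}[g 0%N](psdropE N) -[RHS]addr0; congr (_ + _); apply/funext => k; rewrite ps0.
  by case: ltnP => // /g0.
rewrite psB mulrC psM big_ord_recr /= subnn.
set z := h i - \sum_(k < i) g (i - k)%N * u k.
have -> : h i - (\sum_(k < i) u k * g (i - k)%N + u i * g 0%N) = z - psX ^+ N * psdrop N z.
  rewrite opprD addrA; congr (_ - _ - _).
    by apply: eq_bigr => k _; rewrite mulrC.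
  rewrite /u /wquo rec_solE -/(wquo N g h) -/u -/z -/e ge mulrCA mulrA -mulrA; congr (_ * _).
  by rewrite mulrAC [_ * e]mulrC psmulV // mul1r.
by rewrite {1}[z](psdropE N) addrC addKr ltnNge hj.
Qed.

End FormalWeierstrass.

Section Weierstrass.
Variable K : numFieldType.
Implicit Types (a f : ps K) (g h u : ps (ps K)).

Lemma convergent_inv a : a 0%N != 0 -> convergent a -> convergent (psinv a).
Proof.
move=> a0 /convergentP [s [A [s0 hA]]].
have h1 := subnorm_1 (subnorm_abs2 s0).
have hL x c : absnorm x c -> absnorm ((a 0%N)^-1 * x) (`|(a 0%N)^-1| * c).
  by rewrite /absnorm normrM => hx; rewrite ler_wpM2l.
have [r r0 hr] := rec_sol_norm (subnorm_absnorm K) s0 (normr_ge0 _) hL hA h1.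
by apply/convergentP; exists r, (`|(a 0%N)^-1| * 1 * 2).
Qed.

(** The quotient is [wquo], so convergence is the point. On series in y at radius r, dropping N
    terms costs a factor 1/r^N and dividing by the unit costs the norm E of its inverse;
    [rec_sol_norm] applies with the constant E / r^N. *)
Lemma weierstrass_division g h N : convergent2 g -> convergent2 h ->
    (forall j, (j < N)%N -> g 0%N j = 0) -> g 0%N N != 0 ->
  exists u r, [/\ convergent2 u, convergent2 r, h = g * u + r
    & forall i j, (N <= j)%N -> r i j = 0].
Proof.
move=> hg hh g0 gN; pose Q := @psdrop K N.
pose e := Q (g 0%N).
have e0 : e 0%N != 0 by [].
pose L x := psinv e * Q x.
have [s [t [A [B [s0 t0 hA hB]]]]] := convergent2_common hg hh.
have he : convergent e.
  have [M [rho [M0 [r0 hM]]]] := hg; exists (M * rho ^+ N), rho.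
  rewrite mulr_gt0 ?exprn_gt0 //; split=> //; split=> // n.
  by apply: (le_trans (hM 0%N _)); rewrite add0n exprD -mulrA [rho ^+ N * _]mulrC.
have /convergentP [t' [E [t'0 hE]]] := convergent_inv e0 he.
have [r [r0 rt rt']] := min_pos t0 t'0.
have hEr : psnorm (@absnorm K) r (psinv e) E by apply: psnorm_ler rt' hE; rewrite // ltW.
have W G X : psnorm (psnorm (@absnorm K) t) s G X -> psnorm (psnorm (@absnorm K) r) s G X.
  move=> hG n; have [c [hc hX]] := hG n; exists c; split=> // k hk.
  by apply: psnorm_ler rt (hc k hk); rewrite // ltW.
have hr := subnorm_abs2 r0.
have E0 : 0 <= E := subnorm_ge0 hr hEr.
have hQ x c : psnorm (@absnorm K) r x c -> psnorm (@absnorm K) r (Q x) (c / r ^+ N).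
  move=> hx n; have [d [hd hc]] := hx (n + N)%N; exists (fun k => d (k + N)%N); split=> [k hk|].
    by apply: hd; rewrite ltn_add2r.
  rewrite ler_pdivlMr ?exprn_gt0 //; apply: le_trans hc.
  rewrite mulr_suml addnC big_split_ord /= ler_wpDl //.
    apply: sumr_ge0 => i _; rewrite mulr_ge0 ?exprn_ge0 ?(ltW r0) //.
    by apply: (subnorm_ge0 (subnorm_absnorm K) (hd _ _)); rewrite ltn_addl.
  by apply: ler_sum => i _; rewrite -mulrA -exprD addnC.
have hL x c : psnorm (@absnorm K) r x c -> psnorm (@absnorm K) r (L x) (E / r ^+ N * c).
  by move=> hx; rewrite mulrAC -mulrA; apply: (subnorm_M hr) => //; exact: hQ.
have EN0 : 0 <= E / r ^+ N by rewrite divr_ge0 ?exprn_ge0 ?(ltW r0).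
have [r' r'0 hu] := rec_sol_norm hr s0 EN0 hL (W _ _ hA) (W _ _ hB).
pose u := rec_sol L g h.
have cu : convergent2 u by apply/convergent2P; exists r', r, (E / r ^+ N * B * 2).
exists u, (h - g * u); split=> //; first exact/convergent2D/convergent2N/convergent2M.
  by rewrite addrC subrK.
exact: (@wquoP K N g h g0 gN).
Qed.

End Weierstrass.

Section Reparametrization.
Variable K : numClosedFieldType.
Implicit Types f phi : ps K.

Lemma comp2_map (f1 f2 a : ps K) : comp2 f1 f2 (psmap (@psC K) a) = scomp f1 a.
Proof.
rewrite /comp2 /scomp /=; congr subst; apply/funext => n.
by rewrite /psmap -[LHS]/(scomp f2 (psC (a n))) scompC.
Qed.

(* With phi = X w and f = X^n f', the equation to solve is w^n f'(X w) = 1.  Writing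
   w = w0 + z, dividing z by the left-hand side minus 1 (regular of order 1 in z) leaves the solution
   as the remainder. *)
Lemma exists_root_parameter f n : (0 < n)%N -> convergent f -> ordge n f -> f n != 0 ->
  exists phi, [/\ convergent phi, phi 0%N = 0, phi 1%N != 0 & scomp phi f = psX ^+ n].
Proof.
move=> n0 cf of' fn; pose f' : ps K := fun k => f (k + n)%N.
have fE : f = psX ^+ n * f' := ordgeP of'.
pose w0 := n.-root ((f' 0%N)^-1).
have w0n : w0 ^+ n = (f' 0%N)^-1 by rewrite rootCK.
have w00 : w0 != 0.
  apply/eqP => h; move: w0n; rewrite h expr0n gtn_eqF // => /esym/eqP.
  by rewrite invr_eq0 (negbTE fn).
pose v : ps K := psC w0 + psX.
have v0 m : (v ^+ m) 0%N = w0 ^+ m.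
  by elim: m => [|m IH]; rewrite ?expr0 // !exprS psM_0 IH /v psD addr0.
have v1 : v 1%N = 1 by rewrite /v psD add0r.
(* This is v^n f'(X v), with X as outer variable and z inside v: the coefficient of X^b is f'_b
   v^(n+b). *)
pose E' : ps (ps K) := fun b => psC (f' b) * v ^+ (n + b).
pose E := E' - 1.
have cE : convergent2 E.
  apply: convergent2D; last first.
    apply: convergent2N; have -> : 1 = psC (psC 1) :> ps (ps K) by rewrite !rmorph1.
    exact/convergent2C/convergentC.
  have [M [rho [M0 [r0 hM]]]] := cf.
  have hs := subnorm_abs2 (ltr01 : 0 < 1 :> K).
  set V := `|w0| + 1.
  have V0 : 0 < V by rewrite ltr_wpDl.
  have hv : psnorm (@absnorm K) 1 v V.
    apply: (subnorm_D hs); first by apply: psnorm_C => //; exact: lexx.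
    move=> m; exists (fun k => psX k); split=> [k _|]; first by rewrite /absnorm /psX normr_nat.
    under eq_bigr do rewrite expr1n mulr1.
    case: m => [|[|m]]; rewrite ?big_ord0 ?big_ord_recl ?big_ord0 ?addr0 ?ler01 //.
    by rewrite big1 // !addr0 add0r.
  set t := rho * V.
  have t0 : 0 < t by rewrite mulr_gt0.
  apply/convergent2P; exists (2 * t)^-1, 1, (M * rho ^+ n * V ^+ n * 2).
  have s1 : 0 < (2 * t)^-1 by rewrite invr_gt0 mulr_gt0.
  have A0 : 0 <= M * rho ^+ n * V ^+ n by rewrite !mulr_ge0 ?exprn_ge0 ?ltW.
  split=> //; apply: (@psnorm_geo _ _ _ _ _ _ t); rewrite ?(ltW s1) ?(ltW t0) //.
    by rewrite mulrA divff // gt_eqF // mulr_gt0.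
  move=> k; have -> : M * rho ^+ n * V ^+ n * t ^+ k = (M * rho ^+ (k + n)) * V ^+ (n + k).
    by rewrite /t exprMn !exprD; ring.
  apply: (subnorm_M hs); last by apply: (subnorm_X hs).
  by apply: psnorm_C => //; exact: hM.
have E00 : E 0%N 0%N = 0.
  rewrite /E /E' !psB psCM addn0 ps1 eqxx mulr1n ps1 /=.
  by rewrite v0 w0n mulfV // subrr.
(* The derivative in z at the origin is n w0^(n-1) f'(0), nonzero in characteristic 0: E is regular
   of order 1 in z. *)
have E01 : E 0%N 1%N != 0.
  rewrite /E /E' !psB psCM addn0 ps1 eqxx mulr1n ps1 /= subr0 mulf_neq0 //.
  have -> : (v ^+ n) 1%N = n%:R * w0 ^+ n.-1.
    elim: (n) => [|m IH]; rewrite ?expr0 ?mul0r // exprS psM !big_ord_recl big_ord0 addr0 /=.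
    rewrite /bump /= subn0 subnn v0 IH v1 mul1r -[v 0%N]expr1 -[v]expr1 v0.
    case: m {IH} => [|m]; rewrite ?mul0r ?mulr0 ?add0r ?expr0 ?mulr1 //.
    by rewrite mulrCA -exprS -[in RHS]natr1 mulrDl mul1r.
  by rewrite mulf_neq0 ?pnatr_eq0 -?lt0n // expf_neq0.
have cz : convergent2 (psC psX : ps (ps K)) by apply/convergent2C/convergentX.
have [|u [r [cu cr zE hr]]] := weierstrass_division (N := 1) cE cz _ E01.
  by case.
pose rho : ps K := fun i => r i 0%N.
have rE : r = psmap (@psC K) rho.
  by apply/funext => i; apply/funext => -[|j] //; rewrite hr.
have z00 : (psC psX : ps (ps K)) 0%N 0%N = (E * u + r) 0%N 0%N by rewrite -zE.
have rho0 : rho 0%N = 0.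
  by move: z00; rewrite !psD psM_0 psM_0 E00 mul0r add0r.
have u00 : u 0%N 0%N != 0.
  have : (psC psX : ps (ps K)) 0%N 1%N = (E * u + r) 0%N 1%N by rewrite -zE.
  rewrite !psD psM_0 psM !big_ord_recl big_ord0 /= E00 mul0r add0r addr0 hr // addr0.
  by move=> h; apply/eqP => u0; move: h; rewrite u0 mulr0 => /eqP; rewrite oner_eq0.
pose w := psC w0 + rho.
have cr0 : convergent rho.
  have [M [t [M0 [t0 hM]]]] := cr; exists M, t; split=> //; split=> // i.
  by have := hM i 0%N; rewrite addn0.
(* Substituting z = rho(X) in z = E u + rho leaves E(X, rho) u(X, rho) = 0, and u has a nonzero
   constant term. *)
have compE : comp2 psX rho E = 0.
  have := congr1 (comp2 psX rho) zE; rewrite rE rmorphD rmorphM /= comp2C scompX comp2_map scomp_id.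
  rewrite psv_id // => /esym/eqP; rewrite -subr_eq0 addrK => /eqP h.
  have c0 : comp2 psX rho u 0%N != 0 by rewrite comp2_0.
  by rewrite -[LHS]mulr1 -(psmulV c0) mulrA h mul0r.
have vE : scomp rho v = w by rewrite rmorphD /= scompC scompX psv_id.
have comp' : comp2 psX rho E' = w ^+ n * scomp (psX * w) f'.
  apply/funext => m.
  have -> : w ^+ n * scomp (psX * w) f' = subst (psX * w) (psC (w ^+ n) * psmap (@psC K) f').
    by rewrite rmorphM /= substC.
  rewrite /comp2 /= !(@subst_sum _ _ _ m m) //; apply: eq_bigr => k _.
  rewrite psCM (@psv_id _ psX) // psv_id ?psXM0 //.
  rewrite /psmap -[(_ (E' k))]/(scomp rho (E' k)) rmorphM rmorphXn /= scompC vE exprMn exprD.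
  by congr ((_ : ps K) _); ring.
move: compE; rewrite rmorphB rmorph1 /= => /eqP; rewrite subr_eq0 comp' => /eqP h.
exists (psX * w); split; first exact/convergentM/convergentD/cr0/convergentC/convergentX.
- by rewrite psXM0.
- by rewrite psXMS /w psD rho0 addr0.
rewrite fE rmorphM rmorphXn /= scompX psv_id ?psXM0 //.
by rewrite exprMn -mulrA h mulr1.
Qed.

(** The case n = 1 of [exists_root_parameter] gives a right inverse psi of phi, and then a right
    inverse chi of psi. Associativity forces chi = phi, so psi is two-sided. *)
Lemma exists_scomp_inverse phi : convergent phi -> phi 0%N = 0 -> phi 1%N != 0 ->
  exists psi, [/\ convergent psi, psi 0%N = 0, psi 1%N != 0, scomp psi phi = psX & scomp phi psi = psX].
Proof.
move=> cp p0 p1; have o1 : ordge 1 phi by case.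
have [psi [cs s0 s1 e1]] := exists_root_parameter (ltn0Sn 0) cp o1 p1.
have o2 : ordge 1 psi by case.
have [chi [cc c0 c1 e2]] := exists_root_parameter (ltn0Sn 0) cs o2 s1.
rewrite expr1 in e1 e2; exists psi; split=> //.
suff -> : phi = chi by [].
have := scompA psi chi phi; rewrite e2 scomp_id e1 scompX psv_id //.
Qed.

End Reparametrization.

(** * The rings of convergent series *)

Section Order.
Variable R : idomainType.
Implicit Types a b : ps R.

(** A relation rather than a function: the zero series has no order, and orders are compared through
    [isord_uniq]. *)
Definition isord m a := ordge m a /\ a m != 0.

Lemma isordM m k a b : isord m a -> isord k b -> isord (m + k) (a * b).
Proof.
move=> [h1 n1] [h2 n2]; split; first exact: ordgeM.
by rewrite coef_ordgeM // mulf_neq0.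
Qed.

Lemma isord0 a : isord 0 a <-> a 0%N != 0.
Proof. by split=> [[]//|h]; split. Qed.

Lemma isord1 : isord 0 1.
Proof. by apply/isord0; rewrite ps1 oner_eq0. Qed.

Lemma isord_prod (I : Type) (r : seq I) (P : pred I) (F : I -> ps R) (m : I -> nat) :
  (forall i, P i -> isord (m i) (F i)) ->
  isord (\sum_(i <- r | P i) m i) (\prod_(i <- r | P i) F i).
Proof.
move=> h; elim/big_rec2: _ => [|i x y hi]; first exact: isord1.
by apply: isordM; exact: h.
Qed.

Lemma isord_leq m k a : isord m a -> ordge k a -> (k <= m)%N.
Proof. by move=> [_ h] hk; rewrite leqNgt; apply: contra h => /hk ->. Qed.

Lemma isord_uniq m k a : isord m a -> isord k a -> m = k.
Proof.
move=> h1 h2; apply/eqP; rewrite eqn_leq (isord_leq h1 h2.1) (isord_leq h2 h1.1) //.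
Qed.

Lemma isord_exists a : a != 0 -> exists m, isord m a.
Proof.
move=> a0; have ex : exists n, a n != 0.
  apply: contrapT => h; move/eqP: a0; apply; apply/funext => n; apply/eqP/negPn.
  by apply/negP => hn; apply: h; exists n.
exists (ex_minn ex); case: ex_minnP => m hm min; split=> // i hi; apply/eqP/negPn.
by apply/negP => /min; rewrite leqNgt hi.
Qed.

Lemma isord_neq0 m a : isord m a -> a != 0.
Proof. by move=> [_ h]; apply: contra h => /eqP ->. Qed.

Lemma isord_Xn n : isord n (psX ^+ n).
Proof. by split=> [i hi|]; rewrite psXn ?eqxx ?oner_eq0 // ltn_eqF. Qed.

Lemma isordN m a : isord m (- a) <-> isord m a.
Proof.
have W b : isord m b -> isord m (- b).
  by move=> [h1 h2]; split; [exact: ordgeN|rewrite psN oppr_eq0].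
by split=> [/W|/W //]; rewrite opprK.
Qed.

Lemma isord_scomp f a m k : (0 < m)%N -> isord m f -> isord k a -> isord (m * k) (scomp f a).
Proof.
move=> m0 [h1 h2] [h3 h4]; split; first exact: scomp_ordge.
by rewrite scomp_lead // mulf_neq0 // expf_neq0.
Qed.

End Order.

Section Subrings.
Variable K : numFieldType.

Definition conv_pred : {pred ps K} := fun a => `[< convergent a >].
Lemma conv_predP a : reflect (convergent a) (a \in conv_pred).
Proof. by apply: (iffP (asboolP _)). Qed.
Definition conv2_pred : {pred ps (ps K)} := fun g => `[< convergent2 g >].
Lemma conv2_predP g : reflect (convergent2 g) (g \in conv2_pred).
Proof. by apply: (iffP (asboolP _)). Qed.

Lemma conv_subring : subring_closed conv_pred.
Proof.
split=> [|a b /conv_predP ha /conv_predP hb|a b /conv_predP ha /conv_predP hb]; apply/conv_predP.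
- by rewrite -(rmorph1 (@psC K)); exact: convergentC.
- exact/convergentD/convergentN.
- exact: convergentM.
Qed.
HB.instance Definition _ := GRing.isSubringClosed.Build (ps K) conv_pred conv_subring.

Lemma conv2_subring : subring_closed conv2_pred.
Proof.
split=> [|a b /conv2_predP ha /conv2_predP hb|a b /conv2_predP ha /conv2_predP hb]; apply/conv2_predP.
- have -> : 1 = psC (psC 1) :> ps (ps K) by rewrite !rmorph1.
  exact/convergent2C/convergentC.
- exact/convergent2D/convergent2N.
- exact: convergent2M.
Qed.
HB.instance Definition _ := GRing.isSubringClosed.Build (ps (ps K)) conv2_pred conv2_subring.

Record cps := Cps { cval : ps K; cval_conv : cval \in conv_pred }.
HB.instance Definition _ := [isSub for cval].
HB.instance Definition _ := [Choice of cps by <:].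
HB.instance Definition _ := [SubChoice_isSubComNzRing of cps by <:].

Record cps2 := Cps2 { cval2 : ps (ps K); cval2_conv : cval2 \in conv2_pred }.
HB.instance Definition _ := [isSub for cval2].
HB.instance Definition _ := [Choice of cps2 by <:].
HB.instance Definition _ := [SubChoice_isSubComNzRing of cps2 by <:].

Lemma cvalP (a : cps) : convergent (cval a). Proof. exact/conv_predP/cval_conv. Qed.
Lemma cval2P (g : cps2) : convergent2 (cval2 g). Proof. exact/conv2_predP/cval2_conv. Qed.
Lemma cval_inj : injective cval. Proof. exact: val_inj. Qed.
Lemma cval2_inj : injective cval2. Proof. exact: val_inj. Qed.

Definition mkcps a (h : convergent a) : cps := Cps (introT (conv_predP a) h).
Definition mkcps2 g (h : convergent2 g) : cps2 := Cps2 (introT (conv2_predP g) h).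

HB.instance Definition _ := GRing.isAdditive.Build cps (ps K) cval (fun _ _ => erefl).
HB.instance Definition _ := GRing.isMultiplicative.Build cps (ps K) cval
  (conj (fun _ _ => erefl) erefl).
HB.instance Definition _ := GRing.isAdditive.Build cps2 (ps (ps K)) cval2 (fun _ _ => erefl).
HB.instance Definition _ := GRing.isMultiplicative.Build cps2 (ps (ps K)) cval2
  (conj (fun _ _ => erefl) erefl).

Definition cps_unit : pred cps := fun a => cval a 0%N != 0.
Lemma convergent_inv_or_id (a : cps) :
  convergent (if cps_unit a then psinv (cval a) else cval a).
Proof. by case: ifP => [/convergent_inv|_]; [apply|]; exact: cvalP. Qed.
Definition cps_inv (a : cps) : cps := mkcps (convergent_inv_or_id a).

Lemma cps_mulVr : {in cps_unit, left_inverse 1 cps_inv *%R}.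
Proof.
move=> a ha; apply: cval_inj; rewrite rmorphM rmorph1 /=.
by rewrite (_ : cps_unit a) // mulrC psmulV.
Qed.
Lemma cps_unitP x y : y * x = 1 -> cps_unit x.
Proof.
move=> /(congr1 cval) /(congr1 (fun f => f 0%N)); rewrite rmorphM rmorph1 psM_0 ps1 /= => h.
by apply/eqP => x0; move/eqP: h; rewrite x0 mulr0 eq_sym oner_eq0.
Qed.
Lemma cps_inv_out : {in [predC cps_unit], cps_inv =1 id}.
Proof.
move=> a; rewrite inE -[_ \in _]/(cps_unit a) => h; apply: cval_inj.
by rewrite /= (negbTE h).
Qed.
HB.instance Definition _ := GRing.ComNzRing_hasMulInverse.Build cps cps_mulVr cps_unitP cps_inv_out.

Lemma cps_unitE (a : cps) : (a \is a GRing.unit) = (cval a 0%N != 0).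
Proof. by []. Qed.

Lemma convergent_shift (a : ps K) m : convergent a -> convergent (fun n => a (n + m)%N : K).
Proof.
move=> [M [r [M0 [r0 h]]]]; exists (M * r ^+ m), r; rewrite mulr_gt0 ?exprn_gt0 //.
by split=> //; split=> // n; rewrite -mulrA -exprD addnC h.
Qed.

Lemma convergent_ordge (a : ps K) m : ordge m a -> convergent a ->
  exists c : cps, a = psX ^+ m * cval c.
Proof.
move=> oa ca; exists (mkcps (convergent_shift m ca)); exact: ordgeP.
Qed.

(** Convergent series form a discrete valuation ring: a is t^m times a unit, and b is a multiple of
    t^m. *)
Lemma cps_dvd m (a b : cps) : isord m (cval a) -> ordge m (cval b) -> exists c, b = a * c.
Proof.
move=> [oa am] ob; have [a' ea] := convergent_ordge oa (cvalP a).
have [b' eb] := convergent_ordge ob (cvalP b).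
have ua : a' \is a GRing.unit.
  by move: am; rewrite ea psXnM ltnn subnn cps_unitE.
exists (a'^-1 * b'); apply: cval_inj; rewrite rmorphM /= eb ea -mulrA; congr (_ * _).
have e : b' = a' * (a'^-1 * b') by rewrite mulrA mulrV // mul1r.
exact: (congr1 cval e).
Qed.

Definition cpsC (c : K) : cps := mkcps (convergentC c).
Lemma cpsC_additive : additive cpsC.
Proof. by move=> x y; apply: cval_inj; rewrite /= rmorphB. Qed.
Lemma cpsC_multiplicative : multiplicative cpsC.
Proof. by split=> [x y|]; apply: cval_inj; rewrite /= ?rmorphM ?rmorph1. Qed.
HB.instance Definition _ := GRing.isAdditive.Build K cps cpsC cpsC_additive.
HB.instance Definition _ := GRing.isMultiplicative.Build K cps cpsC cpsC_multiplicative.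
Definition cpsX : cps := mkcps (convergentX K).

Definition cps2C (a : cps) : cps2 := mkcps2 (convergent2C (cvalP a)).

End Subrings.
Arguments cval {K}.
Arguments cval2 {K}.
Arguments cpsX {K}.
Arguments cpsC {K}.

(** * Codimension of lattices over the ring of convergent series *)

Section Smith.
Variable K : numFieldType.
Local Notation A := (cps K).

(** Over a discrete valuation ring an entry of least order divides all the others. Moved to the
    corner and factored out, it becomes 1, and one elimination of its row and column leaves the
    smaller block w - v u. *)
Lemma smith_normal_form n (M : 'M[A]_n) : exists L R (d : 'rV[A]_n),
  [/\ L \in unitmx, R \in unitmx & M = L *m diag_mx d *m R].
Proof.
elim: n M => [|n IH] M.
  by exists 1%:M, 1%:M, 0; rewrite unitmx1; split=> //; apply/matrixP => -[].
have [->|M0] := eqVneq M 0.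
  by exists 1%:M, 1%:M, 0; rewrite unitmx1 raddf0 mulmx0 mul0mx.
have exP : exists m, [exists i, exists j, `[< isord m (cval (M i j)) >]].
  have [i [j ij]] : exists i j, M i j != 0.
    apply: contrapT => h; move/eqP: M0; apply; apply/matrixP => i j; rewrite mxE.
    by apply/eqP/negPn/negP => hn; apply: h; exists i, j.
  have [m hm] : exists m, isord m (cval (M i j)).
    by apply: isord_exists; rewrite (inj_eq (@cval_inj K) _ 0).
  by exists m; apply/existsP; exists i; apply/existsP; exists j; apply/asboolP.
case: (ex_minnP exP) => m /existsP [i /existsP [j /asboolP hij]] min.
have dvd k l : exists c, M k l = M i j * c.
  apply: cps_dvd hij _; have [->|h0] := eqVneq (M k l) 0; first by [].
  have [p hp] : exists p, isord p (cval (M k l)).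
    by apply: isord_exists; rewrite (inj_eq (@cval_inj K) _ 0).
  apply: ordge_le hp.1; apply: min.
  by apply/existsP; exists k; apply/existsP; exists l; apply/asboolP.
pose a := M i j.
(* The quotients by the pivot come from a choice; the corner quotient is therefore set to 1
   explicitly. *)
have [N MN] : exists N : 'M[A]_(1 + n), xcol 0 j (xrow 0 i M) = a *: N /\ N 0 0 = 1.
  pose c k l := projT1 (cid (dvd k l)).
  have cE k l : M k l = a * c k l by rewrite /c; case: cid.
  exists (\matrix_(k, l) (if (tperm 0 i k == i) && (tperm 0 j l == j) then 1
      else c (tperm 0 i k) (tperm 0 j l))); split; last by rewrite mxE !tpermL !eqxx.
  apply/matrixP => k l; rewrite !mxE; case: ifP => [/andP[/eqP -> /eqP ->]|_]; last exact: cE.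
  by rewrite mulr1.
case: MN => MN N00.
have hN : N = block_mx 1 (ursubmx N) (dlsubmx N) (drsubmx N).
  rewrite -[LHS]submxK; congr block_mx; apply/matrixP => x y.
  have l0 : lshift n (0 : 'I_1) = 0 by apply: val_inj.
  by rewrite !ord1 !mxE /= l0 N00.
pose u : 'rV[A]_n := ursubmx N; pose v : 'cV[A]_n := dlsubmx N; pose w : 'M[A]_n := drsubmx N.
have [L' [R' [d' [uL uR E]]]] := IH (w - v *m u).
pose L0 : 'M[A]_(1 + n) := block_mx 1%:M 0 v L'.
pose R0 : 'M[A]_(1 + n) := block_mx 1%:M u 0 R'.
have uL0 : L0 \in unitmx by rewrite unitmxE det_lblock det1 mul1r.
have uR0 : R0 \in unitmx by rewrite unitmxE det_ublock det1 mul1r.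
have NE : N = L0 *m diag_mx (row_mx (const_mx 1) d') *m R0.
  rewrite diag_mx_row /L0 /R0 !mulmx_block hN -/u -/v -/w diag_const_mx.
  rewrite !mul0mx !mulmx0 !mulmx1 !addr0 !mul0mx !add0r mul1mx addr0.
  by rewrite -E addrC subrK.
exists (tperm_mx 0 i *m L0), (R0 *m tperm_mx 0 j), (a *: (row_mx (const_mx 1) d' : 'rV[A]_(1 + n))).
rewrite !unitmx_mul !unitmx_perm uL0 uR0; split=> //.
have -> : M = tperm_mx 0 i *m (xcol 0 j (xrow 0 i M)) *m tperm_mx 0 j.
  rewrite xcolE xrowE -!mulmxA -perm_mxM tperm2 perm_mx1 mulmx1.
  by rewrite mulmxA -perm_mxM tperm2 perm_mx1 mul1mx.
set d := row_mx _ _ in NE *.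
have -> : diag_mx (a *: d) = a *: diag_mx d by rewrite linearZ.
by rewrite MN NE -!(scalemxAl, scalemxAr) !mulmxA.
Qed.

End Smith.

Section Codimension.
Variables (K : fieldType) (U : zmodType) (sc : K -> U -> U) (S : U -> Prop).

(** Linear forms whose independence is witnessed by a dual family. The scalar action is a bare
    function because in the applications scalars act through [cpsC]. *)
Definition coordinates (I : finType) (pi : I -> U -> K) :=
  [/\ forall k x y, pi k (x + y) = pi k x + pi k y,
      forall k c x, pi k (sc c x) = c * pi k x
    & forall k, exists v, forall l, pi l v = (l == k)%:R].
(** It may hold for every D, which is how infinite codimension is expressed. *)
Definition codim_ge D := exists (I : finType) (pi : I -> U -> K),
  [/\ #|I| = D, coordinates pi & forall h, S h -> forall k, pi k h = 0].
Definition has_codim D := exists (I : finType) (pi : I -> U -> K),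
  [/\ #|I| = D, coordinates pi & forall h, S h <-> forall k, pi k h = 0].
Definition codim_le n := exists v : 'I_n -> U, forall h, exists (lam : 'I_n -> K) s,
  S s /\ h = \sum_(i < n) sc (lam i) (v i) + s.

Lemma has_codim_ge D : has_codim D -> codim_ge D.
Proof. by move=> [I [pi [cI hpi hS]]]; exists I, pi; split=> // h /hS. Qed.

Lemma coordinates_sum (I : finType) (pi : I -> U -> K) : coordinates pi ->
  forall k (J : finType) (F : J -> U), pi k (\sum_j F j) = \sum_j pi k (F j).
Proof.
move=> [hD _ _] k J F; elim/big_rec2: _ => [|j x y _ <-]; last by rewrite hD.
by apply: (addrI (pi k 0)); rewrite -hD !addr0.
Qed.

(** The forms vanish on S, so their values on the n generators form an n by D matrix whose rows span
    every unit vector. Its rank is D and at most n. *)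
Lemma codim_le_ge n D : codim_le n -> codim_ge D -> (D <= n)%N.
Proof.
move=> [v hv] [I [pi [<- hpi hS]]]; have [hD hZ hs] := hpi.
pose B : 'M[K]_(n, #|I|) := \matrix_(i, k) pi (enum_val k) (v i).
suff : (1%:M <= B)%MS by move/mxrankS; rewrite mxrank1 => /leq_trans; apply; exact: rank_leq_row.
apply/row_subP => k; have [w hw] := hs (enum_val k); have [lam [s [Ss ws]]] := hv w.
apply/submxP; exists (\row_i lam i); apply/rowP => l; rewrite !mxE.
have := hw (enum_val l); rewrite (inj_eq enum_val_inj) eq_sym => <-.
rewrite ws hD (hS s Ss) addr0 coordinates_sum //; apply: eq_bigr => i _.
by rewrite hZ !mxE.
Qed.

Lemma has_codim_le D : has_codim D -> codim_le D.
Proof.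
move=> [I [pi [<- hpi hS]]]; have [hD hZ hs] := hpi.
have [v hv] := choice hs; exists (fun i => v (enum_val i)) => h.
exists (fun i => pi (enum_val i) h), (h - \sum_(i < #|I|) sc (pi (enum_val i) h) (v (enum_val i))).
split; last by rewrite addrC subrK.
apply/hS => k; apply: (addIr (pi k (\sum_(i < #|I|) sc (pi (enum_val i) h) (v (enum_val i))))).
rewrite -hD subrK add0r coordinates_sum // (bigD1 (enum_rank k)) //= hZ hv enum_rankK eqxx mulr1.
rewrite big1 ?addr0 // => i ik; rewrite hZ hv -{1}(enum_rankK k) (inj_eq enum_val_inj) eq_sym.
by rewrite (negbTE ik) mulr0.
Qed.

End Codimension.

Section CodimTransfer.
Variables (K : fieldType) (U W : zmodType) (sc : K -> U -> U) (sc' : K -> W -> W).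
Variables (T : U -> W).
Hypotheses (hTD : forall x y, T (x + y) = T x + T y) (hTZ : forall c x, T (sc c x) = sc' c (T x)).
Hypothesis hTs : forall w, exists u, T u = w.

Lemma coordinates_transfer (I : finType) (pi : I -> W -> K) :
  coordinates sc' pi -> coordinates sc (fun k x => pi k (T x)).
Proof.
move=> [hD hZ hs]; split=> [k x y|k c x|k]; rewrite ?hTD ?hTZ //.
by have [w hw] := hs k; have [u hu] := hTs w; exists u => l; rewrite hu.
Qed.

Lemma has_codim_transfer (S : U -> Prop) (S' : W -> Prop) D :
  (forall h, S h <-> S' (T h)) -> has_codim sc' S' D -> has_codim sc S D.
Proof.
move=> hS [I [pi [cI /coordinates_transfer hpi h']]].
by exists I, (fun k x => pi k (T x)); split=> // h; rewrite hS.
Qed.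

Lemma codim_ge_transfer (S : U -> Prop) (S' : W -> Prop) D :
  (forall h, S h -> S' (T h)) -> codim_ge sc' S' D -> codim_ge sc S D.
Proof.
move=> hS [I [pi [cI /coordinates_transfer hpi h']]].
by exists I, (fun k x => pi k (T x)); split=> // h /hS /h'.
Qed.

End CodimTransfer.

Section Lattice.
Variable K : numFieldType.
Local Notation A := (cps K).

Definition rVscale n (c : K) (v : 'rV[A]_n) : 'rV[A]_n := cpsC c *: v.
Definition lattice n (M : 'M[A]_n) (h : 'rV[A]_n) := exists u, h = u *m M.

Lemma cval_cpsCM (c : K) (a : A) n : cval (cpsC c * a) n = c * cval a n.
Proof. by rewrite rmorphM /= psCM. Qed.

Lemma lattice_diag n (d : 'rV[A]_n) (h : 'rV[A]_n) :
  lattice (diag_mx d) h <-> forall i, exists c, h 0 i = d 0 i * c.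
Proof.
split=> [[u ->] i|hc].
  exists (u 0 i); rewrite mxE (bigD1 i) //= mxE eqxx mulr1n big1 ?addr0 1?mulrC // => j ji.
  by rewrite mxE (negbTE ji) mulr0n mulr0.
have [c hc'] := choice hc; exists (\row_i c i); apply/rowP => i.
rewrite mxE (bigD1 i) //= !mxE eqxx mulr1n big1 ?addr0 1?mulrC // => j ji.
by rewrite !mxE (negbTE ji) mulr0n mulr0.
Qed.

(** For a diagonal lattice with entries of order m_i, the forms cutting it out are the coefficients
    below m_i of the i-th components, indexed by dependent pairs. *)
Definition row_coef n (m : 'I_n -> nat) (k : {i : 'I_n & 'I_(m i)}) (h : 'rV[A]_n) : K :=
  cval (h 0 (tag k)) (tagged k).

Lemma coefs_coordinates n (m : 'I_n -> nat) :
  @coordinates K _ (@rVscale n) _ (@row_coef n m).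
Proof.
rewrite /row_coef; split=> [k x y|k c x|[i k]]; rewrite ?mxE ?cval_cpsCM //.
exists (\row_j if j == i then cpsX ^+ k else 0) => -[j l] /=; rewrite mxE.
have [e|ij] := eqVneq j i; last first.
  by case: eqP => // e; case/eqP: ij; exact: (congr1 tag e).
case: i / e k => k; rewrite rmorphXn /= psXn; congr (nat_of_bool _)%:R.
by rewrite -tag_eqE /tag_eq /= eqxx tagged_asE.
Qed.

Lemma lattice_diag_codim n (d : 'rV[A]_n) (m : 'I_n -> nat) :
  (forall i, isord (m i) (cval (d 0 i))) ->
  has_codim (@rVscale n) (lattice (diag_mx d)) (\sum_i m i).
Proof.
move=> hd; exists {i : 'I_n & 'I_(m i)}, (@row_coef n m); split.
- by rewrite card_tagged sumnE big_map big_enum; apply: eq_bigr => i _; rewrite card_ord.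
- exact: coefs_coordinates.
move=> h; rewrite lattice_diag; split=> [hc [i k]|h0 i].
  by rewrite /row_coef /=; have [c ->] := hc i; rewrite rmorphM; exact: (ordgeMl _ (hd i).1 (ltn_ord k)).
apply: cps_dvd (hd i) _ => k hk.
exact: (h0 (Tagged (fun i => 'I_(m i)) (Ordinal hk))).
Qed.

(** All coefficients of the i-th component vanish on the lattice, and any D of them are
    independent. *)
Lemma lattice_diag_codim_infinite n (d : 'rV[A]_n) i D : d 0 i = 0 ->
  codim_ge (@rVscale n) (lattice (diag_mx d)) D.
Proof.
move=> di; pose m j := if j == i then D else 0%N.
exists {j : 'I_n & 'I_(m j)}, (@row_coef n m); split.
- rewrite card_tagged sumnE big_map big_enum (bigD1 i) //= card_ord /m eqxx.
  by rewrite big1 ?addn0 // => j ji; rewrite card_ord (negbTE ji).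
- exact: coefs_coordinates.
move=> h /lattice_diag hc [j k]; rewrite /row_coef /=; have [e|ji] := eqVneq j i.
  have dj : d 0 j = 0 by rewrite e.
  by have [c ->] := hc j; rewrite dj mul0r.
by case: k => k; rewrite /m (negbTE ji).
Qed.

Lemma lattice_mulmx n (M R : 'M[A]_n) (h : 'rV[A]_n) : R \in unitmx ->
  lattice (M *m R) h <-> lattice M (h *m invmx R).
Proof.
move=> uR; split=> [[u ->]|[u e]]; exists u; first by rewrite mulmxA mulmxK.
by rewrite mulmxA -e mulmxKV.
Qed.

Lemma lattice_mulmxl n (L M : 'M[A]_n) (h : 'rV[A]_n) : L \in unitmx ->
  lattice (L *m M) h <-> lattice M h.
Proof.
move=> uL; split=> [[u ->]|[u ->]]; first by exists (u *m L); rewrite mulmxA.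
by exists (u *m invmx L); rewrite -!mulmxA mulKmx.
Qed.

Lemma isord_unit (a : A) : a \is a GRing.unit -> isord 0 (cval a).
Proof. by rewrite cps_unitE => /isord0. Qed.

Lemma det_smith n (L R : 'M[A]_n) (d : 'rV[A]_n) :
  \det (L *m diag_mx d *m R) = \det L * \det R * \prod_i d 0 i.
Proof. by rewrite !det_mulmx det_diag mulrAC. Qed.

Lemma rVscale_mulmx n (R : 'M[A]_n) c (v : 'rV[A]_n) : rVscale c v *m R = rVscale c (v *m R).
Proof. by rewrite /rVscale scalemxAl. Qed.

(** The invertible factors of the Smith form change neither the codimension nor the order of the
    determinant; for a diagonal matrix both are the sum of the orders of the entries. *)
Theorem lattice_codim n (M : 'M[A]_n) D : isord D (cval (\det M)) ->
  has_codim (@rVscale n) (lattice M) D.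
Proof.
have [L [R [d [uL uR ->]]]] := smith_normal_form M; rewrite det_smith => hD.
have [m hm] : exists m : 'I_n -> nat, forall i, isord (m i) (cval (d 0 i)).
  suff /choice : forall i, exists k, isord k (cval (d 0 i)) by move=> [m hm]; exists m.
  move=> i; apply: isord_exists; apply: contra (isord_neq0 hD) => /eqP di.
  by rewrite (bigD1 i) //= (@cval_inj K _ 0 di) mul0r mulr0; apply/eqP.
have -> : D = (\sum_i m i)%N.
  apply: (isord_uniq hD); rewrite rmorphM rmorph_prod -[(\sum_i m i)%N]add0n; apply: isordM.
    by apply: isord_unit; rewrite unitrM -!unitmxE uL.
  exact: isord_prod.
apply: (has_codim_transfer (T := fun h => h *m invmx R)) (lattice_diag_codim hm).
- by move=> x y; rewrite mulmxDl.
- by move=> c x; exact: rVscale_mulmx.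
- by move=> w; exists (w *m R); rewrite mulmxK.
by move=> h; rewrite lattice_mulmx // lattice_mulmxl.
Qed.

Theorem lattice_codim_infinite n (M : 'M[A]_n) D : \det M = 0 ->
  codim_ge (@rVscale n) (lattice M) D.
Proof.
have [L [R [d [uL uR ->]]]] := smith_normal_form M; rewrite det_smith => h0.
have [i di] : exists i, d 0 i = 0.
  apply: contrapT => h.
  have [m hm] : exists m : 'I_n -> nat, forall i, isord (m i) (cval (d 0 i)).
    suff /choice : forall i, exists k, isord k (cval (d 0 i)) by move=> [m hm]; exists m.
  move=> i; apply: isord_exists; apply/eqP => di; apply: h; exists i.
    exact: cval_inj.
  have u0 : isord 0 (cval (\det L * \det R)).
    by apply: isord_unit; rewrite unitrM -!unitmxE uL.
  have := isord_neq0 (isordM u0 (@isord_prod K _ (index_enum _) xpredT _ m (fun i _ => hm i))).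
  by rewrite -rmorph_prod -rmorphM h0 rmorph0 eqxx.
apply: (codim_ge_transfer (T := fun h => h *m invmx R)) (lattice_diag_codim_infinite D di).
- by move=> x y; rewrite mulmxDl.
- by move=> c x; exact: rVscale_mulmx.
- by move=> w; exists (w *m R); rewrite mulmxK.
by move=> h; rewrite lattice_mulmx // lattice_mulmxl.
Qed.

End Lattice.

(** * Rotations, inflations and the embedding of polynomials *)

Section RotationInflation.
Variable R : comNzRingType.
Implicit Types a b : ps R.

Definition rotps (e : R) : ps R -> ps R := scomp (psC e * psX).
HB.instance Definition _ e := GRing.RMorphism.copy (rotps e) (scomp (psC e * psX)).
Definition infl n : ps R -> ps R := scomp (psX ^+ n).
HB.instance Definition _ n := GRing.RMorphism.copy (infl n) (scomp (psX ^+ n)).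

Lemma rotpsE e a n : rotps e a n = e ^+ n * a n.
Proof.
rewrite /rotps /scomp /= (@subst_sum _ _ _ n n) // psv_id ?psCM ?mulr0 //.
rewrite (bigD1 ord_max) //= big1 => [|i hi].
  by rewrite addr0 exprMn -rmorphXn psCM /= psCM psXn eqxx mulr1 mulrC.
rewrite exprMn -rmorphXn psCM /= psCM psXn (_ : (n == i) = false) ?mulr0 //.
by apply: contraNF hi => /eqP h; apply/eqP/val_inj.
Qed.

Lemma inflE n a k : (0 < n)%N -> infl n a k = if (n %| k)%N then a (k %/ n)%N else 0.
Proof.
move=> n0; rewrite /infl /scomp /= (@subst_sum _ _ _ k k) // psv_id; last first.
  by rewrite psXn eq_sym gtn_eqF.
have E i : (psmap (@psC R) a i * (psX ^+ n) ^+ i) k = a i * (k == (n * i)%N)%:R.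
  by rewrite psCM -exprM psXn.
under eq_bigr do rewrite E; case: ifP => hk; last first.
  rewrite big1 // => i _; case: eqP => [e|_]; last by rewrite mulr0.
  by rewrite e dvdn_mulr in hk.
have hq : (k %/ n < k.+1)%N by rewrite ltnS leq_div.
rewrite (bigD1 (Ordinal hq)) //= mulnC divnK // eqxx mulr1 big1 ?addr0 // => i hi.
case: eqP => [e|_]; last by rewrite mulr0.
by case/eqP: hi; apply: val_inj; rewrite /= -[in LHS](mulKn i n0) -e.
Qed.

Lemma infl_inj n : (0 < n)%N -> injective (infl n).
Proof.
move=> n0 a b h; apply/funext => k; have := congr1 (fun f => f (n * k)%N) h.
by rewrite !inflE // dvdn_mulr // mulKn.
Qed.

Lemma infl_infl m n a : (0 < m)%N -> infl m (infl n a) = infl (m * n) a.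
Proof.
move=> m0; rewrite /infl scompA rmorphXn /= scompX psv_id ?exprM //.
by rewrite psXn eq_sym gtn_eqF.
Qed.

(** For j < n, the component of a along t^j in the basis 1, t, ..., t^(n-1) over the series in
    t^n. *)
Definition dec n j a : ps R := fun k => a (n * k + j)%N.

Lemma dec_sumE n (c : 'I_n -> ps R) (j : 'I_n) :
  dec n j (\sum_(i < n) infl n (c i) * psX ^+ i) = c j.
Proof.
have n0 : (0 < n)%N := leq_ltn_trans (leq0n j) (ltn_ord j).
apply/funext => k; rewrite /dec ps_sum (bigD1 j) //= mulrC psXnM ltnNge leq_addl addnK.
rewrite inflE // dvdn_mulr // mulKn // big1 ?addr0 // => i ij.
rewrite mulrC psXnM; case: ltnP => // hi; rewrite inflE //; case: ifP => // hd.
case/eqP: ij; apply: val_inj; apply/eqP.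
have : (n * k + j == i %[mod n])%N by rewrite eqn_mod_dvd.
by rewrite mulnC modnMDl !modn_small // eq_sym.
Qed.

Lemma decE n a : (0 < n)%N -> a = \sum_(i < n) infl n (dec n i a) * psX ^+ i.
Proof.
move=> n0; apply/funext => k; rewrite ps_sum.
have hm : (k %% n < n)%N by rewrite ltn_mod.
rewrite (bigD1 (Ordinal hm)) //= mulrC psXnM ltnNge leq_mod /=.
have e : (k - k %% n = n * (k %/ n))%N by rewrite {1}(divn_eq k n) addnK mulnC.
rewrite inflE // e dvdn_mulr // mulKn // /dec mulnC -divn_eq big1 ?addr0 // => i ij.
rewrite mulrC psXnM; case: ltnP => // hi; rewrite inflE //; case: ifP => // hd.
case/eqP: ij; apply: val_inj; apply/eqP => /=.
have : (k == i %[mod n])%N by rewrite eqn_mod_dvd.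
by rewrite (modn_small (ltn_ord i)) eq_sym.
Qed.

Lemma rotps_infl n e a : (0 < n)%N -> e ^+ n = 1 -> rotps e (infl n a) = infl n a.
Proof.
move=> n0 en; apply/funext => k; rewrite rotpsE inflE //; case: ifP => [/dvdnP[m ->]|]; last by rewrite mulr0.
by rewrite mulnC exprM en expr1n mul1r.
Qed.

Lemma rotps_rotps e f a : rotps e (rotps f a) = rotps (e * f) a.
Proof. by apply/funext => k; rewrite !rotpsE exprMn mulrA. Qed.

Lemma rotps1 a : rotps 1 a = a.
Proof. by apply/funext => k; rewrite rotpsE expr1n mul1r. Qed.

Lemma rotps_X e : rotps e psX = psC e * psX.
Proof. by rewrite /rotps scompX psv_id // psCM mulr0. Qed.

End RotationInflation.

Lemma isord_rotps (K : fieldType) (e : K) (a : ps K) m : e != 0 -> isord m a -> isord m (rotps e a).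
Proof.
move=> e0 [h1 h2]; split=> [i hi|]; rewrite rotpsE; first by rewrite h1 // mulr0.
by rewrite mulf_neq0 // expf_neq0.
Qed.

Lemma isord_infl (K : fieldType) n (a : ps K) m : (0 < n)%N -> isord m a -> isord (n * m) (infl n a).
Proof. by move=> n0; apply: isord_scomp => //; exact: isord_Xn. Qed.

Lemma convergent_dec (K : numFieldType) n j (a : ps K) : convergent a -> convergent (dec n j a).
Proof.
move=> [M [r [M0 [r0 h]]]]; exists (M * r ^+ j), (r ^+ n); rewrite mulr_gt0 ?exprn_gt0 //.
by split=> //; split=> // k; rewrite -mulrA -exprM -exprD addnC h.
Qed.

Section Embedding.
Variable K : numFieldType.
Local Notation A := (cps K).
Local Notation O := (cps2 K).

Definition cps2X (a : A) : O := mkcps2 (convergent2_map (cvalP a)).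
Lemma cps2X_additive : additive cps2X.
Proof. by move=> a b; apply: cval2_inj; rewrite /= !rmorphB. Qed.
Lemma cps2X_multiplicative : multiplicative cps2X.
Proof. by split=> [a b|]; apply: cval2_inj; rewrite /= ?rmorphM ?rmorph1. Qed.
HB.instance Definition _ := GRing.isAdditive.Build A O cps2X cps2X_additive.
HB.instance Definition _ := GRing.isMultiplicative.Build A O cps2X cps2X_multiplicative.

(* The second variable of O = K{x, y} is the variable of the coefficient series. *)
Definition cps2Y : O := cps2C cpsX.

Definition emb (p : {poly A}) : O := (map_poly cps2X p).[cps2Y].

Lemma embD p q : emb (p + q) = emb p + emb q. Proof. by rewrite /emb rmorphD hornerD. Qed.
Lemma embM p q : emb (p * q) = emb p * emb q. Proof. by rewrite /emb rmorphM hornerM. Qed.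
Lemma embZ a p : emb (a *: p) = cps2X a * emb p.
Proof. by rewrite /emb map_polyZ hornerZ. Qed.
Lemma emb0 : emb 0 = 0. Proof. by rewrite /emb rmorph0 horner0. Qed.
Lemma embN p : emb (- p) = - emb p. Proof. by rewrite /emb rmorphN hornerN. Qed.

Lemma embC c : emb c%:P = cps2X c. Proof. by rewrite /emb map_polyC hornerC. Qed.
Lemma embX : emb 'X = cps2Y. Proof. by rewrite /emb map_polyX hornerX. Qed.

Lemma emb_coef p i j : cval2 (emb p) i j = cval p`_j i.
Proof.
elim/poly_ind: p i j => [|p c IH] i j; first by rewrite emb0 coef0.
rewrite embD embM embX embC (rmorphD cval2) (rmorphM cval2) !psD coefD coefMX coefC.
rewrite [_ * cval2 cps2Y]mulrC psCM (rmorphD cval) psD; case: j => [|j].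
  by rewrite psXM0 (rmorph0 cval) !add0r.
rewrite psXMS; congr (_ + _); exact: IH.
Qed.

Lemma cval2D_coef (g h : O) i j : cval2 (g + h) i j = cval2 g i j + cval2 h i j.
Proof. by []. Qed.
Lemma cval2M_coef (g h : O) i : cval2 (g * h) i = \sum_(k < i.+1) cval2 g k * cval2 h (i - k)%N.
Proof. by []. Qed.

Lemma emb_inj : injective emb.
Proof.
move=> p q e; apply/polyP => j; apply: cval_inj; apply/funext => i.
by rewrite -!emb_coef e.
Qed.

Lemma exists_poly_emb (r : O) N : (forall i j, (N <= j)%N -> cval2 r i j = 0) ->
  exists2 p : {poly A}, (size p <= N)%N & r = emb p.
Proof.
move=> hr; have cr j : convergent (fun i => cval2 r i j : K).
  have [M [t [M0 [t0 h]]]] := cval2P r; exists (M * t ^+ j), t; rewrite mulr_gt0 ?exprn_gt0 //.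
  by split=> //; split=> // i; rewrite -mulrA -exprD addnC h.
exists (\poly_(j < N) mkcps (cr j)); first exact: size_poly.
apply: cval2_inj; apply/funext => i; apply/funext => j; rewrite emb_coef coef_poly.
by case: ltnP => // hj; rewrite hr.
Qed.

(** Weierstrass polynomials in y: at x = 0 they reduce to y^N. *)
Definition distinguished N (p : {poly A}) :=
  [/\ p \is monic, size p = N.+1 & forall j, (j < N)%N -> cval p`_j 0%N = 0].

Lemma emb_division N p (h : O) : distinguished N p ->
  exists (u : O) (r : {poly A}), (size r <= N)%N /\ h = emb p * u + emb r.
Proof.
move=> [mp sp p0].
have pN : p`_N = 1 by move/monicP: mp; rewrite /lead_coef sp.
have [||u [r [cu cr e hr]]] := @weierstrass_division _ (cval2 (emb p)) (cval2 h) N (cval2P _) (cval2P _).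
- by move=> j hj; rewrite emb_coef p0.
- by rewrite emb_coef pN rmorph1 oner_eq0.
have [q sq eq] := @exists_poly_emb (mkcps2 cr) N hr.
by exists (mkcps2 cu), q; split=> //; apply: cval2_inj; rewrite -eq.
Qed.

(** Induction on the degree in x: once the earlier coefficients of u vanish, the equation at x^i
    reads y^N u_i + r_i = 0, where r_i has degree below N in y. *)
Lemma emb_division_uniq N p (u : O) (r : {poly A}) : distinguished N p -> (size r <= N)%N ->
  emb p * u + emb r = 0 -> u = 0 /\ r = 0.
Proof.
move=> [mp sp p0] sr e.
have pN : p`_N = 1 by move/monicP: mp; rewrite /lead_coef sp.
have pE j : cval2 (emb p) 0%N j = (j == N)%:R.
  rewrite emb_coef; case: ltngtP => hj; first by rewrite p0.
    by rewrite nth_default ?sp.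
  by rewrite hj pN rmorph1.
have pX : cval2 (emb p) 0%N = psX ^+ N by apply/funext => j; rewrite pE psXn.
suff u0 : u = 0.
  split=> //; apply: emb_inj; rewrite emb0.
  by move: e; rewrite u0 mulr0 add0r.
apply: cval2_inj; apply/funext => i; elim/ltn_ind: i => i IH; apply/funext => j.
have : cval2 (emb p * u + emb r) i (j + N)%N = 0 by rewrite e.
rewrite cval2D_coef cval2M_coef emb_coef nth_default ?(leq_trans sr) ?leq_addl //.
have -> : cval (0 : A) i = 0 by []. rewrite addr0 big_ord_recl /= subn0 psD ps_sum big1 => [|k _].
  by rewrite addr0 pX psXnM ltnNge leq_addl /= addnK.
by rewrite IH ?mulr0 //= /bump /= ltn_subrL add1n //; case: i k {IH} => [[]|].
Qed.

End Embedding.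

(** * The delta-invariant of (t^n, F) *)

Lemma triangular_sum (G : nat -> nat) n :
  (\sum_(i < n) \sum_(j < n | i < j) G (j - i) = \sum_(1 <= d < n) (n - d) * G d)%N.
Proof.
elim: n => [|n IH]; first by rewrite big_ord0 big_geq.
rewrite big_ord_recr /= [X in (_ + X)%N]big1 ?addn0; last first.
  by move=> j; rewrite ltnNge -ltnS ltn_ord.
under eq_bigr => i _ do rewrite big_mkcond big_ord_recr -big_mkcond /= ltn_ord.
rewrite big_split /= IH.
have -> : (\sum_(i < n) G (n - i) = \sum_(1 <= d < n.+1) G d)%N.
  rewrite big_add1 /= big_mkord (reindex_inj rev_ord_inj) /=; apply: eq_bigr => i _.
  by rewrite subKn.
case: n {IH} => [|n]; first by rewrite !big_geq.
rewrite [RHS]big_nat_recr //= subSnn mul1n [X in (_ + X)%N]big_nat_recr //= addnA.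
congr addn; rewrite -big_split /=; apply: eq_big_nat => d /andP[_ hd].
by rewrite [in RHS]subSn 1?ltnW // mulSn addnC.
Qed.

(** A difference d occurs for n - d pairs; pairing d with n - d averages this weight to n/2. The
    contact orders have the required symmetry by [order_sym]. *)
Lemma triangular_sum_sym (G : nat -> nat) n :
  (forall d, 0 < d < n -> G (n - d) = G d)%N ->
  (2 * \sum_(i < n) \sum_(j < n | i < j) G (j - i) = n * \sum_(1 <= d < n) G d)%N.
Proof.
move=> hG; rewrite triangular_sum mul2n -addnn {2}big_nat_rev /= -big_split /= big_distrr /=.
apply: eq_big_nat => d /andP[d1 dn]; rewrite add1n subSS.
by rewrite hG ?d1 // subKn 1?ltnW // -mulnDl subnK // ltnW.
Qed.

Lemma sum_offdiag (w : nat -> nat -> nat) n : (forall i j, w i j = w j i) ->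
  (\sum_(i < n) \sum_(j < n | j != i) w i j = 2 * \sum_(i < n) \sum_(j < n | i < j) w i j)%N.
Proof.
move=> ws; transitivity (\sum_(i < n) (\sum_(j < n | i < j) w i j + \sum_(j < n | j < i) w i j))%N.
  apply: eq_bigr => i _; rewrite (bigID (fun j : 'I_n => (i < j)%N)) /=.
  by congr addn; apply: eq_bigl => j; rewrite -(inj_eq val_inj) /=; case: ltngtP.
rewrite big_split mul2n -addnn /=; congr addn.
rewrite (exchange_big_dep predT) //=; apply: eq_bigr => i _; apply: eq_bigr => j _.
exact: ws.
Qed.

Lemma exists_prim_root (K : numClosedFieldType) n : (0 < n)%N -> exists z : K, n.-primitive_root z.
Proof.
move=> n_gt0; pose p : {poly K} := 'X^n - 1; have [r Dp] := closed_field_poly_normal p.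
rewrite (monicP _) ?monicXnsubC // scale1r in Dp.
have rn1 : all n.-unity_root r by apply/allP => z; rewrite -root_prod_XsubC -Dp.
have sz_r : (n < (size r).+1)%N by rewrite -(size_prod_XsubC r id) -Dp size_XnsubC.
have [|z _ hz] := hasP (has_prim_root n_gt0 rn1 _ sz_r); last by exists z.
by rewrite -separable_prod_XsubC -Dp separable_Xn_sub_1 // pnatr_eq0 -lt0n.
Qed.

Section NormalForm.
Variables (K : numClosedFieldType) (n : nat) (e : K) (F : cps K).
Hypotheses (n_gt0 : (0 < n)%N) (prim_e : n.-primitive_root e) (F0 : cval F 0%N = 0).
Local Notation A := (cps K).
Local Notation O := (cps2 K).
Local Notation theta := (infl n \o @cval K).

Let e0 : e != 0.
Proof. by apply/eqP => h; move: (prim_expr_order prim_e); rewrite h expr0n gtn_eqF // => /eqP; rewrite eq_sym oner_eq0. Qed.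

Definition conjps j : ps K := rotps (e ^+ j) (cval F).

Lemma conjps0 : conjps 0 = cval F. Proof. by rewrite /conjps expr0 rotps1. Qed.
Lemma conjpsD i j : conjps (i + j) = rotps (e ^+ i) (conjps j).
Proof. by rewrite /conjps rotps_rotps -exprD. Qed.
Lemma conjps_n : conjps n = cval F.
Proof. by rewrite /conjps (prim_expr_order prim_e) rotps1. Qed.
Lemma conjps_cst j : conjps j 0%N = 0. Proof. by rewrite /conjps rotpsE F0 mulr0. Qed.

Definition decA j (a : A) : A := mkcps (convergent_dec n j (cvalP a)).
Definition decrow (a : A) : 'rV[A]_n := \row_j decA j a.
(** Row i holds the components of F^i in the basis 1, t, ..., t^(n-1) over series in t^n, with t^n
    read as the variable; the rows span the image of the pullback. *)
Definition powmx : 'M[A]_n := \matrix_(i, j) decA j (F ^+ i).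

Lemma cvalE (a : A) : cval a = \sum_(j < n) theta (decrow a 0 j) * psX ^+ j.
Proof. by rewrite {1}(decE (cval a) n_gt0); apply: eq_bigr => j _; rewrite mxE. Qed.

Lemma decrow_uniq (a : A) (v : 'rV[A]_n) : cval a = \sum_(j < n) theta (v 0 j) * psX ^+ j ->
  decrow a = v.
Proof.
move=> h; apply/rowP => j; apply: cval_inj; rewrite mxE /= h.
exact: (dec_sumE (fun j => cval (v 0 j))).
Qed.

Lemma decrowD a b : decrow (a + b) = decrow a + decrow b.
Proof.
apply: decrow_uniq; rewrite rmorphD /= {1}(cvalE a) {1}(cvalE b) -big_split; apply: eq_bigr => j _.
rewrite [(_ + _ : 'rV_n) 0 j]mxE -[infl n _]/(theta (decrow a 0 j + decrow b 0 j)) (rmorphD theta).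
exact/esym/mulrDl.
Qed.

Lemma decrowZ c a : decrow (cpsC c * a) = rVscale c (decrow a).
Proof.
apply: decrow_uniq; rewrite rmorphM /= {1}(cvalE a) mulr_sumr; apply: eq_bigr => j _.
rewrite [(rVscale _ _) 0 j]mxE -[infl n _]/(theta (cpsC c * decrow a 0 j)) (rmorphM theta) mulrA; congr (_ * _ * _).
by rewrite /= /infl scompC.
Qed.

Lemma decrow_surj v : exists a, decrow a = v.
Proof.
have ct (a : A) : convergent (theta a).
  apply: convergent_scomp (cvalP a); elim: (n) => [|m IH].
    by rewrite expr0 -(rmorph1 (@psC K)); exact: convergentC.
  by rewrite exprS; apply: convergentM => //; exact: convergentX.
exists (\sum_(j < n) mkcps (ct (v 0 j)) * cpsX ^+ j); apply: decrow_uniq.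
by rewrite rmorph_sum; apply: eq_bigr => j _; rewrite rmorphM rmorphXn.
Qed.

(** Rotate the expansion of F^i in powers of t by e^l: its coefficients are series in t^n, hence
    fixed, and only the powers of t change. Collected over all i and l this is a product of
    matrices. *)
Lemma powmx_vandermonde : map_mx theta powmx *m Vandermonde n (\row_(j < n) (psC (e ^+ j) * psX)) =
  Vandermonde n (\row_(j < n) conjps j).
Proof.
apply/matrixP => i l; rewrite [LHS]mxE [RHS]mxE [(\row_(_ < _) _) 0 l]mxE /conjps -(rmorphXn (rotps (e ^+ l))).
have -> : cval F ^+ i = \sum_(j < n) theta (decrow (F ^+ i) 0 j) * psX ^+ j.
  by rewrite -cvalE rmorphXn.
rewrite (rmorph_sum (rotps (e ^+ l))); apply: eq_bigr => j _.
rewrite (rmorphM (rotps (e ^+ l))) !mxE (rmorphXn (rotps (e ^+ l))) /= rotps_X rotps_infl //.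
by rewrite -exprM mulnC exprM (prim_expr_order prim_e) expr1n.
Qed.

Lemma det_powmx : theta (\det powmx) *
    (\prod_(i < n) \prod_(j < n | (i < j)%N) (psC (e ^+ j) * psX - psC (e ^+ i) * psX)) =
  \prod_(i < n) \prod_(j < n | (i < j)%N) (conjps j - conjps i).
Proof.
have := congr1 determinant powmx_vandermonde; rewrite det_mulmx det_map_mx !det_Vandermonde => h.
transitivity (theta (\det powmx) * \prod_(i < n) \prod_(j < n | (i < j)%N)
   ((\row_(j < n) (psC (e ^+ j) * psX)) 0 j - (\row_(j < n) (psC (e ^+ j) * psX)) 0 i)).
  by congr (_ * _); apply: eq_bigr => i _; apply: eq_bigr => j _; rewrite !mxE.
by rewrite h; apply: eq_bigr => i _; apply: eq_bigr => j _; rewrite !mxE.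
Qed.

Lemma isord_conj_diff (o : nat -> nat) i j : (i < j < n)%N ->
  (forall d, (0 < d < n)%N -> isord (o d) (conjps d - cval F)) ->
  isord (o (j - i)%N) (conjps j - conjps i).
Proof.
move=> /andP[ij jn] ho.
have -> : conjps j = rotps (e ^+ i) (conjps (j - i)) by rewrite -conjpsD subnKC // ltnW.
have -> : conjps i = rotps (e ^+ i) (cval F) by rewrite -conjps0 -conjpsD addn0.
rewrite -rmorphB.
apply: isord_rotps; first exact: expf_neq0.
by apply: ho; rewrite subn_gt0 ij (leq_ltn_trans (leq_subr _ _)).
Qed.

Lemma isord_root_diff i j : (i < j < n)%N ->
  isord 1 (psC (e ^+ j) * psX - psC (e ^+ i) * psX).
Proof.
move=> /andP[ij jn]; rewrite -mulrBl -rmorphB -[1%N]add0n; apply: isordM; last first.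
  by rewrite -[psX]expr1; exact: isord_Xn.
apply/isord0; rewrite /= subr_eq0 (eq_prim_root_expr prim_e) !modn_small ?gtn_eqF //.
exact: ltn_trans jn.
Qed.

(** Rotating F(e^d t) - F(t) by e^(n-d) gives F(t) - F(e^(n-d) t), and rotation preserves orders. *)
Lemma order_sym (o : nat -> nat) d : (0 < d < n)%N ->
  (forall d, (0 < d < n)%N -> isord (o d) (conjps d - cval F)) -> o (n - d)%N = o d.
Proof.
move=> /andP[d0 dn] ho; have hd := ho _ (introT andP (conj d0 dn)).
have hnd : (0 < n - d < n)%N by rewrite subn_gt0 dn ltn_subrL d0 n_gt0.
apply: (isord_uniq (ho _ hnd)).
have -> : cval F = rotps (e ^+ (n - d)) (conjps d) by rewrite -conjpsD subnK ?conjps_n // ltnW.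
have -> : conjps (n - d) = rotps (e ^+ (n - d)) (cval F) by rewrite -conjps0 -conjpsD addn0.
rewrite -rmorphB.
by apply: isord_rotps; [exact: expf_neq0|rewrite -isordN opprB].
Qed.

(** Orders in [det_powmx]: [theta] multiplies the order D of the determinant by n, each of the
    n(n-1)/2 differences e^j t - e^i t has order 1, and the right side sums o(j - i) over pairs.
    After doubling, n cancels. *)
Lemma isord_det_powmx (o : nat -> nat) :
  (forall d, (0 < d < n)%N -> isord (o d) (conjps d - cval F)) ->
  exists2 D, isord D (cval (\det powmx)) & (2 * D + n.-1 = \sum_(1 <= d < n) o d)%N.
Proof.
move=> ho.
have hR : isord (\sum_(i < n) \sum_(j < n | (i < j)%N) o (j - i))%N
    (\prod_(i < n) \prod_(j < n | (i < j)%N) (conjps j - conjps i)).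
  apply: isord_prod => i _; apply: isord_prod => j ij.
  by apply: isord_conj_diff; rewrite ?ij //=.
have hL : isord (\sum_(i < n) \sum_(j < n | (i < j)%N) 1)%N
    (\prod_(i < n) \prod_(j < n | (i < j)%N) (psC (e ^+ j) * psX - psC (e ^+ i) * psX)).
  apply: isord_prod => i _; apply: isord_prod => j ij.
  by apply: isord_root_diff; rewrite ij /=.
have [|D hD] := @isord_exists K (cval (\det powmx)).
  by apply/eqP => h; move: (isord_neq0 hR); rewrite -det_powmx /= h rmorph0 mul0r eqxx.
exists D => //.
have E : (n * D + \sum_(i < n) \sum_(j < n | (i < j)%N) 1 =
    \sum_(i < n) \sum_(j < n | (i < j)%N) o (j - i))%N.
  apply: (isord_uniq _ hR); rewrite -det_powmx; apply: isordM hL.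
  exact: isord_infl.
have := congr1 (muln 2) E; rewrite mulnDr triangular_sum_sym; last first.
  by move=> d hd; exact: order_sym.
rewrite (triangular_sum_sym (G := fun=> 1%N)) // sum_nat_const_nat muln1 mulnCA -mulnDr.
by move/eqP; rewrite eqn_pmul2l // subn1 => /eqP.
Qed.

Lemma det_powmx0 d : (0 < d < n)%N -> conjps d = cval F -> \det powmx = 0.
Proof.
move=> /andP[d0 dn] h; apply: contrapT => /eqP det0.
have [|D hD] := @isord_exists K (cval (\det powmx)).
  by rewrite (inj_eq (@cval_inj K) _ 0).
have hL : isord (\sum_(i < n) \sum_(j < n | (i < j)%N) 1)%N
    (\prod_(i < n) \prod_(j < n | (i < j)%N) (psC (e ^+ j) * psX - psC (e ^+ i) * psX)).
  apply: isord_prod => i _; apply: isord_prod => j ij.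
  by apply: isord_root_diff; rewrite ij /=.
have := isord_neq0 (isordM (isord_infl n_gt0 hD) hL); rewrite [infl n _ * _]det_powmx.
rewrite (bigD1 (Ordinal n_gt0)) //= (bigD1 (Ordinal dn)) //= h conjps0 subrr.
by rewrite !mul0r eqxx.
Qed.

End NormalForm.

Section ImagePolynomial.
Variables (K : numClosedFieldType) (n : nat) (e : K) (F : cps K).
Hypotheses (n_gt0 : (0 < n)%N) (prim_e : n.-primitive_root e) (F0 : cval F 0%N = 0).
Local Notation A := (cps K).
Local Notation O := (cps2 K).
Local Notation theta := (infl n \o @cval K).
Local Notation Fc := (conjps e F).

Definition coef_at0 (a : ps K) : K := a 0%N.
Lemma coef_at0_additive : additive coef_at0. Proof. by []. Qed.
Lemma coef_at0_multiplicative : multiplicative coef_at0.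
Proof. by split=> // a b; exact: psM_0. Qed.
HB.instance Definition _ := GRing.isAdditive.Build (ps K) K coef_at0 coef_at0_additive.
HB.instance Definition _ := GRing.isMultiplicative.Build (ps K) K coef_at0 coef_at0_multiplicative.

Definition conjpoly : {poly ps K} := \prod_(l < n) ('X - (Fc l)%:P).

Lemma conjpoly_rot : map_poly (rotps e) conjpoly = conjpoly.
Proof.
rewrite /conjpoly rmorph_prod /=.
rewrite [RHS](reindex_inj (@ordS_inj n)) /=; apply: eq_bigr => l _.
rewrite rmorphB /= map_polyX map_polyC /= -[e in rotps e]expr1 -conjpsD add1n.
have [h|h] := ltnP l.+1 n; first by rewrite modn_small.
have -> : l.+1 = n by apply/eqP; rewrite eqn_leq h ltn_ord.
by rewrite modnn conjps0 conjps_n.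
Qed.

Lemma conjpoly_conv : conjpoly \is a polyOver (@conv_pred K).
Proof.
apply: rpred_prod => l _; rewrite polyOverXsubC; apply/conv_predP.
apply: convergent_scomp (cvalP F); apply: convergentM; [exact: convergentC|exact: convergentX].
Qed.

(** The coefficient is fixed by t -> e t, so its term of degree m vanishes unless e^m = 1, that is,
    unless n divides m. *)
Lemma conjpoly_coef k : conjpoly`_k = infl n (dec n 0 conjpoly`_k).
Proof.
apply/funext => m; rewrite inflE // /dec addn0; case: ifP => h.
  by rewrite mulnC divnK.
have : rotps e conjpoly`_k m = conjpoly`_k m.
  by rewrite -(coef_map (rotps e)) conjpoly_rot.
rewrite rotpsE => /eqP; rewrite -subr_eq0 -{2}[conjpoly`_k m]mul1r -mulrBl mulf_eq0 => /orP[|/eqP //].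
by rewrite subr_eq0 -(prim_order_dvd prim_e) h.
Qed.

Definition image_poly : {poly A} :=
  \poly_(k < n.+1) mkcps (convergent_dec n 0 (conv_predP _ (polyOverP conjpoly_conv k))).

Lemma size_conjpoly : size conjpoly = n.+1.
Proof. by rewrite /conjpoly -big_enum size_prod_XsubC size_enum_ord. Qed.

Lemma image_polyE : map_poly theta image_poly = conjpoly.
Proof.
apply/polyP => k; rewrite coef_map coef_poly; case: ltnP => h.
  by rewrite /= -conjpoly_coef.
by rewrite [RHS]nth_default ?size_conjpoly //; exact: (rmorph0 theta).
Qed.

Lemma image_poly_distinguished : distinguished n image_poly.
Proof.
have pn : image_poly`_n = 1.
  apply: cval_inj; apply: (@infl_inj _ n n_gt0).
  rewrite -[LHS]/(theta image_poly`_n) -coef_map image_polyE.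
  have := monic_prod_XsubC (index_enum 'I_n) xpredT (fun l : 'I_n => Fc l).
  by rewrite monicE lead_coefE -/conjpoly size_conjpoly !rmorph1 => /eqP.
have sz : size image_poly = n.+1.
  apply/eqP; rewrite eqn_leq size_poly ltnNge; apply/negP => /leq_sizeP/(_ n (leqnn _)).
  by rewrite pn => /eqP; rewrite oner_eq0.
split=> //; first by rewrite monicE lead_coefE sz pn.
move=> j jn; rewrite -(scomp_0 (psX ^+ n)) -[scomp _ _]/(theta image_poly`_j).
rewrite -coef_map image_polyE -[_ 0%N]/(coef_at0 _) -coef_map /conjpoly rmorph_prod /=.
rewrite (eq_bigr (fun=> 'X)) => [|l _].
  by rewrite prodr_const card_ord coefXn ltn_eqF.
by rewrite rmorphB /= map_polyX map_polyC /= /coef_at0 conjps_cst // subr0.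
Qed.

Lemma comp2_emb (p : {poly A}) : comp2 (psX ^+ n) (cval F) (cval2 (emb p)) = (map_poly theta p).[cval F].
Proof.
rewrite /emb -[LHS]/((comp2 (psX ^+ n) (cval F) \o @cval2 K) _) -horner_map -map_poly_comp /=.
rewrite comp2C scompX psv_id //; congr (_.[_]); apply: eq_map_poly => a /=.
by rewrite comp2_map.
Qed.

Lemma image_poly_root l : (map_poly theta image_poly).[Fc l] = 0.
Proof.
have -> : Fc l = Fc (l %% n).
  rewrite {1}(divn_eq l n) addnC conjpsD.
  suff -> : Fc (l %/ n * n) = cval F by rewrite -(conjps0 e F) -conjpsD addn0.
  by rewrite /conjps mulnC exprM (prim_expr_order prim_e) expr1n rotps1.
have hl : (l %% n < n)%N by rewrite ltn_mod.
rewrite image_polyE /conjpoly horner_prod (bigD1 (Ordinal hl)) //=.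
by rewrite !hornerE subrr mul0r.
Qed.

Lemma cval_decrow_sum (p : {poly A}) : (size p <= n)%N ->
  (map_poly theta p).[cval F] = \sum_(j < n) theta (((\row_(i < n) p`_i) *m powmx n F) 0 j) * psX ^+ j.
Proof.
move=> sp; have sp' : (size (map_poly theta p) <= n)%N by exact: leq_trans (size_poly _ _) sp.
rewrite (horner_coef_wide _ sp').
under [RHS]eq_bigr => j _ do rewrite mxE rmorph_sum mulr_suml.
rewrite exchange_big /=; apply: eq_bigr => i _.
rewrite coef_map -(rmorphXn (@cval K)) /= (cvalE n_gt0 (F ^+ i)) mulr_sumr.
by apply: eq_bigr => j _; rewrite !mxE mulrA -(rmorphM (infl n)) -(rmorphM (@cval K)).
Qed.

(** The image polynomial vanishes at (t^n, F), so Weierstrass division by it replaces g by a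
    remainder of degree below n in y, whose pullback is a combination of 1, F, ..., F^(n-1) over
    series in t^n. *)
Lemma pullback_lattice (h : A) :
  (exists g : O, cval h = comp2 (psX ^+ n) (cval F) (cval2 g)) <-> lattice (powmx n F) (decrow n h).
Proof.
split=> [[g hg]|[u hu]].
  have [w [r [sr e1]]] := emb_division g image_poly_distinguished.
  exists (\row_i r`_i); apply: decrow_uniq => //; rewrite hg e1 -cval_decrow_sum //.
  rewrite (rmorphD (@cval2 K)) (rmorphM (@cval2 K)) rmorphD rmorphM /= !comp2_emb.
  by rewrite -(conjps0 e F) image_poly_root mul0r add0r.
pose p : {poly A} := \poly_(i < n) (if insub i is Some j then u 0 j else 0).
have up : u = \row_(i < n) p`_i.
  by apply/rowP => i; rewrite mxE coef_poly ltn_ord valK.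
by exists (emb p); rewrite comp2_emb cval_decrow_sum ?size_poly // (cvalE n_gt0 h) hu up.
Qed.

Definition cps_scale (c : K) (a : A) : A := cpsC c * a.
Definition pullbackA (f1 f2 : ps K) (h : A) := exists g : O, cval h = comp2 f1 f2 (cval2 g).

Theorem delta_normal (o : nat -> nat) :
  (forall d, (0 < d < n)%N -> isord (o d) (Fc d - cval F)) ->
  exists2 D, has_codim cps_scale (pullbackA (psX ^+ n) (cval F)) D
    & (2 * D + n.-1 = \sum_(1 <= d < n) o d)%N.
Proof.
move=> ho; have [D hD e1] := isord_det_powmx n_gt0 prim_e ho.
exists D => //; apply: (has_codim_transfer (T := @decrow K n)) (lattice_codim hD).
- by move=> x y; rewrite decrowD.
- by move=> c x; rewrite decrowZ.
- exact: decrow_surj.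
- exact: pullback_lattice.
Qed.

Theorem delta_normal_infinite d D : (0 < d < n)%N -> Fc d = cval F ->
  codim_ge cps_scale (pullbackA (psX ^+ n) (cval F)) D.
Proof.
move=> hd hF; have := lattice_codim_infinite D (det_powmx0 n_gt0 prim_e hd hF).
apply: (codim_ge_transfer (T := @decrow K n)).
- by move=> x y; rewrite decrowD.
- by move=> c x; rewrite decrowZ.
- exact: decrow_surj.
- by move=> h /pullback_lattice.
Qed.

(** The remainder of g modulo the image polynomial also vanishes at (t^n, F), so its coefficients
    form a row killed by [powmx]. Distinct conjugates make the determinant nonzero, and the adjugate
    shows that the row is 0. *)
Lemma image_poly_kernel (g : O) : (forall d, (0 < d < n)%N -> Fc d <> cval F) ->
  comp2 (psX ^+ n) (cval F) (cval2 g) = 0 -> exists w, g = emb image_poly * w.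
Proof.
move=> hF hg; have [w [r [sr e1]]] := emb_division g image_poly_distinguished.
exists w; rewrite e1 -[RHS]addr0; congr (_ + _).
have [c ho] : exists c : nat -> nat, forall d, (0 < d < n)%N -> isord (c d) (Fc d - cval F).
  suff /choice : forall d, exists m, (0 < d < n)%N -> isord m (Fc d - cval F) by move=> [c]; exists c.
  move=> d; have [hd|] := boolP (0 < d < n)%N; last by exists 0%N.
  by have [|m hm] := @isord_exists K (Fc d - cval F); [rewrite subr_eq0; exact/eqP/hF|exists m].
have [D hD _] := isord_det_powmx n_gt0 prim_e ho.
have hz : (\row_(i < n) r`_i) *m powmx n F = 0.
  transitivity (decrow n (0 : A)); first apply/esym; apply: decrow_uniq => //.
    rewrite -cval_decrow_sum // -comp2_emb; move: hg; rewrite e1.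
    rewrite (rmorphD (@cval2 K)) (rmorphM (@cval2 K)) rmorphD rmorphM /= !comp2_emb.
    by rewrite -(conjps0 e F) image_poly_root mul0r add0r conjps0 => ->.
  by rewrite big1 // => j _; rewrite mxE (rmorph0 theta) mul0r.
have {hz}h : (\row_(i < n) r`_i) *m (\det (powmx n F))%:M = 0.
  by rewrite -mul_mx_adj mulmxA hz mul0mx.
have -> : r = 0; last by rewrite emb0.
apply/polyP => i; rewrite coef0; have [hi|hi] := ltnP i n; last by rewrite nth_default // (leq_trans sr).
have h' : r`_i * \det (powmx n F) = 0.
  by move/rowP/(_ (Ordinal hi)): h; rewrite mul_mx_scalar !mxE mulrC.
apply: cval_inj; apply: contrapT => /eqP r0.
have [m hm] := isord_exists r0.
have := isord_neq0 (isordM hm hD); rewrite -(rmorphM (@cval K)) h'.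
by rewrite (rmorph0 (@cval K)) eqxx.
Qed.

End ImagePolynomial.

(** * Coefficients of the normal form *)

Section Pure.
Variable R : comNzRingType.
Implicit Types a b w : ps R.

(** This is what the minimality of r_k says of each f_i divided by t^(d_i). *)
Definition pure k r a := forall s, (s < r)%N -> ~~ (k %| s)%N -> a s = 0.

Lemma pure_le k r s a : (s <= r)%N -> pure k r a -> pure k s a.
Proof. by move=> sr ha i hi; apply: ha; exact: leq_trans sr. Qed.

(* On series that are pure below r, the coefficient of index r is a derivation. *)
Lemma pureM_coef k r a b : pure k r a -> pure k r b -> ~~ (k %| r)%N ->
  (a * b) r = a 0%N * b r + a r * b 0%N.
Proof.
move=> ha hb kr; case: r kr ha hb => [|r] kr ha hb; first by rewrite dvdn0 in kr.
rewrite psM big_ord_recl big_ord_recr /= subn0 /bump /= add1n subnn big1 ?add0r //.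
move=> i _; rewrite add1n; have [hi|hi] := boolP (k %| i.+1)%N.
  rewrite hb ?mulr0 ?subSS ?ltnS ?leq_subr //; apply: contra kr => h.
  have := dvdn_add hi h; rewrite -subSS subnKC // ltnS; exact: ltnW.
by rewrite ha ?mul0r // ltnS.
Qed.

Lemma pureM k r a b : pure k r a -> pure k r b -> pure k r (a * b).
Proof.
move=> ha hb s sr ks; rewrite (@pureM_coef k s) //; try exact: pure_le (ltnW sr) _.
by rewrite (ha s sr ks) (hb s sr ks) mulr0 mul0r addr0.
Qed.

Lemma pure1 k r : pure k r 1.
Proof. by move=> [|s] // _; rewrite dvdn0. Qed.

Lemma pureX k r a m : pure k r a -> pure k r (a ^+ m).
Proof. by move=> ha; elim: m => [|m IH]; rewrite ?expr0 ?exprS; [exact: pure1|exact: pureM]. Qed.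

Lemma coef0X a m : (a ^+ m) 0%N = a 0%N ^+ m.
Proof. by elim: m => [|m IH]; rewrite ?expr0 // !exprS psM_0 IH. Qed.

(** The power rule for the derivation of [pureM_coef], multiplied by a_0 so that no exponent m - 1
    occurs. *)
Lemma pureX_coef k r a m : pure k r a -> ~~ (k %| r)%N ->
  (a ^+ m) r * a 0%N = m%:R * a 0%N ^+ m * a r.
Proof.
move=> ha kr; elim: m => [|m IH].
  by rewrite expr0 ps1 !mul0r; case: r kr {ha} => [|r]; rewrite ?dvdn0 //= mul0r.
rewrite exprS (@pureM_coef k r) //; last exact: pureX.
by rewrite mulrDl -mulrA IH coef0X -natr1 exprS; ring.
Qed.

(** In a(t w) = sum_i a_i t^i w^i with i < r: if k does not divide i then a_i = 0; if it does and i
    > 0, then w^i has no term of degree r - i, which k does not divide; and i = 0 gives a constant.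
    Only i = r contributes. *)
Lemma pure_scomp_coef k r a w : pure k r a -> pure k r w -> ~~ (k %| r)%N ->
  scomp (psX * w) a r = a r * w 0%N ^+ r.
Proof.
move=> ha hw kr; rewrite /scomp /= (@subst_sum _ _ _ r r) // psv_id ?psXM0 //.
rewrite big_ord_recr /= big1 ?add0r => [|i _].
  by rewrite psCM exprMn psXnM ltnn subnn coef0X.
rewrite psCM exprMn psXnM ltnNge (ltnW (ltn_ord i)) /=.
have [ki|ki] := boolP (k %| i)%N; last by rewrite ha ?mul0r.
have kri : ~~ (k %| r - i)%N by apply: contra kr => h; rewrite -(subnKC (ltnW (ltn_ord i))) dvdn_add.
case: (posnP i) => [i0|i0]; last first.
  by rewrite (pureX _ hw) ?mulr0 // ltn_subrL i0 (leq_ltn_trans _ (ltn_ord i)).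
rewrite i0 expr0 ps1 subn0; case: (r) kr => [|r'] //=; first by rewrite dvdn0.
by rewrite mulr0.
Qed.

Lemma pure_scomp k r a w : pure k r a -> pure k r w -> pure k r (scomp (psX * w) a).
Proof.
move=> ha hw s sr ks; rewrite (@pure_scomp_coef k s) ?ha ?mul0r //;
exact: pure_le (ltnW sr) _.
Qed.

End Pure.

Section NormalCoefficients.
Variables (K : numFieldType) (n d : nat) (f1 f2 phi : ps K).
Hypotheses (n_gt0 : (0 < n)%N) (o1 : ordge n f1) (f1n : f1 n != 0) (o2 : ordge d f2).
Hypotheses (phi0 : phi 0%N = 0) (phi1 : phi 1%N != 0) (hphi : scomp phi f1 = psX ^+ n).

Let w : ps K := psshift phi.
Let a1 : ps K := fun k => f1 (k + n)%N.
Let a2 : ps K := fun k => f2 (k + d)%N.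

Let phiE : phi = psX * w.
Proof. by rewrite {1}(ps_shiftE phi) phi0 rmorph0 add0r. Qed.

Let w1 : w ^+ n * scomp (psX * w) a1 = 1.
Proof.
have := hphi; rewrite (ordgeP o1) -/a1 rmorphM rmorphXn /= scompX phiE psv_id ?psXM0 //.
rewrite exprMn -mulrA => h; apply/funext => i.
have := congr1 (fun f : ps K => f (n + i)%N) h.
by rewrite psXnM psXn ltnNge leq_addr addKn /= => ->; rewrite ps1 -(eqn_add2l n i 0%N) addn0.
Qed.

Let FE : scomp phi f2 = psX ^+ d * (w ^+ d * scomp (psX * w) a2).
Proof.
by rewrite (ordgeP o2) -/a2 rmorphM rmorphXn /= scompX phiE psv_id ?psXM0 // exprMn -mulrA.
Qed.

Let w0 : w 0%N != 0. Proof. by []. Qed.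

(** Coefficient r of w^n a1(t w) = 1, computed by the derivation rules and divided by w_0^(n-1). *)
Let w_pure k r : pure k r a1 -> ~~ (k %| r)%N -> pure k r w ->
  n%:R * a1 0%N * w r + a1 r * w 0%N ^+ r.+1 = 0.
Proof.
move=> ha kr hw; have := congr1 (fun f : ps K => f r) w1.
rewrite (@pureM_coef _ k r) //; [|exact: pureX|exact: pure_scomp].
rewrite coef0X scomp_0 (pure_scomp_coef ha hw kr) ps1 => h.
have {h} : (w 0%N ^+ n * (a1 r * w 0%N ^+ r) + (w ^+ n) r * a1 0%N) * w 0%N = 0.
  by rewrite h; case: (r) kr => [|r'] //=; rewrite ?dvdn0 ?mul0r.
rewrite mulrDl [X in _ + X]mulrAC (pureX_coef _ hw) // => h.
apply: (mulfI (expf_neq0 n w0)); rewrite mulr0 -h exprS; ring.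
Qed.

Let w_pure_all k r : pure k r a1 -> pure k r w.
Proof.
elim: r => [|r IH] ha //; have hw := IH (pure_le (leqnSn r) ha).
move=> s; rewrite ltnS leq_eqVlt => /orP[/eqP ->|]; last exact: hw.
move=> kr; have := w_pure (pure_le (leqnSn r) ha) kr hw; rewrite (ha r (ltnSn r) kr) mul0r addr0 => /eqP.
by rewrite !mulf_eq0 pnatr_eq0 (gtn_eqF n_gt0) (negbTE f1n) => /eqP.
Qed.

Lemma normal_pure k r : pure k r a1 -> pure k r a2 ->
  forall s, (s < r)%N -> ~~ (k %| s)%N -> scomp phi f2 (d + s)%N = 0.
Proof.
move=> h1 h2 s sr ks; have hw := w_pure_all h1.
rewrite FE psXnM ltnNge leq_addr addKn.
by apply: (pureM (pureX d hw) (pure_scomp h2 hw)).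
Qed.

(** Here F = t^d w^d a2(t w). The derivation rule gives w_0^d a2_r w_0^r from the last factor and d
    w_0^(d-1) w_r a2_0 from w^d, with w_r determined by [w_pure]. The bracket vanishes exactly when
    the two ratios of the nondegeneracy condition agree. *)
Lemma normal_coef k r : pure k r a1 -> pure k r a2 -> ~~ (k %| r)%N ->
  scomp phi f2 (d + r)%N =
    phi 1%N ^+ (d + r) * (f2 (d + r)%N - d%:R * f2 d * f1 (n + r)%N / (n%:R * f1 n)).
Proof.
move=> h1 h2 kr; have hw := w_pure_all h1; have hr := w_pure h1 kr hw.
rewrite FE psXnM ltnNge leq_addr addKn (@pureM_coef _ k r) //; [|exact: pureX|exact: pure_scomp].
rewrite coef0X scomp_0 (pure_scomp_coef h2 hw kr); apply: (mulIf w0).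
rewrite mulrDl [X in _ + X]mulrAC (pureX_coef _ hw) //.
have n0 : n%:R != 0 :> K by rewrite pnatr_eq0 -lt0n.
have -> : w r = - (a1 r * w 0%N ^+ r.+1) / (n%:R * a1 0%N).
  apply/eqP; rewrite eq_sym -[_ == _](inj_eq (mulfI (_ : n%:R * a1 0%N != 0))) ?mulf_neq0 //.
  by rewrite mulrC divfK ?mulf_neq0 // eq_sym -subr_eq0 opprK hr.
rewrite -[phi 1%N]/(w 0%N) -[a2 r]/(f2 (r + d)%N) -[a1 r]/(f1 (r + n)%N) [(r + d)%N]addnC [(r + n)%N]addnC.
rewrite -[a2 0%N]/(f2 d) -[a1 0%N]/(f1 n) exprD exprS.
by move: (f1 n) f1n n0 => x x0 n0; field; rewrite n0 x0.
Qed.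

Lemma normal_ordge : ordge d (scomp phi f2).
Proof. rewrite FE; exact: ordge_XnM. Qed.

Lemma normal_lead : scomp phi f2 d = phi 1%N ^+ d * f2 d.
Proof. by rewrite FE psXnM ltnn subnn psM_0 coef0X scomp_0. Qed.

End NormalCoefficients.

Section Combinatorics.
Variables (B1 B2 : pred nat) (d1 d2 : nat).
Hypotheses (hd1 : B1 d1) (hmin1 : forall b, B1 b -> (d1 <= b)%N) (hpos1 : (0 < d1)%N).
Hypotheses (hd2 : B2 d2) (hmin2 : forall b, B2 b -> (d2 <= b)%N) (hpos2 : (0 < d2)%N).
Hypothesis hgcd : forall k, (forall b, B1 b || B2 b -> (k %| b)%N) -> k = 1%N.

Lemma dvdn_biggcd (s : seq nat) (P : pred nat) k :
  (k %| \big[gcdn/0%N]_(b <- s | P b) b)%N = all (fun b => P b ==> (k %| b)%N) s.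
Proof.
elim: s => [|b s IH]; first by rewrite big_nil dvdn0.
by rewrite big_cons /=; case: (P b) => //=; rewrite dvdn_gcd IH.
Qed.

Lemma dvdn_jr k r : (k %| jr B1 B2 d1 d2 r)%N <->
  (k %| d1)%N /\ (k %| d2)%N /\ forall s, (s <= r)%N -> B1 (d1 + s)%N || B2 (d2 + s)%N -> (k %| s)%N.
Proof.
rewrite /jr dvdn_gcd !dvdn_biggcd; split.
  move=> /andP[/allP h1 /allP h2].
  have k1 : (k %| d1)%N.
    by have := h1 d1; rewrite mem_index_iota leqnn ltnS leq_addr hd1; apply.
  have k2 : (k %| d2)%N.
    by have := h2 d2; rewrite mem_index_iota leqnn ltnS leq_addr hd2; apply.
  split=> //; split=> // s sr /orP[hs|hs].
    have := h1 (d1 + s)%N; rewrite mem_index_iota leq_addr ltnS leq_add2l sr hs => /(_ isT).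
    by rewrite dvdn_addr.
  have := h2 (d2 + s)%N; rewrite mem_index_iota leq_addr ltnS leq_add2l sr hs => /(_ isT).
  by rewrite dvdn_addr.
move=> [k1 [k2 h]]; apply/andP; split; apply/allP => b; rewrite mem_index_iota ltnS => /andP[b1 b2];
  apply/implyP => Bb.
  by rewrite -(subnKC b1) dvdn_add // h ?leq_subLR // subnKC ?Bb.
by rewrite -(subnKC b1) dvdn_add // h ?leq_subLR // subnKC ?Bb ?orbT.
Qed.

Lemma is_rk_uniq k r s : is_rk B1 B2 d1 d2 k r -> is_rk B1 B2 d1 d2 k s -> r = s.
Proof.
move=> [h1 [h2 h3]] [h1' [h2' h3']]; apply/eqP; rewrite eqn_leq; apply/andP; split.
  by rewrite leqNgt; apply: contra h2' => /h3; apply.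
by rewrite leqNgt; apply: contra h2 => /h3'; apply.
Qed.

(** If every shift were a multiple of k, then k would divide all elements of B1 and B2, against
    their gcd being 1. *)
Lemma exists_rk k : (1 < k)%N -> (k %| d1)%N -> (k %| d2)%N -> exists r, is_rk B1 B2 d1 d2 k r.
Proof.
move=> k1 kd1 kd2.
have ex : exists r, (B1 (d1 + r)%N || B2 (d2 + r)%N) && ~~ (k %| r)%N.
  apply: contrapT => h; have : k = 1%N; last by move=> e; rewrite e in k1.
  apply: hgcd => b hb; have [le_b|le_b] : (d1 <= b)%N /\ B1 b \/ (d2 <= b)%N /\ B2 b.
  - by case/orP: hb => hb; [left|right]; split=> //; [exact: hmin1|exact: hmin2].
  - case: le_b => le_b Bb; rewrite -(subnKC le_b) dvdn_add //; apply: contrapT => /negP hk; apply: h.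
    by exists (b - d1)%N; rewrite subnKC // Bb.
  - case: le_b => le_b Bb; rewrite -(subnKC le_b) dvdn_add //; apply: contrapT => /negP hk; apply: h.
    by exists (b - d2)%N; rewrite subnKC // Bb orbT.
case: (ex_minnP ex) => r /andP[hr kr] min; exists r; split=> //; split=> // s sr hs.
by apply: contraTT sr => ks; rewrite -leqNgt; apply: min; rewrite hs ks.
Qed.

(** With the value 0 when k does not divide d2, the number d2 + ek k is the expected contact order
    in both cases: there the leading term of F already distinguishes the conjugates. *)
Lemma exists_contact : exists ek : nat -> nat, forall k, (1 < k)%N -> (k %| d1)%N ->
  if (k %| d2)%N then is_rk B1 B2 d1 d2 k (ek k) else ek k = 0%N.
Proof.
suff /choice [ek h] : forall k, exists r, (1 < k)%N -> (k %| d1)%N ->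
    if (k %| d2)%N then is_rk B1 B2 d1 d2 k r else r = 0%N by exists ek.
move=> k; have [k1|] := boolP (1 < k)%N; last by exists 0%N.
have [kd1|] := boolP (k %| d1)%N; last by exists 0%N.
have [kd2|kd2] := boolP (k %| d2)%N; last by exists 0%N.
by have [r hr] := exists_rk k1 kd1 kd2; exists r.
Qed.

(* The order of e^j for a primitive d1-th root of unity e. *)
Definition kj j := (d1 %/ gcdn d1 j)%N.

Lemma kj_dvd j m : (d1 %| j * m)%N = (kj j %| m)%N.
Proof.
have g0 : (0 < gcdn d1 j)%N by rewrite gcdn_gt0 hpos1.
rewrite -[RHS](dvdn_pmul2l g0) /kj [(gcdn _ _ * (_ %/ _))%N]mulnC divnK ?dvdn_gcdl // muln_gcdl dvdn_gcd.
by rewrite (dvdn_mulr m (dvdnn d1)).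
Qed.

Lemma kj_dvd_n j : (kj j %| d1)%N.
Proof. by rewrite -kj_dvd dvdn_mull. Qed.

Lemma kj_gt1 j : (0 < j < d1)%N -> (1 < kj j)%N.
Proof.
move=> /andP[j0 jn]; have : ~~ (kj j %| 1)%N.
  by rewrite -kj_dvd muln1; apply/negP => /dvdn_leq; rewrite j0 leqNgt jn => /(_ isT).
have : (0 < kj j)%N by rewrite (dvdn_gt0 hpos1) // kj_dvd_n.
by case: (kj j) => [|[|]].
Qed.

Lemma kj_div k : (k %| d1)%N -> (1 < k)%N -> kj (d1 %/ k) = k /\ (0 < d1 %/ k < d1)%N.
Proof.
move=> kd k1; have k0 := ltnW k1; split.
  by rewrite /kj (gcdn_idPr (dvdn_div _)) // divnA // mulKn.
by rewrite divn_gt0 // dvdn_leq //= ltn_Pdiv.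
Qed.

(** By [kj_dvd] the condition means that d1 divides j J, that is, that j is a multiple of d1 / J.
    There are J such j from 1 to d1, and j = d1 is left out. *)
Lemma count_kj J : (J %| d1)%N -> (\sum_(1 <= j < d1) (kj j %| J)%N = J - 1)%N.
Proof.
move=> /dvdnP[q nE]; have q0 : (0 < q)%N by case: q nE => //= h; move: hpos1; rewrite h.
have J0 : (0 < J)%N by case: J nE => //; rewrite muln0 => h; move: hpos1; rewrite h.
have qd : (q %| d1)%N by rewrite nE dvdn_mulr.
have := divn_count_dvd q d1; rewrite {1}nE mulKn // big_nat_recr //= qd.
move=> hJ; rewrite [X in _ = (X - 1)%N]hJ addn1 subn1 /=; apply: eq_bigr => j _; rewrite -kj_dvd {1}nE dvdn_pmul2r //.
Qed.

Lemma sum_ltn_nat m e : (e <= m)%N -> (\sum_(r < m) (r < e) = e)%N.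
Proof.
move=> em; suff -> : (\sum_(r < m) (r < e) = minn m e)%N by exact/minn_idPr.
elim: m {em} => [|m IH]; first by rewrite big_ord0 min0n.
by rewrite big_ord_recr /= IH /minn; case: (ltnP m e) => h; case: (ltnP m.+1 e) => h'; rewrite /=; lia.
Qed.

Variable N : nat.
Hypothesis hN : forall r, (N <= r)%N -> jr B1 B2 d1 d2 r = 1%N.

(** As r grows, k divides j_r until the first shift that k does not divide enters, and never if k
    does not divide d2. *)
Lemma contact_jr (ek : nat -> nat) k r : (1 < k)%N -> (k %| d1)%N ->
  (if (k %| d2)%N then is_rk B1 B2 d1 d2 k (ek k) else ek k = 0%N) ->
  (r < ek k)%N = (k %| jr B1 B2 d1 d2 r)%N.
Proof.
move=> k1 kd1; case: ifP => [kd2 [h1 [h2 h3]]|kd2 ->]; apply/idP/idP => //.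
- move=> hr; apply/dvdn_jr; split=> //; split=> // s sr hs.
  by apply: h3 => //; exact: leq_ltn_trans hr.
- move=> /dvdn_jr [_ [_ h]]; rewrite ltnNge; apply: contra h2 => hr; exact: h.
- by move=> /dvdn_jr [_ []]; rewrite kd2.
Qed.

(** Double counting: [ek (kj j)] is the number of r with [kj j] dividing j_r, and for fixed r the
    number of such j is j_r - 1 by [count_kj]. No r >= N is counted because j_r = 1 there and [kj j]
    > 1. *)
Lemma sum_contact (ek : nat -> nat) :
  (forall k, (1 < k)%N -> (k %| d1)%N -> if (k %| d2)%N then is_rk B1 B2 d1 d2 k (ek k) else ek k = 0%N) ->
  (\sum_(1 <= j < d1) ek (kj j) = \sum_(r < N) (jr B1 B2 d1 d2 r - 1))%N.
Proof.
move=> hek.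
have hE j r : (1 <= j < d1)%N -> (r < ek (kj j))%N = (kj j %| jr B1 B2 d1 d2 r)%N.
  move=> hj; apply: contact_jr; [exact: kj_gt1|exact: kj_dvd_n|].
  by apply: hek; [exact: kj_gt1|exact: kj_dvd_n].
transitivity (\sum_(1 <= j < d1) \sum_(r < N) (kj j %| jr B1 B2 d1 d2 r)%N)%N.
  apply: eq_big_nat => j hj; rewrite -[LHS](@sum_ltn_nat N); last first.
    rewrite leqNgt hE // hN // dvdn1; have := kj_gt1 hj; by case: (kj j) => [|[]].
  by apply: eq_bigr => r _; rewrite hE.
rewrite exchange_big /=; apply: eq_bigr => r _; apply: count_kj.
by have [h _] := (dvdn_jr (jr B1 B2 d1 d2 r) r).1 (dvdnn _).
Qed.

(** Doubled so as to stay in the natural numbers; every j_r is positive, so the truncated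
    subtractions are genuine. *)
Definition twice_delta := ((d1 - 1) * (d2 - 1) + \sum_(r < N) (jr B1 B2 d1 d2 r - 1))%N.

Lemma twice_deltaB : (2 : rat) * deltaB B1 B2 d1 d2 N = twice_delta%:R.
Proof.
rewrite /deltaB /twice_delta natrD mulrDr mulrC divfK // mulr_sumr natr_sum; congr (_ + _).
apply: eq_bigr => r _; rewrite mulrC divfK // natrB //.
rewrite lt0n; apply/eqP => h; have := dvdn_jr 0 r; rewrite h dvdnn => -[/(_ isT) [+ _] _].
by rewrite dvd0n => /eqP h0; move: hpos1; rewrite h0.
Qed.

Lemma sum_orders (ek : nat -> nat) :
  (forall k, (1 < k)%N -> (k %| d1)%N -> if (k %| d2)%N then is_rk B1 B2 d1 d2 k (ek k) else ek k = 0%N) ->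
  (\sum_(1 <= j < d1) (d2 + ek (kj j)) = twice_delta + d1.-1)%N.
Proof.
move=> hek; rewrite big_split /= sum_contact // sum_nat_const_nat /twice_delta.
rewrite -subn1; move: (\sum_(r < N) _)%N => s; nia.
Qed.

End Combinatorics.

(** * The delta-invariant of a germ with given support *)

Section Germ.
Variables (K : numClosedFieldType) (B1 B2 : pred nat) (d1 d2 : nat).
Hypotheses (hd1 : B1 d1) (hmin1 : forall b, B1 b -> (d1 <= b)%N) (hpos1 : (0 < d1)%N).
Hypotheses (hd2 : B2 d2) (hmin2 : forall b, B2 b -> (d2 <= b)%N) (hpos2 : (0 < d2)%N).
Hypothesis hgcd : forall k, (forall b, B1 b || B2 b -> (k %| b)%N) -> k = 1%N.
Local Notation A := (cps K).

Definition supp (B : pred nat) (a : ps K) := forall b, ~~ B b -> a b = 0.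
Definition nondegenerate (f1 f2 : ps K) : Prop :=
  forall k, (1 < k)%N -> (k %| d1)%N -> (k %| d2)%N ->
    forall r, is_rk B1 B2 d1 d2 k r ->
      f1 (d1 + r)%N / (f1 d1 * d1%:R) != f2 (d2 + r)%N / (f2 d2 * d2%:R).

(* The normal form (t^d1, F) of a germ, for a convergent change of parameter phi. *)
Record normal_form (f1 f2 phi psi : ps K) (F : A) : Prop := {
  nf_conv : convergent phi /\ convergent psi;
  nf_cst : phi 0%N = 0 /\ psi 0%N = 0;
  nf_inv : scomp psi phi = psX /\ scomp phi psi = psX;
  nf_fst : scomp phi f1 = psX ^+ d1;
  nf_snd : scomp phi f2 = cval F;
  nf_ord : isord d2 (cval F);
  nf_pure : forall k r, is_rk B1 B2 d1 d2 k r -> forall s, (s < r)%N -> ~~ (k %| s)%N ->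
    cval F (d2 + s)%N = 0;
  nf_coef : forall k r, is_rk B1 B2 d1 d2 k r ->
    (cval F (d2 + r)%N == 0) =
    (f1 (d1 + r)%N / (f1 d1 * d1%:R) == f2 (d2 + r)%N / (f2 d2 * d2%:R)) }.

Lemma exists_normal_form (f1 f2 : ps K) : convergent f1 -> convergent f2 ->
  supp B1 f1 -> supp B2 f2 -> f1 d1 != 0 -> f2 d2 != 0 ->
  exists phi psi F, normal_form f1 f2 phi psi F.
Proof.
move=> c1 c2 s1 s2 n1 n2.
have o1 : ordge d1 f1.
  by move=> i hi; apply: s1; apply: contraTN hi => /hmin1; rewrite -leqNgt.
have o2 : ordge d2 f2.
  by move=> i hi; apply: s2; apply: contraTN hi => /hmin2; rewrite -leqNgt.
have [phi [cp p0 p1 e1]] := exists_root_parameter hpos1 c1 o1 n1.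
have [psi [cs q0 q1 e2 e3]] := exists_scomp_inverse cp p0 p1.
have cF : convergent (scomp phi f2) by exact: convergent_scomp.
have pu k r : is_rk B1 B2 d1 d2 k r -> pure k r (fun k => f1 (k + d1)%N : K) /\
    pure k r (fun k => f2 (k + d2)%N : K).
  move=> [_ [_ h]]; split=> s sr ks; [apply: s1|apply: s2]; rewrite addnC;
  by apply: contra ks => Bs; apply: h => //; rewrite Bs ?orbT.
exists phi, psi, (mkcps cF); split=> //=.
- split; first exact: (normal_ordge o2 p0).
  by rewrite (normal_lead o2 p0) mulf_neq0 ?expf_neq0.
- by move=> k r /pu [h1 h2]; exact: (normal_pure hpos1 o1 n1 o2 p0 p1 e1 h1 h2).
move=> k r hr; have [h1 h2] := pu k r hr; have [_ [kr _]] := hr.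
rewrite (normal_coef hpos1 o1 n1 o2 p0 p1 e1 h1 h2 kr).
rewrite mulf_eq0 (negbTE (expf_neq0 _ p1)) /= subr_eq0.
have m1 : d1%:R != 0 :> K by rewrite pnatr_eq0 -lt0n.
have m2 : d2%:R != 0 :> K by rewrite pnatr_eq0 -lt0n.
move: (f1 d1) (f2 d2) n1 n2 (f1 (d1 + r)%N) (f2 (d2 + r)%N) => g f g0 f0 x y.
apply/eqP/eqP => [->|h]; first by field; rewrite m1 m2 g0 f0.
have -> : y = y / (f * d2%:R) * (f * d2%:R) by rewrite divfK // mulf_neq0.
by rewrite -h; field; rewrite m1 g0.
Qed.

Variables (e : K).
Hypothesis prim_e : d1.-primitive_root e.

Section Contact.
Variables (F : A) (ek : nat -> nat).
Hypothesis hek : forall k, (1 < k)%N -> (k %| d1)%N ->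
  if (k %| d2)%N then is_rk B1 B2 d1 d2 k (ek k) else ek k = 0%N.
Hypothesis ordF : isord d2 (cval F).
Hypothesis pureF : forall k r, is_rk B1 B2 d1 d2 k r -> forall s, (s < r)%N ->
  ~~ (k %| s)%N -> cval F (d2 + s)%N = 0.

Lemma conj_diff_coef j m : (conjps e F j - cval F) m = (e ^+ (j * m) - 1) * cval F m.
Proof. by rewrite psB /conjps rotpsE exprM mulrBl mul1r. Qed.

Lemma conj_diff_factor j m : (e ^+ (j * m) - 1 == 0) = (kj d1 j %| m)%N.
Proof.
by rewrite subr_eq0 -(kj_dvd hpos1) -(prim_order_dvd prim_e).
Qed.

(** Let k be the order of e^j, and consider degree d2 + s with s < [ek k]. If k divides s, it
    divides d2 + s and the factor e^(j(d2+s)) - 1 is zero; otherwise F has no such term. When k does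
    not divide d2, no such s exists. *)
Lemma conj_diff_ordge j : (0 < j < d1)%N ->
  ordge (d2 + ek (kj d1 j)) (conjps e F j - cval F).
Proof.
move=> hj m hm; rewrite conj_diff_coef.
have [md|dm] := ltnP m d2; first by rewrite ordF.1 // mulr0.
have := hek (kj_gt1 hpos1 hj) (kj_dvd_n hpos1 j); case: ifP => kd2 hk; last first.
  by move: hm; rewrite hk addn0 ltnNge dm.
have hm' : (m - d2 < ek (kj d1 j))%N by rewrite ltn_subLR.
have [km|km] := boolP (kj d1 j %| m - d2)%N; last first.
  by rewrite -(subnKC dm) (pureF hk hm' km) mulr0.
have /eqP -> : e ^+ (j * m) - 1 == 0 by rewrite conj_diff_factor -(subnKC dm) dvdn_addl.
by rewrite mul0r.
Qed.

Lemma conj_diff_lead j : (0 < j < d1)%N ->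
  ((conjps e F j - cval F) (d2 + ek (kj d1 j))%N == 0) = (cval F (d2 + ek (kj d1 j))%N == 0).
Proof.
move=> hj; rewrite conj_diff_coef mulf_eq0 conj_diff_factor.
have := hek (kj_gt1 hpos1 hj) (kj_dvd_n hpos1 j); case: ifP => kd2.
  by move=> [_ [kr _]]; rewrite dvdn_addr // (negbTE kr).
by move=> ->; rewrite addn0 kd2.
Qed.

End Contact.

Lemma contact_nondegenerate (f1 f2 phi psi : ps K) (F : A) (ek : nat -> nat) :
  normal_form f1 f2 phi psi F -> nondegenerate f1 f2 ->
  (forall k, (1 < k)%N -> (k %| d1)%N ->
     if (k %| d2)%N then is_rk B1 B2 d1 d2 k (ek k) else ek k = 0%N) ->
  forall j, (0 < j < d1)%N -> isord (d2 + ek (kj d1 j)) (conjps e F j - cval F).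
Proof.
move=> nf nd hek d hd; split; first exact: (conj_diff_ordge hek (nf_ord nf) (nf_pure nf) hd).
rewrite (conj_diff_lead F hek hd).
have := hek _ (kj_gt1 hpos1 hd) (kj_dvd_n hpos1 d); case: ifP => kd2 hk.
  by rewrite (nf_coef nf hk); apply: (nd _ (kj_gt1 hpos1 hd) (kj_dvd_n hpos1 d) kd2 _ hk).
by rewrite hk addn0 (nf_ord nf).2.
Qed.

Variable N : nat.
Hypothesis hN : forall r, (N <= r)%N -> jr B1 B2 d1 d2 r = 1%N.

Lemma pullback_normal (f1 f2 phi psi : ps K) (F : A) D :
  normal_form f1 f2 phi psi F ->
  (has_codim (@cps_scale K) (pullbackA (psX ^+ d1) (cval F)) D ->
     has_codim (@cps_scale K) (pullbackA f1 f2) D) /\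
  (codim_ge (@cps_scale K) (pullbackA (psX ^+ d1) (cval F)) D ->
     codim_ge (@cps_scale K) (pullbackA f1 f2) D).
Proof.
move=> nf; have [cphi cpsi] := nf_conv nf; have [p0 q0] := nf_cst nf; have [i1 i2] := nf_inv nf.
pose T (a : A) : A := mkcps (convergent_scomp cphi (cvalP a)).
have TD x y : T (x + y) = T x + T y by apply: cval_inj; rewrite /= rmorphD.
have TZ c x : T (cps_scale c x) = cps_scale c (T x).
  by apply: cval_inj; rewrite /= rmorphM /= scompC.
have Ts w : exists u, T u = w.
  exists (mkcps (convergent_scomp cpsi (cvalP w))); apply: cval_inj => /=.
  by rewrite scompA i2 scomp_id.
have hS h : pullbackA f1 f2 h <-> pullbackA (psX ^+ d1) (cval F) (T h).
  split=> [[g hg]|[g hg]]; exists g.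
    by rewrite /= hg scomp_comp2 (nf_fst nf) (nf_snd nf).
  move: hg => /= /(congr1 (scomp psi)).
  rewrite scompA i1 scomp_id => ->; rewrite scomp_comp2 -(nf_fst nf) -(nf_snd nf).
  by rewrite !scompA i1 !scomp_id.
split; first exact: (has_codim_transfer TD TZ Ts hS).
by apply: (codim_ge_transfer TD TZ Ts) => h /hS.
Qed.

Lemma delta_nondegenerate (f1 f2 phi psi : ps K) (F : A) :
  normal_form f1 f2 phi psi F -> nondegenerate f1 f2 ->
  exists2 D, has_codim (@cps_scale K) (pullbackA f1 f2) D & (2 * D = twice_delta B1 B2 d1 d2 N)%N.
Proof.
move=> nf nd; have [ek hek] := exists_contact hmin1 hmin2 hgcd.
have F0 : cval F 0%N = 0 by rewrite (nf_ord nf).1.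
have [D hD e1] := delta_normal hpos1 prim_e F0 (contact_nondegenerate nf nd hek).
exists D; first exact: (pullback_normal D nf).1.
move: e1; rewrite (sum_orders hd1 hpos1 hd2 hpos2 hN hek) => /eqP.
by rewrite eqn_add2r => /eqP.
Qed.

(** Every contact order is at least the expected one. If the condition fails for k, the one at j =
    d1 / k, where e^j has order exactly k, is strictly larger, so the sum of orders grows. *)
Lemma delta_degenerate (f1 f2 phi psi : ps K) (F : A) :
  normal_form f1 f2 phi psi F -> ~ nondegenerate f1 f2 ->
  exists2 D, codim_ge (@cps_scale K) (pullbackA f1 f2) D & (twice_delta B1 B2 d1 d2 N < 2 * D)%N.
Proof.
move=> nf nd; have [ek hek] := exists_contact hmin1 hmin2 hgcd.
have F0 : cval F 0%N = 0 by rewrite (nf_ord nf).1.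
have [[d hd dF]|hne] := pselect (exists2 d, (0 < d < d1)%N & conjps e F d = cval F).
  (* Coinciding conjugates make the codimension infinite, so any D is a lower bound; this one is
     large enough. *)
  exists (twice_delta B1 B2 d1 d2 N).+1; last lia.
  apply: (pullback_normal _ nf).2; exact: (delta_normal_infinite hpos1 prim_e F0 _ hd dF).
have [c hc] : exists c : nat -> nat, forall d, (0 < d < d1)%N -> isord (c d) (conjps e F d - cval F).
  suff /choice [c hc] : forall d, exists m, (0 < d < d1)%N -> isord m (conjps e F d - cval F) by exists c.
  move=> d; have [hd|] := boolP (0 < d < d1)%N; last by exists 0%N.
  have [|m hm] := @isord_exists K (conjps e F d - cval F); last by exists m.
  by rewrite subr_eq0; apply/eqP => h; apply: hne; exists d.
have [D hD e1] := delta_normal hpos1 prim_e F0 hc.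
exists D; first by apply: (pullback_normal D nf).2; exact: has_codim_ge.
have le_c d : (0 < d < d1)%N -> (d2 + ek (kj d1 d) <= c d)%N.
  move=> hd; apply: isord_leq (hc d hd) _.
  exact: (conj_diff_ordge hek (nf_ord nf) (nf_pure nf) hd).
have [j hj lt_c] : exists2 j, (0 < j < d1)%N & (d2 + ek (kj d1 j) < c j)%N.
  apply: contrapT => h; apply: nd => k k1 kd1 kd2 r hr; rewrite -(nf_coef nf hr).
  have [kjE hj] := kj_div hpos1 kd1 k1; have := hek k k1 kd1; rewrite kd2 => hk.
  rewrite (is_rk_uniq hr hk) -{1}kjE -(conj_diff_lead F hek hj).
  have -> : (d2 + ek (kj d1 (d1 %/ k)) = c (d1 %/ k))%N.
    apply/eqP; rewrite eqn_leq le_c //= leqNgt; apply/negP => lt_c; apply: h.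
    by exists (d1 %/ k)%N.
  exact: (hc _ hj).2.
have := sum_orders hd1 hpos1 hd2 hpos2 hN hek.
have : (\sum_(1 <= d < d1) (d2 + ek (kj d1 d) + (d == j)) <= \sum_(1 <= d < d1) c d)%N.
  rewrite big_nat [leqRHS]big_nat; apply: leq_sum => d hd.
  by case: eqVneq => [->|_]; rewrite ?addn1 // addn0; exact: le_c.
rewrite big_split [X in (_ + X <= _)%N](bigD1_seq j) ?mem_index_iota ?iota_uniq //= eqxx.
rewrite [X in (_ + (1 + X) <= _)%N]big1 ?addn0 => [|i /negbTE -> //].
by rewrite -e1 => h h'; move: h; rewrite h'; lia.
Qed.

End Germ.

(** * Puiseux factorization *)

Section SeriesDomain.
Variable K : fieldType.

Definition ps_unit : pred (ps K) := fun a => a 0%N != 0.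
Definition ps_inv (a : ps K) : ps K := if ps_unit a then psinv a else a.

Lemma ps_mulVr : {in ps_unit, left_inverse 1 ps_inv *%R}.
Proof. by move=> a ha; rewrite /ps_inv (_ : ps_unit a) // mulrC psmulV. Qed.
Lemma ps_unitP (x y : ps K) : y * x = 1 -> ps_unit x.
Proof.
move=> /(congr1 (fun f : ps K => f 0%N)); rewrite psM_0 ps1 /= => h.
by apply/eqP => x0; move/eqP: h; rewrite x0 mulr0 eq_sym oner_eq0.
Qed.
Lemma ps_inv_out : {in [predC ps_unit], ps_inv =1 id}.
Proof. by move=> a; rewrite inE -[_ \in _]/(ps_unit a) /ps_inv => /negbTE ->. Qed.
HB.instance Definition _ := GRing.ComNzRing_hasMulInverse.Build (ps K) ps_mulVr ps_unitP ps_inv_out.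

Lemma ps_integral (a b : ps K) : a * b = 0 -> (a == 0) || (b == 0).
Proof.
move=> ab; have [//|a0] := eqVneq a 0; have [//|b0] := eqVneq b 0.
have [m hm] := isord_exists a0; have [k hk] := isord_exists b0.
by have := isord_neq0 (isordM hm hk); rewrite ab eqxx.
Qed.
HB.instance Definition _ := GRing.ComUnitRing_isIntegral.Build (ps K) ps_integral.

End SeriesDomain.

Section FormalEmbedding.
Variable K : numClosedFieldType.

Definition embf (p : {poly ps K}) : ps (ps K) := (map_poly (psmap (@psC K)) p).[psC psX].

Lemma embfD p q : embf (p + q) = embf p + embf q. Proof. by rewrite /embf rmorphD hornerD. Qed.
Lemma embfM p q : embf (p * q) = embf p * embf q. Proof. by rewrite /embf rmorphM hornerM. Qed.
Lemma embfC c : embf c%:P = psmap (@psC K) c. Proof. by rewrite /embf map_polyC hornerC. Qed.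
Lemma embfX : embf 'X = psC psX. Proof. by rewrite /embf map_polyX hornerX. Qed.

Lemma embf_coef p i j : embf p i j = p`_j i.
Proof.
elim/poly_ind: p i j => [|p c IH] i j; first by rewrite /embf rmorph0 horner0 coef0.
rewrite embfD embfM embfX embfC !psD coefD coefMX coefC [_ * psC psX]mulrC psCM psD /psmap.
case: j => [|j]; first by rewrite psXM0 !add0r.
by rewrite psXMS IH.
Qed.

Lemma comp2_embf (p : {poly ps K}) (b : ps K) : b 0%N = 0 -> comp2 psX b (embf p) = p.[b].
Proof.
move=> b0; elim/poly_ind: p => [|p c IH]; first by rewrite /embf rmorph0 !horner0 (rmorph0 (comp2 psX b)).
rewrite embfD embfM embfX embfC rmorphD rmorphM /= IH comp2C scompX psv_id // comp2_map scomp_id.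
by rewrite !hornerE.
Qed.

Lemma infl_embf m (p : {poly ps K}) : (0 < m)%N -> infl m (embf p) = embf (map_poly (infl m) p).
Proof.
move=> m0; apply/funext => i; apply/funext => j.
rewrite embf_coef coef_map [RHS](inflE _ _ m0).
rewrite -[LHS]/((infl m (embf p) i) j) (inflE (embf p) i m0).
by case: ifP => // _; rewrite embf_coef.
Qed.

End FormalEmbedding.

Section Puiseux.
Variable K : numClosedFieldType.
Local Notation P0 := (map_poly (@coef_at0 K)).
Implicit Types p q : {poly ps K}.

(** A Puiseux root b(x^(1/m)) of q, expressed by substituting x^m for x. *)
Definition inflation_root q := exists m b, (0 < m)%N /\ root (map_poly (infl m) q) b.

Lemma horner_shift (R : comNzRingType) (q : {poly R}) c b : (q \Po ('X + c%:P)).[b] = q.[b + c].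
Proof. by rewrite horner_comp !hornerE. Qed.

Lemma monic_shift (R : idomainType) (q : {poly R}) c : q \is monic -> q \Po ('X + c%:P) \is monic.
Proof.
move=> mq; rewrite monicE lead_coef_comp ?size_XaddC //.
by rewrite lead_coefXaddC expr1n mulr1.
Qed.

Lemma size_exp_XaddC (R : idomainType) (c : R) n : size (('X + c%:P) ^+ n) = n.+1.
Proof. by rewrite -[c]opprK rmorphN size_exp_XsubC. Qed.

Lemma coef_XaddC_exp (R : idomainType) (c : R) n : (('X + c%:P) ^+ n.+1)`_n = c *+ n.+1.
Proof.
elim: n => [|n IH]; first by rewrite expr1 coefD coefX coefC add0r.
rewrite exprS mulrDl coefD coefXM coefCM IH /= [LHS]addrC.
have : ('X + c%:P) ^+ n.+1 \is monic by rewrite monic_exp // monicXaddC.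
by rewrite monicE lead_coefE size_exp_XaddC /= => /eqP ->; rewrite mulr1 -mulrS.
Qed.

Lemma coef_shift (R : idomainType) (q : {poly R}) c n : q \is monic -> size q = n.+2 ->
  (q \Po ('X + c%:P))`_n = q`_n + c *+ n.+1.
Proof.
move=> mq sq; have qn : q`_n.+1 = 1 by move: mq; rewrite monicE lead_coefE sq => /eqP.
rewrite comp_polyE coef_sum sq !big_ord_recr /= big1 ?add0r => [|i _].
  rewrite !coefZ qn mul1r coef_XaddC_exp.
  have : ('X + c%:P) ^+ n \is monic by rewrite monic_exp // monicXaddC.
  by rewrite monicE lead_coefE size_exp_XaddC /= => /eqP ->; rewrite mulr1.
by rewrite coefZ [X in _ * X]nth_default ?mulr0 // size_exp_XaddC.
Qed.

(* Weierstrass preparation splits off the factor of the roots that reduce to a given root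
   of the reduction. *)
Lemma inflation_root_split n q (a : K) (r : nat) (e : {poly K}) :
  (forall m p, (m < n)%N -> p \is monic -> size p = m.+2 -> inflation_root p) ->
  q \is monic -> P0 q \Po ('X + a%:P) = 'X^r * e -> e`_0 != 0 -> (0 < r <= n)%N ->
  inflation_root q.
Proof.
move=> IH mq eq e0 /andP[r0 rn].
pose p := q \Po ('X + (psC a)%:P).
have p0 j : embf p 0%N j = if (j < r)%N then 0 else e`_(j - r).
  rewrite embf_coef -[_ 0%N]/(coef_at0 _) -coef_map /p map_comp_poly rmorphD /= map_polyX map_polyC /=.
  have -> : coef_at0 (psC a) = a by [].
  by rewrite eq coefXnM.
have hr j : (j < r)%N -> embf p 0%N j = 0 by move=> hj; rewrite p0 hj.
have hrr : embf p 0%N r != 0 by rewrite p0 ltnn subnn.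
(* The shifted polynomial p is regular of order r in y. Dividing y^r by it gives y^r = p u + R with
   u a unit, and W = y^r - R is the Weierstrass polynomial of the roots near a. *)
pose g : ps (ps K) := psC (psX ^+ r).
have hR := wquoP g hr hrr; set u := wquo r (embf p) g in hR.
pose R := g - embf p * u.
pose Rc j : ps K := fun i => R i j.
pose W : {poly ps K} := 'X^r - \poly_(j < r) Rc j.
have WE : embf W = embf p * u.
  apply/funext => i; apply/funext => j; rewrite embf_coef coefB coefXn coef_poly.
  have -> : embf p * u = g - R by rewrite opprB addrC subrK.
  rewrite psB [in RHS]psB psB; congr (_ - _).
    rewrite /g; case: i => [|i]; rewrite /= ?psXn; first by case: eqP.
    by case: eqP => _; rewrite ?ps1.
  by case: ltnP => // hj; exact/esym/hR.
have sz : (size (\poly_(j < r) Rc j) < size ('X^r : {poly ps K}))%N.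
  by rewrite size_polyXn ltnS size_poly.
have mW : W \is monic by rewrite monicE lead_coefDl ?size_polyN // lead_coefXn.
have sW : size W = r.+1 by rewrite size_polyDl ?size_polyN // size_polyXn.
have u00 : u 0%N 0%N != 0.
  have : embf W 0%N r = (embf p * u) 0%N r by rewrite WE.
  rewrite embf_coef psM_0 psM big_ord_recr /= subnn big1 ?add0r => [|i _]; last by rewrite hr ?mul0r.
  move: mW; rewrite monicE lead_coefE sW => /eqP /= ->; rewrite ps1 /= => h.
  by apply/eqP => u0; move/eqP: h; rewrite u0 mulr0 oner_eq0.
have [m [b [m0 hb]]] : inflation_root W.
  by case: (r) r0 rn sW => // r' _ hr' sW; apply: (IH r').
have W0 : P0 W = 'X^r.
  apply/polyP => j; rewrite coef_map coefXn; have [jr|jr] := ltnP j r.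
    rewrite ltn_eqF // -[LHS]/(W`_j 0%N) -embf_coef WE psM_0 psM big1 // => i _.
    by rewrite hr ?mul0r // (leq_trans _ jr) // ltn_ord.
  have [->|nj] := eqVneq j r.
    by move: mW; rewrite monicE lead_coefE sW => /eqP /= ->; rewrite rmorph1.
  by rewrite nth_default ?rmorph0 // sW ltn_neqAle eq_sym nj.
have b0 : b 0%N = 0.
  have : coef_at0 (map_poly (infl m) W).[b] = 0 by rewrite (rootP hb) rmorph0.
  rewrite -horner_map -map_poly_comp (eq_map_poly (g := @coef_at0 K)); last first.
    by move=> x; exact: scomp_0.
  by rewrite W0 hornerXn => /eqP; rewrite expf_eq0 r0 => /eqP.
exists m, (b + psC a); split=> //; apply/rootP.
have : comp2 psX b (infl m (embf W)) = 0 by rewrite infl_embf // comp2_embf // (rootP hb).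
rewrite WE (rmorphM (@infl (ps K) m)) rmorphM /= infl_embf // comp2_embf // => /eqP.
rewrite mulf_eq0 => /orP[/eqP|/eqP h]; last first.
  have := congr1 (fun f : ps K => f 0%N) h; rewrite comp2_0 (scomp_0 _ u : infl m u 0%N = _) => /eqP.
  by rewrite (negbTE u00).
rewrite /p map_comp_poly rmorphD /= map_polyX map_polyC /= {1}/infl scompC.
by rewrite horner_shift.
Qed.

End Puiseux.

Section PuiseuxTheorem.
Variable K : numClosedFieldType.
Local Notation P0 := (map_poly (@coef_at0 K)).
Implicit Types p q : {poly ps K}.

(** A root a of full multiplicity would give g = (X - a)^(N+1), whose vanishing coefficient of
    degree N forces a = 0 and then g = X^(N+1), against the nonzero coefficient g_j. *)
Lemma split_root_multiplicity (g : {poly K}) N j : g \is monic -> size g = N.+2 ->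
  g`_N = 0 -> (j <= N)%N -> g`_j != 0 ->
  exists a r e, [/\ g \Po ('X + a%:P) = 'X^r * e, e`_0 != 0 & (0 < r <= N)%N].
Proof.
move=> mg sg gN jN gj.
have g0 : g != 0 by exact: monic_neq0.
have [|a ra] := closed_rootP g _; first by rewrite sg.
have [m [h]] := multiplicity_XsubC g a; rewrite g0 /= => ha gE.
have mh : h \is monic by rewrite -(monicMr h (monic_exp m (monicXsubC a))) -gE.
have sh : (size h + m = N.+2)%N.
  move: sg; rewrite gE size_Mmonic ?monic_neq0 ?monic_exp ?monicXsubC // size_exp_XsubC.
  by rewrite addnS.
exists a, m, (h \Po ('X + a%:P)); split.
- by rewrite gE comp_polyM rmorphXn /= comp_polyD comp_polyX -polyCN comp_polyC polyCN addrK mulrC.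
- by rewrite -horner_coef0 horner_shift add0r.
apply/andP; split.
  by case: m gE ha {sh} => // gE /negP; rewrite expr0 mulr1 in gE; rewrite -gE.
rewrite -ltnS ltn_neqAle; apply/andP; split; last first.
  by rewrite -ltnS -sh -addn1 addnC leq_add2r lt0n size_poly_eq0 monic_neq0.
apply/eqP => mN; have h1 : h = 1.
  have /size_poly1P [c c0 hc] : size h == 1%N by rewrite -(eqn_add2r m) sh mN.
  by move: mh; rewrite hc monicE lead_coefC => /eqP ->.
move: gN gj; rewrite gE h1 mul1r mN -[a]opprK polyCN opprK coef_XaddC_exp.
rewrite -mulr_natr => /eqP; rewrite mulf_eq0 pnatr_eq0 orbF => /eqP ->.
by rewrite addr0 coefXn ltn_eqF ?eqxx.
Qed.

(** The first slope of the Newton polygon, the minimum of o_j / (M - j); multiplying by M! keeps the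
    minimisation in the natural numbers. *)
Lemma minimal_slope (o : nat -> nat) (P : pred nat) M :
  (exists2 j, (j < M)%N & P j) ->
  exists2 j, (j < M)%N /\ P j & forall k, (k < M)%N -> P k -> (o j * (M - k) <= o k * (M - j))%N.
Proof.
move=> [j0 hj0 Pj0].
pose key j := (o j * (M`! %/ (M - j)))%N.
have ex : exists m, [exists j : 'I_M, P j && (key j == m)].
  by exists (key j0); apply/existsP; exists (Ordinal hj0); rewrite Pj0 eqxx.
case: (ex_minnP ex) => m /existsP [j /andP [Pj /eqP kj]] min.
exists j => // k hk Pk; have le : (key j <= key k)%N.
  by rewrite kj; apply: min; apply/existsP; exists (Ordinal hk); rewrite Pk eqxx.
have F i : (i < M)%N -> (M`! %/ (M - i) * (M - i) = M`!)%N.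
  by move=> hi; rewrite divnK // dvdn_fact // subn_gt0 hi leq_subr.
have kE i : (i < M)%N -> (key i * (M - i) = o i * M`!)%N by move=> hi; rewrite /key -mulnA F.
rewrite -(leq_pmul2r (fact_gt0 M)) mulnAC -kE // [leqRHS]mulnAC -kE //.
by rewrite mulnAC leq_mul2r leq_mul2r le !orbT.
Qed.

Lemma puiseux_root N q : q \is monic -> size q = N.+2 -> inflation_root q.
Proof.
elim/ltn_ind: N q => N IH q mq sq.
(* The Tschirnhaus shift: it kills the coefficient of degree N, as [split_root_multiplicity]
   requires. *)
pose c : ps K := psC ((N.+1%:R)^-1) * - q`_N.
pose p := q \Po ('X + c%:P).
have mp : p \is monic by exact: monic_shift.
have sp : size p = N.+2 by rewrite size_comp_poly2 ?size_XaddC.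
have pN : p`_N = 0.
  have e : psC ((N.+1%:R : K)^-1) *+ N.+1 = 1.
    by rewrite -raddfMn /= -[X in psC X]mulr_natr mulVf ?pnatr_eq0 // rmorph1.
  by rewrite coef_shift // /c -mulrnAl e mul1r subrr.
have pN1 : p`_N.+1 = 1 by move: mp; rewrite monicE lead_coefE sp => /eqP.
have [[j jN pj]|all0] := pselect (exists2 j, (j < N.+1)%N & p`_j != 0); last first.
  have pE : p = 'X^(N.+1).
    apply/polyP => j; rewrite coefXn; case: ltngtP => jN.
    - by apply/eqP/negPn/negP => h; apply: all0; exists j.
    - by rewrite nth_default // sp.
    - by rewrite jN pN1.
  exists 1%N, c; split=> //; apply/rootP.
  have -> : map_poly (infl 1) q = q.
    by apply/polyP => i; rewrite coef_map /= /infl expr1 scomp_id.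
  by rewrite -[c]add0r -horner_shift -/p pE hornerXn expr0n.
have [f hf] : exists f : nat -> nat, forall j, p`_j != 0 -> isord (f j) p`_j.
  suff /choice [f hf] : forall j, exists m, p`_j != 0 -> isord m p`_j by exists f.
  move=> i; have [->|p0] := eqVneq p`_i 0; first by exists 0%N.
  by have [m hm] := isord_exists p0; exists m.
have [j0 [j0N pj0] hmin] := @minimal_slope f (fun j => p`_j != 0) N.+1 (ex_intro2 _ _ j jN pj).
(* The minimal slope is s / l. After x -> x^l the coefficient of y^i is divisible by x^(s(M-i)),
   with exact order at i = j0. Replacing y by x^s y and dividing by x^(sM) leaves a monic polynomial
   whose reduction has a nonzero coefficient at j0. *)
pose M := N.+1; pose l := (M - j0)%N; pose s := f j0.
have l0 : (0 < l)%N by rewrite subn_gt0.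
pose p1 := map_poly (infl l) p.
have o1 i : (i <= M)%N -> ordge (s * (M - i)) p1`_i.
  rewrite leq_eqVlt => /orP[/eqP ->|iM]; first by rewrite subnn muln0.
  rewrite coef_map /=; have [->|p0] := eqVneq p`_i 0; first by rewrite rmorph0.
  apply: (ordge_le (m := (l * f i)%N)); last exact: (isord_infl l0 (hf i p0)).1.
  by rewrite [(l * _)%N]mulnC; exact: hmin.
pose c2 i : ps K := fun k => p1`_i (k + s * (M - i))%N.
have c2E i : (i <= M)%N -> p1`_i = psX ^+ (s * (M - i)) * c2 i by move=> hi; exact: ordgeP (o1 i hi).
pose p2 : {poly ps K} := \poly_(i < M.+1) c2 i.
have c2M : c2 M = 1.
  have := c2E M (leqnn _); rewrite subnn muln0 expr0 mul1r => <-.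
  by rewrite /p1 coef_map /= pN1 (rmorph1 (infl l)).
have p2M : p2`_M = 1 by rewrite coef_poly ltnSn.
have sp2 : size p2 = N.+2.
  apply/eqP; rewrite eqn_leq size_poly ltnNge; apply/negP => /leq_sizeP/(_ M (leqnn _)).
  by rewrite p2M => /eqP; rewrite oner_eq0.
have mp2 : p2 \is monic by rewrite monicE lead_coefE sp2 p2M.
have p2c i : (i <= M)%N -> (P0 p2)`_i = p1`_i (s * (M - i))%N.
  by move=> hi; rewrite coef_map coef_poly ltnS hi.
have [|||||a [r [e [e1 e2 e3]]]] := @split_root_multiplicity (P0 p2) N j0.
- by rewrite monic_map.
- by rewrite size_map_poly_id0 // (monicP mp2) rmorph1 oner_eq0.
- by rewrite p2c ?leqnSn // /p1 coef_map /= pN (rmorph0 (infl l)).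
- by [].
- rewrite p2c 1?ltnW // mulnC /p1 coef_map /=; exact: (isord_infl l0 (hf j0 pj0)).2.
have [m [b [m0 hb]]] := inflation_root_split (fun m p h => IH m h p) mp2 e1 e2 e3.
exists (m * l)%N, (psX ^+ (s * m) * b + infl (m * l) c); split; first by rewrite muln_gt0 m0.
apply/rootP; rewrite -horner_shift.
have -> : map_poly (infl (m * l)) q \Po ('X + (infl (m * l) c)%:P) = map_poly (infl m) p1.
  rewrite /p1 -map_poly_comp /p (eq_map_poly (g := infl (m * l))) => [|x]; last by rewrite /= infl_infl.
  by rewrite map_comp_poly rmorphD /= map_polyX map_polyC.
rewrite (@horner_coef_wide _ M.+1); last first.
  by rewrite (leq_trans (size_poly _ _)) // (leq_trans (size_poly _ _)) // sp.
transitivity (psX ^+ (s * m * M) * (map_poly (infl m) p2).[b]); last by rewrite (rootP hb) mulr0.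
rewrite (@horner_coef_wide _ M.+1) ?(leq_trans (size_poly _ _)) ?sp2 // mulr_sumr.
apply: eq_bigr => i _; have iM : (i <= M)%N by rewrite -ltnS.
rewrite [(map_poly (infl m) p1)`_i]coef_map [(map_poly (infl m) p2)`_i]coef_map /= (c2E i iM).
have -> : p2`_i = c2 i by rewrite coef_poly ltn_ord.
have -> : (s * m * M = m * (s * (M - i)) + s * m * i)%N.
  by rewrite -[X in (_ * X)%N = _](subnK iM); ring.
rewrite rmorphM rmorphXn /= {1}/infl scompX psv_id; last by rewrite psXn eq_sym gtn_eqF.
by rewrite exprD -exprM exprMn -exprM; ring.
Qed.

Theorem puiseux N q : q \is monic -> size q = N.+1 ->
  exists m (s : seq (ps K)), (0 < m)%N /\ map_poly (infl m) q = \prod_(b <- s) ('X - b%:P).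
Proof.
elim: N q => [|N IH] q mq sq.
  exists 1%N, [::]; split=> //; rewrite big_nil.
  have /size_poly1P [c c0 qc] : size q == 1%N by rewrite sq.
  by move: mq; rewrite qc monicE lead_coefC => /eqP ->; rewrite map_polyC /= rmorph1.
have [m [b [m0 /factor_theorem [q' e]]]] := puiseux_root mq sq.
have mq' : q' \is monic by rewrite -(monicMr q' (monicXsubC b)) -e monic_map.
have sq' : size q' = N.+1.
  have : size (map_poly (infl m) q) = N.+2.
    by rewrite size_map_poly_id0 // (monicP mq) rmorph1 oner_eq0.
  by rewrite e size_Mmonic ?monic_neq0 ?monicXsubC // size_XsubC addn2 /= => -[].
have [m' [s [m'0 hs]]] := IH q' mq' sq'.
exists (m' * m)%N, (infl m' b :: s); split; first by rewrite muln_gt0 m'0.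
rewrite (eq_map_poly (g := infl m' \o infl m)) => [|x]; last by rewrite /= infl_infl.
rewrite map_poly_comp e rmorphM /= hs big_cons mulrC; congr (_ * _).
by rewrite rmorphB /= map_polyX map_polyC.
Qed.

End PuiseuxTheorem.

(** * Multiplication modulo a distinguished polynomial *)

Lemma monic_mul_small (R : nzRingType) (q w : {poly R}) N :
  q \is monic -> size q = N.+1 -> (size (w * q)%R <= N)%N -> w = 0.
Proof.
move=> mq sq; have [//|w0] := eqVneq w 0.
by rewrite size_Mmonic // sq addnS /= -[X in (_ <= X)%N]add0n leq_add2r leqn0 size_poly_eq0 (negbTE w0).
Qed.

Section MultiplicationDeterminant.
Variables (R : comNzRingType) (s : seq R) (h : {poly R}).
Local Notation N := (size s).
Local Notation q := (\prod_(b <- s) ('X - b%:P)).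

(** The basis of Newton interpolation at the roots. *)
Definition newton_poly i : {poly R} := \prod_(b <- take i s) ('X - b%:P).

Lemma newton_polyS i : (i < N)%N -> newton_poly i.+1 = newton_poly i * ('X - (s`_i)%:P).
Proof. by move=> hi; rewrite /newton_poly (take_nth 0) // -cats1 big_cat big_seq1. Qed.

Lemma size_newton_poly i : (i <= N)%N -> size (newton_poly i) = i.+1.
Proof. by move=> hi; rewrite size_prod_XsubC size_takel. Qed.

(** In this basis multiplication by f modulo q is triangular with f(s_i) on the diagonal: f - f(s_i)
    is divisible by X - s_i, which turns the i-th basis element into the next. The induction
    descends from i = N, where the product is a multiple of q. *)
Lemma newton_expansion i (f : {poly R}) : (i <= N)%N -> exists (c : nat -> R) (w : {poly R}),
  newton_poly i * f = \sum_(i <= j < N) c j *: newton_poly j + w * q /\ ((i < N)%N -> c i = f.[s`_i]).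
Proof.
move=> iN; rewrite -(subKn iN); move: (N - i)%N (leq_subr i N) => k.
elim: k f => [|k IH] f kN.
  exists (fun=> 0), f; rewrite subn0 big_geq // add0r ltnn; split=> //.
  by rewrite /newton_poly take_size mulrC.
have hk : (N - k.+1 < N)%N by rewrite ltn_subrL /= (leq_trans _ kN).
have [f1 e1] : exists f1, f - f.[s`_(N - k.+1)]%:P = f1 * ('X - (s`_(N - k.+1))%:P).
  by apply/factor_theorem/rootP; rewrite !hornerE subrr.
have [c [w [e2 _]]] := IH f1 (ltnW kN).
have ek : (N - k = (N - k.+1).+1)%N by rewrite -subSn.
exists (fun j => if (j == N - k.+1)%N then f.[s`_(N - k.+1)] else c j), w; split; last by rewrite eqxx.
rewrite [in RHS]big_ltn // eqxx -ek.
have -> : \sum_(N - k <= j < N) (if (j == N - k.+1)%N then f.[s`_(N - k.+1)] else c j) *: newton_poly j =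
    \sum_(N - k <= j < N) c j *: newton_poly j.
  by apply: eq_big_nat => j /andP[hj _]; rewrite gtn_eqF // -ek.
have -> : newton_poly (N - k.+1) * f = newton_poly (N - k) * f1 + f.[s`_(N - k.+1)] *: newton_poly (N - k.+1).
  by rewrite -[in LHS](subrK (f.[s`_(N - k.+1)])%:P f) e1 ek newton_polyS // -mul_polyC; ring.
by rewrite e2; ring.
Qed.

(** M is multiplication by h modulo q in the monomial basis. The unitriangular change V to the
    Newton basis makes it the triangular T, with diagonal h(s_i); repeated roots are covered. *)
Lemma det_mult_mod (M : 'M[R]_N) :
  (forall i : 'I_N, exists w, 'X^i * h = w * q + rVpoly (row i M)) ->
  \det M = \prod_(b <- s) h.[b].
Proof.
move=> hM; have [w hw] := choice hM.
have /choice [c hc] : forall i : 'I_N, exists c : nat -> R, exists w : {poly R},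
    newton_poly i * h = \sum_(i <= j < N) c j *: newton_poly j + w * q /\ c i = h.[s`_i].
  move=> i; have [c [v [e1 e2]]] := newton_expansion h (ltnW (ltn_ord i)).
  by exists c, v; split=> //; exact: e2.
pose T : 'M[R]_N := \matrix_(i, j) (if (i <= j)%N then c i j else 0).
pose V : 'M[R]_N := \matrix_(i, j) (newton_poly i)`_j.
have mq : q \is monic by exact: monic_prod_XsubC.
have sq : size q = N.+1 by rewrite size_prod_XsubC.
have VE i : rVpoly (row i V) = newton_poly i.
  apply/polyP => j; rewrite coef_rVpoly; case: insubP => [k _ <-|]; first by rewrite !mxE.
  by rewrite -leqNgt => hj; rewrite nth_default // size_newton_poly ?(leq_trans _ hj) // ltnW.
have E : V *m M = T *m V.
  apply/row_matrixP => i; apply: (can_inj (@rVpolyK _ _)).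
  have [v [e1 _]] := hc i.
  have eL : newton_poly i * h = (\sum_(k < N) (newton_poly i)`_k *: w k) * q + rVpoly (row i (V *m M)).
    rewrite row_mul mulmx_sum_row linear_sum /=.
    have nE : newton_poly i = \sum_(k < N) (newton_poly i)`_k *: 'X^k.
      rewrite -[LHS]VE; apply/polyP => k; rewrite coef_rVpoly coef_sum; case: insubP => [l _ <-|].
        rewrite (bigD1 l) //= coefZ coefXn eqxx mulr1 !mxE big1 ?addr0 // => m ml.
        by rewrite coefZ coefXn val_eqE eq_sym (negbTE ml) mulr0.
      rewrite -leqNgt => hk; rewrite big1 // => l _.
      by rewrite coefZ coefXn gtn_eqF ?mulr0 // (leq_trans (ltn_ord l)).
    rewrite {1}nE mulr_suml mulr_suml -big_split; apply: eq_bigr => k _ /=.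
    by rewrite [rVpoly _]linearZ !mxE -[LHS]scalerAl hw scalerDr scalerAl.
  have eR : newton_poly i * h = v * q + rVpoly (row i (T *m V)).
    rewrite e1 addrC; congr (_ + _); rewrite row_mul mulmx_sum_row linear_sum /=.
    rewrite big_geq_mkord big_mkcond /=; apply: eq_bigr => j _.
    by rewrite linearZ /= VE !mxE; case: ifP => //; rewrite scale0r.
  have : ((\sum_(k < N) (newton_poly i)`_k *: w k) - v) * q = rVpoly (row i (T *m V)) - rVpoly (row i (V *m M)).
    rewrite mulrBl; apply: (addIr (rVpoly (row i (V *m M)))).
    by rewrite subrK addrAC -eL eR addrAC subrr add0r.
  move=> e2; have /(monic_mul_small mq sq) z : (size (((\sum_(k < N) (newton_poly i)`_k *: w k) - v) * q)%R <= N)%N.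
    by rewrite e2 -raddfB /= size_poly.
  by move: e2; rewrite z mul0r => /esym/eqP; rewrite subr_eq0 => /eqP.
have dV : \det V = 1.
  rewrite det_trig; last first.
    apply/is_trig_mxP => i j ij; rewrite mxE nth_default // size_newton_poly //.
    exact: ltnW.
  rewrite big1 // => i _; rewrite mxE.
  have : newton_poly i \is monic by exact: monic_prod_XsubC.
  by rewrite monicE lead_coefE size_newton_poly ?(ltnW (ltn_ord i)) // => /eqP.
have dT : \det T = \prod_(b <- s) h.[b].
  rewrite -det_tr det_trig; last first.
    by apply/is_trig_mxP => i j ij; rewrite !mxE leqNgt ij.
  rewrite [RHS](big_nth 0) big_mkord; apply: eq_bigr => i _; rewrite !mxE leqnn.
  by have [v [_ ->]] := hc i.
by have := congr1 determinant E; rewrite !det_mulmx dV mul1r mulr1 dT.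
Qed.

End MultiplicationDeterminant.

Section IdealCodimension.
Variables (K : numFieldType) (N : nat) (q h : {poly cps K}).
Hypothesis dq : distinguished N q.
Local Notation A := (cps K).
Local Notation O := (cps2 K).

Lemma exists_remainder (g : O) : exists r : {poly A}, (size r <= N)%N /\ exists u : O, g = emb q * u + emb r.
Proof. by have [u [r [sr e]]] := emb_division g dq; exists r; split=> //; exists u. Qed.

Definition remainder (g : O) : {poly A} := projT1 (cid (exists_remainder g)).

Lemma size_remainder g : (size (remainder g) <= N)%N.
Proof. by rewrite /remainder; case: cid => r []. Qed.

Lemma remainderE g : exists u, g = emb q * u + emb (remainder g).
Proof. by rewrite /remainder; case: cid => r []. Qed.

Lemma remainder_uniq (g u : O) (r : {poly A}) : (size r <= N)%N -> g = emb q * u + emb r -> remainder g = r.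
Proof.
move=> sr e; have [v e'] := remainderE g.
have [] := @emb_division_uniq _ N q (v - u) (remainder g - r) dq.
- by rewrite (leq_trans (size_polyD _ _)) // size_polyN geq_max size_remainder sr.
- by rewrite embD embN mulrBr addrACA -opprD -e' -e subrr.
by move=> _ /eqP; rewrite subr_eq0 => /eqP.
Qed.

Lemma remainderD (g1 g2 : O) : remainder (g1 + g2) = remainder g1 + remainder g2.
Proof.
have [u1 e1] := remainderE g1; have [u2 e2] := remainderE g2.
apply: (@remainder_uniq _ (u1 + u2)).
  by rewrite (leq_trans (size_polyD _ _)) // geq_max !size_remainder.
by rewrite {1}e1 {1}e2 embD mulrDr addrACA.
Qed.

Lemma remainderZ (a : A) (g : O) : remainder (cps2X a * g) = a *: remainder g.
Proof.
have [u e] := remainderE g; apply: (@remainder_uniq _ (cps2X a * u)).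
  exact: leq_trans (size_scale_leq _ _) (size_remainder g).
by rewrite {1}e embZ mulrDr mulrCA.
Qed.

Lemma remainder_emb (r : {poly A}) : (size r <= N)%N -> remainder (emb r) = r.
Proof. by move=> sr; apply: (@remainder_uniq _ 0) => //; rewrite mulr0 add0r. Qed.

Lemma remainder0 (u : O) : remainder (emb q * u) = 0.
Proof. by apply: (@remainder_uniq _ u); rewrite ?size_poly0 // emb0 addr0. Qed.

Definition remrow (g : O) : 'rV[A]_N := poly_rV (remainder g).
Definition mult_mx : 'M[A]_N := \matrix_(i, j) (remainder (emb ('X^i * h)))`_j.

Lemma remainder_mul (r : {poly A}) : (size r <= N)%N ->
  remrow (emb (r * h)) = poly_rV r *m mult_mx.
Proof.
move=> sr; have rE : r = \sum_(i < N) r`_i *: 'X^i.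
  apply/polyP => j; rewrite coef_sum; have [hj|hj] := ltnP j N.
    rewrite (bigD1 (Ordinal hj)) //= coefZ coefXn eqxx mulr1 big1 ?addr0 // => i ij.
    rewrite coefZ coefXn; case: eqP => [e|]; last by rewrite mulr0.
    by case/eqP: ij; apply: val_inj.
  rewrite nth_default ?(leq_trans sr) // big1 // => i _.
  by rewrite coefZ coefXn gtn_eqF ?mulr0 // (leq_trans (ltn_ord i)).
have -> : remrow (emb (r * h)) = \sum_(i < N) r`_i *: row i mult_mx.
  apply/rowP => j; rewrite !mxE {1}rE mulr_suml.
  have -> : remainder (emb (\sum_(i < N) r`_i *: 'X^i * h)) =
      \sum_(i < N) r`_i *: remainder (emb ('X^i * h)).
    elim/big_rec2: _ => [|i x y _ <-]; first by rewrite remainder_emb // size_poly0.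
    by rewrite embD remainderD -scalerAl embZ remainderZ.
  by rewrite coef_sum summxE; apply: eq_bigr => i _; rewrite coefZ !mxE.
by rewrite mulmx_sum_row; apply: eq_bigr => i _; rewrite mxE.
Qed.

Definition ideal2 (g : O) := exists u v : O, g = u * emb h + v * emb q.

(** Modulo q the ring K{x, y} is free over K{x} on 1, y, ..., y^(N-1). The multiplier u of h matters
    only modulo q, so the ideal becomes the row lattice of multiplication by h. *)
Lemma ideal2_lattice g : ideal2 g <-> lattice mult_mx (remrow g).
Proof.
split=> [[u [v e]]|[w hw]].
  have [u' eu] := remainderE u.
  exists (poly_rV (remainder u)); rewrite -remainder_mul ?size_remainder //.
  have -> : g = emb q * (u' * emb h + v) + emb (remainder u * h).
    by rewrite e {1}eu embM; ring.
  by rewrite /remrow remainderD remainder0 add0r.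
have sw : (size (rVpoly w) <= N)%N by rewrite size_poly.
have hr : remainder g = remainder (emb (rVpoly w * h)).
  have : remrow g = remrow (emb (rVpoly w * h)) by rewrite remainder_mul // rVpolyK.
  by move/(congr1 rVpoly); rewrite !poly_rV_K ?size_remainder.
have [u1 e1] := remainderE g; have [u2 e2] := remainderE (emb (rVpoly w * h)).
exists (emb (rVpoly w)), (u1 - u2); rewrite -embM {1}e1 hr [in RHS]e2; ring.
Qed.

Definition cps2_scale (c : K) (g : O) : O := cps2X (cpsC c) * g.

Theorem ideal2_codim D : isord D (cval (\det mult_mx)) -> has_codim cps2_scale ideal2 D.
Proof.
move=> hD; apply: (has_codim_transfer (T := remrow)) (lattice_codim hD).
- by move=> x y; rewrite /remrow remainderD linearD.
- by move=> c x; rewrite /remrow /cps2_scale remainderZ linearZ.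
- move=> w; exists (emb (rVpoly w)); rewrite /remrow remainder_emb ?size_poly //.
  exact: rVpolyK.
- exact: ideal2_lattice.
Qed.

(** Euclidean division of polynomials by the monic q is also a Weierstrass division, so by
    uniqueness the remainders agree and [det_mult_mod] becomes applicable. *)
Lemma mult_mx_mod (i : 'I_N) : exists w, 'X^i * h = w * q + rVpoly (row i mult_mx).
Proof.
have [mq sq _] := dq; exists (Pdiv.Ring.rdivp ('X^i * h) q).
have e := Pdiv.RingMonic.rdivp_eq mq ('X^i * h).
have sr : (size (Pdiv.Ring.rmodp ('X^i * h) q) <= N)%N.
  by rewrite -ltnS -sq Pdiv.Ring.ltn_rmodpN0 ?monic_neq0.
rewrite {1}e; congr (_ + _).
have -> : row i mult_mx = remrow (emb ('X^i * h)) by apply/rowP => j; rewrite !mxE.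
rewrite /remrow (remainder_uniq (u := emb (Pdiv.Ring.rdivp ('X^i * h) q)) (r := Pdiv.Ring.rmodp ('X^i * h) q)) ?poly_rV_K //.
by rewrite -embM -embD {1}e mulrC.
Qed.

End IdealCodimension.

(** * The Milnor number of the normal form *)

Section Derivation.
Variable R : comNzRingType.
Implicit Types a b : ps R.

Definition psderiv a : ps R := fun k => a k.+1 *+ k.+1.

Lemma psderiv_additive : additive psderiv.
Proof. by move=> a b; apply/funext => k; rewrite /psderiv psB mulrnBl. Qed.
HB.instance Definition _ := GRing.isZmodMorphism.Build (ps R) (ps R) psderiv psderiv_additive.

Lemma psderivM a b : psderiv (a * b) = psderiv a * b + a * psderiv b.
Proof.
apply/funext => k; pose p := trunc_poly k.+2 a; pose q := trunc_poly k.+2 b.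
have hp i : (i <= k.+1)%N -> p`_i = a i by move=> hi; rewrite coef_trunc_poly.
have hq i : (i <= k.+1)%N -> q`_i = b i by move=> hi; rewrite coef_trunc_poly.
rewrite psD /psderiv -[(a * b) k.+1]/(psmul a b k.+1) (psmul_coef hp hq) -coef_deriv derivM coefD.
congr (_ + _); apply/esym/psmul_coef => i hi; rewrite ?coef_deriv ?hp ?hq // ltnW //.
Qed.

Lemma psderivC c : psderiv (psC c) = 0.
Proof. by apply/funext => k; rewrite /psderiv mul0rn. Qed.

Lemma psderivD a b : psderiv (a + b) = psderiv a + psderiv b.
Proof. exact: (raddfD psderiv). Qed.

Lemma psderivX : psderiv psX = 1.
Proof. by apply/funext => -[|k]; rewrite /psderiv /psX ps1 //= mul0rn. Qed.

Lemma psderiv_Xn n : psderiv (psX ^+ n) = (psX ^+ n.-1) *+ n.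
Proof.
elim: n => [|n IH].
  by rewrite expr0 mulr0n -(rmorph1 (@psC R)) psderivC.
rewrite exprS psderivM psderivX mul1r IH mulrnAr mulrS; congr (_ + _).
by case: n {IH} => [|n]; rewrite ?mulr0n // -exprS.
Qed.

(* The difference E(a) of the two sides satisfies E(X a) = f E(a). *)
Lemma psderiv_scomp f a : psderiv (scomp f a) = scomp f (psderiv a) * psderiv (psv f).
Proof.
apply/eqP; rewrite -subr_eq0; apply/eqP/ordge_all => m.
elim: m a => [|m IH] a //.
have E : psderiv (psC (a 0%N) + psX * psshift a) = psshift a + psX * psderiv (psshift a).
  by rewrite psderivD psderivC psderivM psderivX mul1r add0r.
rewrite {1}(ps_shiftE a) [in X in _ - X](ps_shiftE a) E !rmorphD !rmorphM /= scompC scompX.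
rewrite psderivD psderivC add0r psderivM.
rewrite [X in ordge _ X](_ : _ = psv f * (psderiv (scomp f (psshift a)) -
  scomp f (psderiv (psshift a)) * psderiv (psv f))); last by ring.
by rewrite -add1n; apply: ordgeM; [exact: ordge_psv|exact: IH].
Qed.

Lemma psderiv_infl n a : (0 < n)%N ->
  psderiv (infl n a) = infl n (psderiv a) * (psX ^+ n.-1 *+ n).
Proof.
by move=> n0; rewrite /infl psderiv_scomp psv_id ?psderiv_Xn // psXn eq_sym gtn_eqF.
Qed.

End Derivation.

Lemma isord_psderiv (K : numFieldType) (a : ps K) m : isord m.+1 a -> isord m (psderiv a).
Proof.
move=> [h1 h2]; split=> [i hi|]; rewrite /psderiv; first by rewrite h1 // mul0rn.
by rewrite mulrn_eq0.
Qed.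

Section DerivedPolynomial.
Variable K : numFieldType.
Local Notation A := (cps K).

Lemma convergent_psderiv (a : A) : convergent (psderiv (cval a)).
Proof.
have [M [r [M0 [r0 h]]]] := cvalP a; exists (M * r), (2 * r).
rewrite !mulr_gt0 //; split=> //; split=> // k.
have -> : M * r * (2 * r) ^+ k = M * r ^+ k.+1 * 2 ^+ k by rewrite exprMn exprS; ring.
rewrite /psderiv normrMn -[leLHS]mulr_natr; apply: ler_pM => //.
by rewrite -natrX ler_nat ltn_expl.
Qed.

Definition derivA (a : A) : A := mkcps (convergent_psderiv a).
Lemma derivA_additive : zmod_morphism derivA.
Proof. by move=> a b; apply: cval_inj; rewrite /= raddfB. Qed.
HB.instance Definition _ := GRing.isZmodMorphism.Build A A derivA derivA_additive.

Definition derpoly (p : {poly A}) : {poly A} := map_poly derivA p.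

Lemma derpoly_coef p i : (derpoly p)`_i = derivA p`_i.
Proof. by rewrite coef_map. Qed.

Lemma derpolyMX_C p c : derpoly (p * 'X + c%:P) = derpoly p * 'X + (derivA c)%:P.
Proof.
apply/polyP => i; rewrite derpoly_coef !(coefD, coefMX, coefC) derpoly_coef.
by case: i => [|i] /=; rewrite ?add0r ?addr0.
Qed.

Variable L : nat.
Hypothesis L_gt0 : (0 < L)%N.
Local Notation theta := (infl L \o @cval K).

(** The chain rule for s |-> p(s^L, b(s)); [derpoly] is the partial derivative in x, and the formal
    derivative of p the one in y. *)
Lemma psderiv_horner (p : {poly A}) (b : ps K) :
  psderiv (map_poly theta p).[b] = (map_poly theta (derpoly p)).[b] * (psX ^+ L.-1 *+ L) +
    (map_poly theta p)^`().[b] * psderiv b.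
Proof.
elim/poly_ind: p => [|p c IH].
  by rewrite /derpoly !map_poly0 deriv0 !horner0 (raddf0 (@psderiv K)) !mul0r addr0.
rewrite derpolyMX_C !rmorphD !rmorphM /= !map_polyX !map_polyC derivD derivM derivX derivC !hornerE.
rewrite psderivD psderivM IH psderiv_infl //=; ring.
Qed.

End DerivedPolynomial.

Lemma isord_sign (R : idomainType) (a : ps R) m k : isord m a -> isord m ((-1) ^+ k * a).
Proof.
move=> h; elim: k => [|k IH]; first by rewrite expr0 mul1r.
by rewrite exprS mulN1r mulNr -isordN opprK.
Qed.

Section Milnor.
Variables (K : numClosedFieldType) (n : nat) (e : K) (F : cps K).
Hypotheses (n_gt0 : (0 < n)%N) (prim_e : n.-primitive_root e) (F0 : cval F 0%N = 0).
Variable o : nat -> nat.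
Hypothesis ho : forall d, (0 < d < n)%N -> isord (o d) (conjps e F d - cval F).
Local Notation A := (cps K).
Local Notation O := (cps2 K).
Local Notation Fc := (conjps e F).
Local Notation P := (image_poly n e F).

Let n0 : n%:R != 0 :> K. Proof. by rewrite pnatr_eq0 -lt0n. Qed.
Let dP : distinguished n P. Proof. exact: image_poly_distinguished. Qed.

Definition polar_poly : {poly A} := cpsC (n%:R^-1) *: P^`().
Local Notation q := polar_poly.
Local Notation h := (derpoly P).

Lemma polar_coef k : q`_k = cpsC (k.+1%:R / n%:R) * P`_k.+1.
Proof.
have -> : k.+1%:R / n%:R = n%:R^-1 *+ k.+1 :> K by rewrite mulr_natl.
by rewrite coefZ coef_deriv (raddfMn (@cpsC K)) mulrnAl mulrnAr.
Qed.

Lemma deriv_image_poly : P^`() = cpsC n%:R *: q.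
Proof. by rewrite scalerA -rmorphM mulfV // rmorph1 scale1r. Qed.

Lemma polar_distinguished : distinguished n.-1 q.
Proof.
have [mP sP P0] := dP.
have Pn : P`_n = 1 by move: mP; rewrite monicE lead_coefE sP => /eqP.
have qn : q`_n.-1 = 1 by rewrite polar_coef prednK // mulfV // rmorph1 Pn mulr1.
have sq : size q = n.-1.+1.
  apply/eqP; rewrite eqn_leq; apply/andP; split.
    by rewrite prednK // (leq_trans (size_scale_leq _ _)) // -ltnS -sP lt_size_deriv // monic_neq0.
  rewrite ltnNge; apply/negP => /leq_sizeP/(_ _ (leqnn _)).
  by rewrite qn => /eqP; rewrite oner_eq0.
split=> //; first by rewrite monicE lead_coefE sq qn.
move=> j hj; rewrite polar_coef cval_cpsCM P0 ?mulr0 //.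
by rewrite -(prednK n_gt0) ltnS.
Qed.

Section Roots.
Variables (m : nat) (s : seq (ps K)).
Hypothesis m_gt0 : (0 < m)%N.
Local Notation L := (m * n)%N.
Local Notation theta := (infl L \o @cval K).
Hypothesis hs : map_poly theta q = \prod_(b <- s) ('X - b%:P).

Let L_gt0 : (0 < L)%N. Proof. by rewrite muln_gt0 m_gt0. Qed.
Local Notation G l := (infl m (Fc l)).
Local Notation PL := (map_poly theta P).

Lemma image_poly_inflated : PL = \prod_(l < n) ('X - (G l)%:P).
Proof.
rewrite (eq_map_poly (g := infl m \o (infl n \o @cval K))) => [|x]; last by rewrite /= infl_infl.
rewrite map_poly_comp image_polyE // /conjpoly rmorph_prod /=; apply: eq_bigr => l _.
by rewrite rmorphB /= map_polyX map_polyC.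
Qed.

Lemma coef_at0_theta (p : {poly A}) N : distinguished N p ->
  map_poly (@coef_at0 K) (map_poly theta p) = 'X^N.
Proof.
move=> [mp sp p0]; apply/polyP => j; rewrite !coef_map coefXn /= -[coef_at0 _]/(infl L _ 0%N).
rewrite /infl scomp_0; case: ltngtP => hj; first by rewrite p0.
  by rewrite nth_default ?sp.
by move: mp; rewrite hj monicE lead_coefE sp /= => /eqP ->.
Qed.

Lemma polar_root_cst b : b \in s -> (0 < n.-1)%N /\ b 0%N = 0.
Proof.
move=> bs; have rb : (map_poly theta q).[b] = 0.
  by rewrite hs; apply/rootP; rewrite root_prod_XsubC.
have n1 : (0 < n.-1)%N.
  have : size (map_poly theta q) = (size s).+1 by rewrite hs size_prod_XsubC.
  have [mq sq _] := polar_distinguished.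
  rewrite size_map_poly_id0 ?(monicP mq) ?rmorph1 ?oner_eq0 // sq => -[->].
  by case: (s) bs.
split=> //; have := congr1 (@coef_at0 K) rb; rewrite -horner_map /= (coef_at0_theta polar_distinguished).
by rewrite hornerXn => /eqP; rewrite -[coef_at0 0]/(0 : K) expf_eq0 n1 => /eqP.
Qed.

Let w i j := o (maxn i j - minn i j)%N.
Let wC i j : w i j = w j i. Proof. by rewrite /w maxnC minnC. Qed.

Lemma isord_G i j : (i < n)%N -> (j < n)%N -> i != j -> isord (m * w i j) (G i - G j).
Proof.
have W i' j' : (i' < j' < n)%N -> isord (m * w j' i') (G j' - G i').
  move=> ij; rewrite -rmorphB; apply: isord_infl => //.
  have /andP[lt_ij _] := ij; rewrite /w (maxn_idPl (ltnW lt_ij)) (minn_idPr (ltnW lt_ij)).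
  exact: isord_conj_diff ij ho.
move=> hi hj; rewrite neq_ltn => /orP[lt_ij|lt_ij]; last by apply: W; rewrite lt_ij.
by rewrite wC -isordN opprB; apply: W; rewrite lt_ij.
Qed.

(** By the product rule, the y-derivative of the product of the y - G_i at G_l is the product of the
    G_l - G_i over i different from l. *)
Lemma polar_at_branch (l : 'I_n) :
  isord (\sum_(i < n | i != l) m * w l i) (map_poly theta q).[G l].
Proof.
have -> : map_poly theta q = psC (n%:R^-1) *: PL^`().
  rewrite /q map_polyZ deriv_map; congr (_ *: _); rewrite /= /infl scompC //.
rewrite hornerZ image_poly_inflated [\prod_(_ < n) _](bigD1 l) //= derivM derivXsubC !hornerE subrr mul0r addr0 horner_prod.
rewrite -[X in isord X _]add0n; apply: isordM; first by apply/isord0; rewrite /= invr_eq0.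
apply: isord_prod => i il; rewrite !hornerE; apply: isord_G => //.
by rewrite eq_sym.
Qed.

(** Symmetry of the resultant: the product of g over the roots of the polar polynomial is, up to
    sign, the product of the polar polynomial over the branches, whose orders are known. *)
Lemma polar_product :
  isord (m * (n * \sum_(1 <= d < n) o d)) (\prod_(b <- s) PL.[b]).
Proof.
have -> : \prod_(b <- s) PL.[b] = \prod_(l < n) ((-1) ^+ size s * (map_poly theta q).[G l]).
  under eq_bigr do rewrite image_poly_inflated horner_prod.
  rewrite exchange_big /=; apply: eq_bigr => l _; rewrite hs horner_prod.
  elim: s => [|b r IH]; first by rewrite !big_nil expr0 mulr1.
  by rewrite !big_cons IH !hornerE /= exprS; ring.
have -> : (m * (n * \sum_(1 <= d < n) o d) = \sum_(l < n) \sum_(i < n | i != l) m * w l i)%N.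
  transitivity (m * \sum_(l < n) \sum_(i < n | i != l) w l i)%N; last first.
    by rewrite big_distrr /=; apply: eq_bigr => l _; rewrite big_distrr.
  congr muln; rewrite sum_offdiag //.
  rewrite -(triangular_sum_sym (G := o)); last by move=> d hd; exact: order_sym ho.
  congr muln; apply: eq_bigr => i _; apply: eq_bigr => j ij.
  by rewrite /w (maxn_idPr (ltnW ij)) (minn_idPl (ltnW ij)).
by apply: isord_prod => l _; apply: isord_sign; exact: polar_at_branch.
Qed.

(** At a root b of g_y the chain rule leaves only L s^(L-1) g_x(s^L, b), so the order of g at b is L
    more than that of g_x. Summing over the n - 1 roots and comparing with [polar_product], where L
    times the sum of the o d is L (2D + n - 1), gives 2 D L. *)
Lemma polar_derivative_product D : (2 * D + n.-1 = \sum_(1 <= d < n) o d)%N -> size s = n.-1 ->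
  isord (L * (2 * D)) (\prod_(b <- s) (map_poly theta h).[b]).
Proof.
move=> eD ss.
have [k hk] : exists k : ps K -> nat, forall b, b \in s -> isord (k b) (map_poly theta h).[b] /\
    isord (L + k b) PL.[b].
  suff /choice [k hk] : forall b, exists k, b \in s -> isord k (map_poly theta h).[b] /\ isord (L + k) PL.[b].
    by exists k.
  move=> b; have [bs|] := boolP (b \in s); last by exists 0%N.
  have [n1 b0] := polar_root_cst bs.
  have g0 : PL.[b] != 0.
    have := isord_neq0 polar_product; apply: contra => /eqP z.
    by rewrite (big_rem b) //= z mul0r.
  have [[|g] hg] := isord_exists g0.
    have := hg.2; have := congr1 (fun p : {poly K} => p.[b 0%N]) (coef_at0_theta dP).
    rewrite -[b 0%N]/(coef_at0 b) horner_map /= -[coef_at0 _]/(PL.[b] 0%N) => ->.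
    by rewrite -[coef_at0 b]/(b 0%N) b0 hornerXn expr0n gtn_eqF // eqxx.
  have rb : PL^`().[b] = 0.
    rewrite deriv_map /= deriv_image_poly map_polyZ hornerZ hs.
    by rewrite (rootP (_ : root _ b)) ?mulr0 // root_prod_XsubC.
  have := isord_psderiv hg; rewrite psderiv_horner // rb mul0r addr0 => hd.
  have hX : isord L.-1 (psX ^+ L.-1 *+ L : ps K).
    rewrite -mulr_natr -[X in isord X _]addn0; apply: isordM; first exact: isord_Xn.
    by apply/isord0; rewrite -(rmorph_nat (@psC K)) /= pnatr_eq0 -lt0n.
  have h0 : (map_poly theta h).[b] != 0.
    by apply/eqP => z; have := isord_neq0 hd; rewrite z mul0r eqxx.
  have [k hk] := isord_exists h0; exists k => _; split=> //.
  have := isord_uniq (isordM hk hX) hd => e1.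
  by rewrite (_ : L + k = g.+1)%N // -e1 -(prednK L_gt0) addSn addnC.
have E1 : isord (\sum_(b <- s) k b) (\prod_(b <- s) (map_poly theta h).[b]).
  by rewrite !big_seq; apply: isord_prod => b bs; have [] := hk b bs.
have E2 : isord (\sum_(b <- s) (L + k b)) (\prod_(b <- s) PL.[b]).
  by rewrite !big_seq; apply: isord_prod => b bs; have [] := hk b bs.
have := isord_uniq E2 polar_product; rewrite big_split /= big_const_seq count_predT iter_addn_0 ss -eD.
move=> e1; suff -> : (L * (2 * D) = \sum_(b <- s) k b)%N by [].
apply: (@addnI (L * n.-1)); rewrite e1; ring.
Qed.

End Roots.

(** After x -> s^(mn) the polar polynomial splits, and [det_mult_mod] evaluates the inflated
    determinant as a product over its roots. Inflation multiplies orders by mn, which cancels. *)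
Lemma isord_det_polar D : (2 * D + n.-1 = \sum_(1 <= d < n) o d)%N ->
  isord (2 * D) (cval (\det (mult_mx h polar_distinguished))).
Proof.
move=> eD; have [mq sq _] := polar_distinguished.
pose q1 := map_poly (infl n \o @cval K) q.
have mq1 : q1 \is monic by exact: monic_map.
have sq1 : size q1 = n.-1.+1 by rewrite size_map_poly_id0 // (monicP mq) rmorph1 oner_eq0.
have [m [s [m0 hs1]]] := puiseux mq1 sq1.
have hs : map_poly (infl (m * n) \o @cval K) q = \prod_(b <- s) ('X - b%:P).
  rewrite -hs1 (eq_map_poly (g := infl m \o (infl n \o @cval K))) => [|x]; last by rewrite /= infl_infl.
  by rewrite map_poly_comp.
have ss : size s = n.-1.
  have : size (map_poly (infl (m * n) \o @cval K) q) = (size s).+1 by rewrite hs size_prod_XsubC.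
  by rewrite size_map_poly_id0 ?(monicP mq) ?rmorph1 ?oner_eq0 // sq => -[].
have hprod := polar_derivative_product m0 hs eD ss.
have L0 : (0 < m * n)%N by rewrite muln_gt0 m0.
have eM : (infl (m * n) \o @cval K) (\det (mult_mx h polar_distinguished)) = \prod_(b <- s) (map_poly (infl (m * n) \o @cval K) h).[b].
  rewrite -det_map_mx; move: (mult_mx h polar_distinguished) (mult_mx_mod h polar_distinguished).
  (* Elimination of [ss] makes the size of the matrix literally the length of the list of roots. *)
  have {hprod sq1 hs1 sq} := hs; case: _ / ss => hs' M hM.
  apply: det_mult_mod => i; have [w hw] := hM i; exists (map_poly (infl (m * n) \o @cval K) w).
  rewrite -hs' -rmorphM /=.
  have -> : rVpoly (row i (map_mx (infl (m * n) \o @cval K) M)) = map_poly (infl (m * n) \o @cval K) (rVpoly (row i M)).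
    apply/polyP => k; rewrite coef_map !coef_rVpoly; case: insubP => [l _ _|_]; first by rewrite !mxE.
    exact/esym/(rmorph0 (infl (m * n) \o @cval K)).
  by rewrite -rmorphD -hw rmorphM /= map_polyXn.
have [D' hD'] : exists D', isord D' (cval (\det (mult_mx h polar_distinguished))).
  apply: isord_exists; apply/eqP => z; have := isord_neq0 hprod.
  by rewrite -eM /= z rmorph0 eqxx.
have := isord_uniq (isord_infl L0 hD') (_ : isord (m * n * (2 * D)) ((infl (m * n) \o @cval K) (\det _))).
rewrite eM => /(_ hprod)/eqP; rewrite eqn_pmul2l // => /eqP <-.
exact: hD'.
Qed.

Theorem milnor_normal D : (2 * D + n.-1 = \sum_(1 <= d < n) o d)%N ->
  has_codim (@cps2_scale K) (fun g : O => exists u v, g = u * emb (derpoly P) + v * emb P^`()) (2 * D).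
Proof.
move=> /isord_det_polar /ideal2_codim.
apply: (has_codim_transfer (T := id)) => // [w|g]; first by exists w.
rewrite deriv_image_poly embZ; split=> [[u [v ->]]|[u [v ->]]]; exists u.
  by exists (v * cps2X (cpsC n%:R)); rewrite mulrA.
exists (v * cps2X (cpsC n%:R^-1)); rewrite mulrA -[v * _ * _]mulrA -!rmorphM mulVf //.
by rewrite !rmorph1 mulr1.
Qed.

End Milnor.

(** * Translation to coefficient functions *)

Section Translation.
Variable K : numClosedFieldType.
Local Notation A := (cps K).
Local Notation O := (cps2 K).

Lemma comp2_expand (f1 f2 : ps K) (g : ps (ps K)) n : f1 0%N = 0 -> f2 0%N = 0 ->
  comp2 f1 f2 g n = \sum_(p < n.+1) \sum_(q < n.+1) g p q * (f1 ^+ p * f2 ^+ q) n.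
Proof.
move=> z1 z2; rewrite /comp2 /= (@subst_sum _ _ _ n n) // psv_id //; apply: eq_bigr => p _.
have E : forall i, (i < n.+1)%N -> psmap (scomp f2) g p i = (\sum_(q < n.+1) psC (g p q) * f2 ^+ q) i.
  move=> i hi; rewrite ps_sum /psmap -[LHS]/(scomp f2 (g p) i) /scomp /= (@subst_sum _ _ _ i n) //.
  by rewrite psv_id.
rewrite (@psM_agree _ n.+1 _ _ _ (f1 ^+ p) E) // mulr_suml ps_sum; apply: eq_bigr => q _.
by rewrite -mulrA psCM mulrC [f2 ^+ q * _]mulrC mulrC.
Qed.

Lemma codim_le_translation (S : ps K -> Prop) n : (forall s, S s -> convergent s) ->
  codim_le (@cps_scale K) (fun a : A => S (cval a)) n <->
  (exists v : 'I_n -> ps K, (forall i, convergent (v i)) /\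
    forall h, convergent h -> exists lam : 'I_n -> K, exists s, S s /\
      h = (fun m => \sum_(i < n) lam i * v i m + s m)).
Proof.
move=> hS.
have E (v : 'I_n -> A) lam (s : A) :
    cval (\sum_(i < n) cps_scale (lam i) (v i) + s) = (fun m => \sum_(i < n) lam i * cval (v i) m + cval s m).
  apply/funext => m; rewrite (rmorphD (@cval K)) psD (rmorph_sum (@cval K)) ps_sum; congr (_ + _).
  by apply: eq_bigr => i _; rewrite -[LHS]/(cval (cpsC (lam i) * v i) m) cval_cpsCM.
split=> [[v hv]|[v [cv hv]]].
  exists (fun i => cval (v i)); split=> [i|h ch]; first exact: cvalP.
  by have [lam [s [Ss e]]] := hv (mkcps ch); exists lam, (cval s); split=> //; rewrite -E -e.
exists (fun i => mkcps (cv i)) => h; have [lam [s [Ss e]]] := hv (cval h) (cvalP h).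
exists lam, (mkcps (hS s Ss)); split=> //; apply: cval_inj.
by rewrite [RHS](E (fun i => mkcps (cv i))) e.
Qed.

Lemma codim2_le_translation (S : ps (ps K) -> Prop) n : (forall s, S s -> convergent2 s) ->
  codim_le (@cps2_scale K) (fun g : O => S (cval2 g)) n <->
  (exists v : 'I_n -> ps (ps K), (forall i, convergent2 (v i)) /\
    forall h, convergent2 h -> exists lam : 'I_n -> K, exists s, S s /\
      h = (fun a b => \sum_(i < n) lam i * v i a b + s a b)).
Proof.
move=> hS.
have E (v : 'I_n -> O) lam (s : O) :
    cval2 (\sum_(i < n) cps2_scale (lam i) (v i) + s) =
    (fun a b => \sum_(i < n) lam i * cval2 (v i) a b + cval2 s a b).
  apply/funext => a; apply/funext => b; rewrite (rmorphD (@cval2 K)) !psD.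
  rewrite (rmorph_sum (@cval2 K)) !ps_sum; congr (_ + _); apply: eq_bigr => i _.
  rewrite -[LHS]/((cval2 (cps2X (cpsC (lam i))) * cval2 (v i)) a b).
  have -> : cval2 (cps2X (cpsC (lam i))) = psC (psC (lam i)) by rewrite /= psmapC.
  by rewrite !psCM.
split=> [[v hv]|[v [cv hv]]].
  exists (fun i => cval2 (v i)); split=> [i|h ch]; first exact: cval2P.
  by have [lam [s [Ss e]]] := hv (mkcps2 ch); exists lam, (cval2 s); split=> //; rewrite -E -e.
exists (fun i => mkcps2 (cv i)) => h; have [lam [s [Ss e]]] := hv (cval2 h) (cval2P h).
exists lam, (mkcps2 (hS s Ss)); split=> //; apply: cval2_inj.
by rewrite [RHS](E (fun i => mkcps2 (cv i))) e.
Qed.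

Lemma dx_emb (p : {poly A}) :
  (fun i j => i.+1%:R * cval2 (emb p) i.+1 j) = cval2 (emb (derpoly p)) :> ps (ps K).
Proof.
apply/funext => i; apply/funext => j; rewrite !emb_coef derpoly_coef.
by rewrite -[RHS]/(psderiv (cval p`_j) i) /psderiv mulr_natl.
Qed.

Lemma dy_emb (p : {poly A}) :
  (fun i j => j.+1%:R * cval2 (emb p) i j.+1) = cval2 (emb p^`()) :> ps (ps K).
Proof.
apply/funext => i; apply/funext => j; rewrite !emb_coef coef_deriv mulr_natl.
have E (a : A) k : cval (a *+ k) i = cval a i *+ k.
  by elim: k => [|k IH] //; rewrite !mulrS -IH.
by rewrite E.
Qed.

Lemma mul2_coef (g h : ps (ps K)) i j :
  (g * h) i j = \sum_(a < i.+1) \sum_(b < j.+1) g a b * h (i - a)%N (j - b)%N.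
Proof. by rewrite psM ps_sum. Qed.

End Translation.

Section ImageEquation.
Variables (K : numClosedFieldType) (B1 B2 : pred nat) (d1 d2 : nat).
Hypotheses (hd1 : B1 d1) (hmin1 : forall b, B1 b -> (d1 <= b)%N) (hpos1 : (0 < d1)%N).
Hypotheses (hd2 : B2 d2) (hmin2 : forall b, B2 b -> (d2 <= b)%N) (hpos2 : (0 < d2)%N).
Hypothesis hgcd : forall k, (forall b, B1 b || B2 b -> (k %| b)%N) -> k = 1%N.
Variable N : nat.
Hypothesis hN : forall r, (N <= r)%N -> jr B1 B2 d1 d2 r = 1%N.
Local Notation A := (cps K).
Local Notation O := (cps2 K).

Lemma milnor_nondegenerate (f1 f2 : ps K) : convergent f1 -> convergent f2 ->
  supp B1 f1 -> supp B2 f2 -> f1 d1 != 0 -> f2 d2 != 0 -> nondegenerate B1 B2 d1 d2 f1 f2 ->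
  exists P : {poly A}, [/\ comp2 f1 f2 (cval2 (emb P)) = 0,
    forall h : O, comp2 f1 f2 (cval2 h) = 0 -> exists w, h = w * emb P
    & has_codim (@cps2_scale K) (fun g : O => exists u v, g = u * emb (derpoly P) + v * emb P^`())
        (twice_delta B1 B2 d1 d2 N)].
Proof.
move=> c1 c2 s1 s2 n1 n2 nd.
have [phi [psi [F nf]]] := exists_normal_form hmin1 hpos1 hmin2 hpos2 c1 c2 s1 s2 n1 n2.
have [e prim_e] := exists_prim_root K hpos1.
have [ek hek] := exists_contact hmin1 hmin2 hgcd.
have ho d : (0 < d < d1)%N -> isord (d2 + ek (kj d1 d)) (conjps e F d - cval F).
  move=> hd; split; first exact: (conj_diff_ordge hpos1 prim_e hek (nf_ord nf) (nf_pure nf) hd).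
  rewrite (conj_diff_lead hpos1 prim_e F hek hd).
  have := hek _ (kj_gt1 hpos1 hd) (kj_dvd_n hpos1 d); case: ifP => kd2 hk.
    by rewrite (nf_coef nf hk); apply: (nd _ (kj_gt1 hpos1 hd) (kj_dvd_n hpos1 d) kd2 _ hk).
  by rewrite hk addn0 (nf_ord nf).2.
have F0 : cval F 0%N = 0 by rewrite (nf_ord nf).1.
have pull g : comp2 f1 f2 g = 0 <-> comp2 (psX ^+ d1) (cval F) g = 0.
  rewrite -(nf_fst nf) -(nf_snd nf) -scomp_comp2; split=> [->|h]; first by rewrite rmorph0.
  have := congr1 (scomp psi) h; rewrite scompA (nf_inv nf).1 scomp_id rmorph0.
  by [].
exists (image_poly d1 e F); split.
- by apply/pull; rewrite comp2_emb // -(conjps0 e F) image_poly_root.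
- move=> h /pull hh; have [|w ->] := image_poly_kernel hpos1 prim_e F0 _ hh; last by exists w; rewrite mulrC.
  by move=> d hd e1; have := isord_neq0 (ho d hd); rewrite e1 subrr eqxx.
have := sum_orders hd1 hpos1 hd2 hpos2 hN hek.
have [D _ <-] := delta_nondegenerate hd1 hmin1 hpos1 hd2 hmin2 hpos2 hgcd prim_e hN nf nd.
by move=> /esym; exact: milnor_normal.
Qed.

End ImageEquation.

(** * The delta-invariant and the Milnor number over the complex numbers *)

Lemma pow1E (a : series1) m : pow1 a m = (a : ps C) ^+ m.
Proof. by elim: m => [|m IH]; rewrite ?expr0 // exprS -IH. Qed.

Lemma compE (g : series2) (f1 f2 : series1) : f1 0%N = 0 -> f2 0%N = 0 ->
  Defs.comp g f1 f2 = comp2 (f1 : ps C) (f2 : ps C) (g : ps (ps C)).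
Proof.
move=> z1 z2; apply/funext => n; rewrite comp2_expand //.
by apply: eq_bigr => p _; apply: eq_bigr => q _; rewrite !pow1E.
Qed.

Lemma codim1_leE (f1 f2 : series1) n : conv1 f1 -> conv1 f2 -> f1 0%N = 0 -> f2 0%N = 0 ->
  codim1_le (pullback f1 f2) n <-> codim_le (@cps_scale C) (pullbackA (f1 : ps C) f2) n.
Proof.
move=> c1 c2 z1 z2.
have hS (s : ps C) : pullback f1 f2 s -> convergent s.
  by move=> [g [cg ->]]; rewrite compE //; exact: convergent_comp2.
have E : pullbackA (f1 : ps C) f2 = fun a => pullback f1 f2 (cval a).
  apply/funext => a; apply/propext; split=> [[g ha]|[g [cg ha]]].
    by exists (cval2 g); split; [exact: cval2P|rewrite compE].
  by exists (mkcps2 (cg : convergent2 (g : ps (ps C)))); rewrite ha compE.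
rewrite E; apply: iff_sym; exact: (codim_le_translation n hS).
Qed.

Lemma codim2_leE (P : {poly cps C}) n :
  codim2_le (jacobian_ideal (cval2 (emb P))) n <->
  codim_le (@cps2_scale C) (fun g : cps2 C => exists u v, g = u * emb (derpoly P) + v * emb P^`()) n.
Proof.
pose S : ps (ps C) -> Prop := jacobian_ideal (cval2 (emb P)).
have SE (u v : ps (ps C)) : (fun i j => mul2 u (dx (cval2 (emb P))) i j + mul2 v (dy (cval2 (emb P))) i j) =
    u * cval2 (emb (derpoly P)) + v * cval2 (emb P^`()) :> ps (ps C).
  apply/funext => i; apply/funext => j; rewrite !psD !mul2_coef -dx_emb -dy_emb.
  by [].
have hS (s : ps (ps C)) : S s -> convergent2 s.
  move=> [u [v [cu [cv ->]]]]; rewrite SE.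
  by apply: convergent2D; apply: convergent2M => //; exact: cval2P.
have E : (fun g : cps2 C => exists u v, g = u * emb (derpoly P) + v * emb P^`()) = fun g => S (cval2 g).
  apply/funext => g; apply/propext; split=> [[u [v ->]]|[u [v [cu [cv e]]]]].
    by exists (cval2 u), (cval2 v); split; [exact: cval2P|split; [exact: cval2P|rewrite SE]].
  exists (mkcps2 (cu : convergent2 (u : ps (ps C)))), (mkcps2 (cv : convergent2 (v : ps (ps C)))).
  by apply: cval2_inj; rewrite [LHS]e SE.
rewrite E; apply: iff_sym; exact: (codim2_le_translation n hS).
Qed.

Section ComplexGerms.
Variables (B1 B2 : pred nat) (d1 d2 : nat).
Hypotheses (hd1 : B1 d1) (hmin1 : forall b, B1 b -> (d1 <= b)%N) (hpos1 : (0 < d1)%N).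
Hypotheses (hd2 : B2 d2) (hmin2 : forall b, B2 b -> (d2 <= b)%N) (hpos2 : (0 < d2)%N).
Hypothesis hgcd : forall k, (forall b, B1 b || B2 b -> (k %| b)%N) -> k = 1%N.
Variable N : nat.
Hypothesis hN : forall r, (N <= r)%N -> jr B1 B2 d1 d2 r = 1%N.
Local Notation dB := (deltaB B1 B2 d1 d2 N).

Lemma in_CB_0 (B : pred nat) d f : (forall b, B b -> (d <= b)%N) -> (0 < d)%N -> in_CB B f -> f 0%N = 0.
Proof. by move=> hmin d0 [_ s]; apply: s; apply/negP => /hmin; rewrite leqNgt d0. Qed.

Lemma deltaB_nat D : (2 * D = twice_delta B1 B2 d1 d2 N)%N -> D%:R = dB.
Proof.
move=> e; have := twice_deltaB hd1 hpos1 hd2 N.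
rewrite -e natrM => /mulfI -> //.
Qed.

Lemma delta_nondeg f1 f2 : in_CB B1 f1 -> in_CB B2 f2 -> nondeg0 B1 B2 d1 d2 f1 f2 ->
  exists2 n, (2 * n = twice_delta B1 B2 d1 d2 N)%N & delta_is f1 f2 n.
Proof.
move=> i1 i2 [n1 [n2 nd]]; have [c1 s1] := i1; have [c2 s2] := i2.
have z1 := in_CB_0 hmin1 hpos1 i1; have z2 := in_CB_0 hmin2 hpos2 i2.
have [phi [psi [F nf]]] := @exists_normal_form C B1 B2 d1 d2 hmin1 hpos1 hmin2 hpos2 f1 f2 c1 c2 s1 s2 n1 n2.
have [e prim_e] := exists_prim_root C hpos1.
have [D hD eD] := delta_nondegenerate hd1 hmin1 hpos1 hd2 hmin2 hpos2 hgcd prim_e hN nf nd.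
exists D => //; split; first by apply/codim1_leE => //; exact: has_codim_le.
move=> m mD /(codim1_leE _ c1 c2 z1 z2) h; have := codim_le_ge h (has_codim_ge hD).
by rewrite leqNgt mD.
Qed.

Lemma delta_deg f1 f2 : in_CB B1 f1 -> in_CB B2 f2 -> f1 d1 != 0 -> f2 d2 != 0 ->
  ~ nondeg0 B1 B2 d1 d2 f1 f2 -> forall n : nat, n%:R <= dB -> ~ codim1_le (pullback f1 f2) n.
Proof.
move=> i1 i2 n1 n2 nd; have [c1 s1] := i1; have [c2 s2] := i2.
have z1 := in_CB_0 hmin1 hpos1 i1; have z2 := in_CB_0 hmin2 hpos2 i2.
have [phi [psi [F nf]]] := @exists_normal_form C B1 B2 d1 d2 hmin1 hpos1 hmin2 hpos2 f1 f2 c1 c2 s1 s2 n1 n2.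
have [e prim_e] := exists_prim_root C hpos1.
have nd' : ~ nondegenerate B1 B2 d1 d2 (f1 : ps C) f2 by move=> h; apply: nd.
have [D hD eD] := delta_degenerate hd1 hmin1 hpos1 hd2 hmin2 hpos2 hgcd prim_e hN nf nd'.
move=> n hn /(codim1_leE _ c1 c2 z1 z2) h; have := codim_le_ge h hD => Dn.
have : (2 : rat) * n%:R <= 2 * dB by rewrite ler_pM2l.
rewrite (twice_deltaB hd1 hpos1 hd2 N) -natrM ler_nat => h2.
have := leq_trans eD (leq_trans (_ : (2 * D <= 2 * n)%N) h2); rewrite ltnn leq_mul2l Dn orbT => /(_ isT).
by [].
Qed.

Theorem delta_characterization f1 f2 : in_CB B1 f1 -> in_CB B2 f2 -> f1 d1 != 0 -> f2 d2 != 0 ->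
  ((exists n : nat, n%:R = dB /\ delta_is f1 f2 n) <-> nondeg0 B1 B2 d1 d2 f1 f2) /\
  (~ nondeg0 B1 B2 d1 d2 f1 f2 -> forall n : nat, n%:R <= dB -> ~ codim1_le (pullback f1 f2) n).
Proof.
move=> i1 i2 n1 n2; split; last exact: delta_deg.
split=> [[n [e [hn _]]]|nd].
  apply: contrapT => nd; apply: (delta_deg i1 i2 n1 n2 nd (n := n)) => //.
  by rewrite e.
by have [n en hn] := delta_nondeg i1 i2 nd; exists n; split=> //; exact: deltaB_nat.
Qed.

Theorem milnor_nondeg f1 f2 : in_CB B1 f1 -> in_CB B2 f2 -> nondeg0 B1 B2 d1 d2 f1 f2 ->
  exists n : nat, n%:R = dB /\ delta_is f1 f2 n /\ milnor_is f1 f2 (2 * n)%N.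
Proof.
move=> i1 i2 nd; have [n en hn] := delta_nondeg i1 i2 nd; exists n; split; first exact: deltaB_nat.
split=> //; have [n1 [n2 nd']] := nd; have [c1 s1] := i1; have [c2 s2] := i2.
have z1 := in_CB_0 hmin1 hpos1 i1; have z2 := in_CB_0 hmin2 hpos2 i2.
have [P [P0 Pk hP]] := @milnor_nondegenerate C B1 B2 d1 d2 hd1 hmin1 hpos1 hd2 hmin2 hpos2 hgcd N hN
  f1 f2 c1 c2 s1 s2 n1 n2 nd'.
exists (cval2 (emb P)); split.
  split; first exact: cval2P.
  split; first by rewrite compE // P0.
  move=> h ch; rewrite compE // => hh.
  have [w ew] := Pk (mkcps2 (ch : convergent2 (h : ps (ps C)))) hh.
  exists (cval2 w); split; first exact: cval2P.
  apply/funext => i; apply/funext => j; rewrite /mul2 -mul2_coef.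
  exact: (congr1 (fun g : cps2 C => cval2 g i j) ew).
rewrite en; split; first by apply/codim2_leE; exact: has_codim_le.
move=> m hm /codim2_leE h; have := codim_le_ge h (has_codim_ge hP).
by rewrite leqNgt hm.
Qed.

End ComplexGerms.

(** * Genericity of nondegeneracy *)

Import (canonicals) mpoly.

Section Generic.
Variables (B1 B2 : pred nat) (d1 d2 : nat).
Hypotheses (hd1 : B1 d1) (hmin1 : forall b, B1 b -> (d1 <= b)%N) (hpos1 : (0 < d1)%N).
Hypotheses (hd2 : B2 d2) (hmin2 : forall b, B2 b -> (d2 <= b)%N) (hpos2 : (0 < d2)%N).
Hypothesis hgcd : forall k, (forall b, B1 b || B2 b -> (k %| b)%N) -> k = 1%N.

Section Polynomial.
Variables (m : nat) (ek : nat -> nat).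
Local Notation M := m.+1.
Local Notation poly2 := (mpoly.mpoly (M + M) C).

Definition var1 i : poly2 := mpoly.mpolyX C (mpoly.mnm1 (lshift M (inord i : 'I_M))).
Definition var2 i : poly2 := mpoly.mpolyX C (mpoly.mnm1 (rshift M (inord i : 'I_M))).

Lemma meval_var1 f1 f2 i : (i < M)%N -> mpoly.meval (coefvec M f1 f2) (var1 i) = f1 i.
Proof.
move=> hi; rewrite mpoly.mevalXU /coefvec (_ : fintype.split _ = inl (inord i)) ?inordK //.
exact: (unsplitK (inl _)).
Qed.

Lemma meval_var2 f1 f2 i : (i < M)%N -> mpoly.meval (coefvec M f1 f2) (var2 i) = f2 i.
Proof.
move=> hi; rewrite mpoly.mevalXU /coefvec (_ : fintype.split _ = inr (inord i)) ?inordK //.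
exact: (unsplitK (inr _)).
Qed.

Definition divides_both k := [&& (1 < k)%N, (k %| d1)%N & (k %| d2)%N].

(** Besides the two leading coefficients, one factor for each common divisor k > 1: the two ratios
    at r_k = [ek k], compared after cross-multiplication. *)
Definition nondeg_poly : poly2 := var1 d1 * var2 d2 *
  \prod_(k < d1.+1 | divides_both k)
    (var1 (d1 + ek k) * (var2 d2 *+ d2) - var2 (d2 + ek k) * (var1 d1 *+ d1)).

Lemma meval_nondeg_poly f1 f2 : (d1 < M)%N -> (d2 < M)%N ->
  (forall k, (k < d1.+1)%N -> (d1 + ek k < M)%N && (d2 + ek k < M)%N) ->
  mpoly.meval (coefvec M f1 f2) nondeg_poly = f1 d1 * f2 d2 *
    \prod_(k < d1.+1 | divides_both k)
      (f1 (d1 + ek k)%N * (f2 d2 *+ d2) - f2 (d2 + ek k)%N * (f1 d1 *+ d1)).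
Proof.
move=> h1 h2 hk; rewrite /nondeg_poly !rmorphM /= meval_var1 // meval_var2 // rmorph_prod /=.
congr (_ * _); apply: eq_bigr => k _; have /andP [k1 k2] := hk k (ltn_ord k).
by rewrite rmorphB !rmorphM !rmorphMn /= !meval_var1 // !meval_var2.
Qed.

End Polynomial.

Lemma conv1_bounded (f : series1) : (forall n, `|f n| <= 1) -> conv1 f.
Proof. by move=> h; exists 1, 1; do 2!split=> //; move=> n; rewrite expr1n mulr1. Qed.

Theorem nondeg0_generic : generic B1 B2 (nondeg0 B1 B2 d1 d2).
Proof.
have [ek hek] := exists_contact hmin1 hmin2 hgcd.
pose m := (d1 + d2 + \sum_(k < d1.+1) ek k)%N.
have hk k : (k < d1.+1)%N -> (d1 + ek k < m.+1)%N && (d2 + ek k < m.+1)%N.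
  move=> hk; have le_s : (ek k <= \sum_(i < d1.+1) ek i)%N.
    by rewrite (bigD1 (Ordinal hk)) //= leq_addr.
  by rewrite !ltnS /m leq_add // ?leq_addr //= leq_add // leq_addl.
have l1 : (d1 < m.+1)%N by rewrite ltnS /m -addnA leq_addr.
have l2 : (d2 < m.+1)%N by rewrite ltnS /m addnAC leq_addl.
exists m.+1, (nondeg_poly m ek); split; last first.
  move=> f1 f2 i1 i2; rewrite meval_nondeg_poly // mulf_eq0 negb_or => /andP[].
  rewrite mulf_eq0 negb_or => /andP[n1 n2] hp; do 2!split=> //.
  move=> k k1 kd1 kd2 r hr; have := hek k k1 kd1; rewrite kd2 => hr'.
  have kl : (k < d1.+1)%N by rewrite ltnS dvdn_leq.
  have dk : divides_both k by rewrite /divides_both k1 kd1.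
  move: hp; rewrite (bigD1 (Ordinal kl)) //= mulf_eq0 negb_or => /andP[+ _].
  rewrite -(is_rk_uniq hr hr') subr_eq0.
  have m1 : d1%:R != 0 :> C by rewrite pnatr_eq0 -lt0n.
  have m2 : d2%:R != 0 :> C by rewrite pnatr_eq0 -lt0n.
  by rewrite eqr_div ?mulf_neq0 // !mulr_natr.
(* A nondegenerate pair with coefficients 0 and 1: g1 drops every shift s > 0 that also occurs in
   B2, so at each r_k exactly one of the two coefficients is nonzero and the ratios differ. *)
pose g1 : series1 := fun b => [&& B1 b, (b < m.+1)%N & (b == d1) || ~~ B2 (d2 + (b - d1))%N]%:R.
pose g2 : series1 := fun b => (B2 b && (b < m.+1)%N)%:R.
have g1d : g1 d1 = 1 by rewrite /g1 hd1 l1 eqxx.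
have g2d : g2 d2 = 1 by rewrite /g2 hd2 l2.
have b01 (b : bool) : `|b%:R : C| <= 1 by rewrite normr_nat lern1; case: b.
exists g1, g2; split; first by split=> [|b /negbTE hb]; [by apply: conv1_bounded => n; exact: b01|rewrite /g1 hb].
split; first by split=> [|b /negbTE hb]; [by apply: conv1_bounded => n; exact: b01|rewrite /g2 hb].
rewrite meval_nondeg_poly // g1d g2d mulf_neq0 ?mulf_neq0 ?oner_eq0 //.
apply/prodf_neq0 => k /and3P[k1 kd1 kd2]; have := hek k k1 kd1; rewrite kd2 => -[hin [kr _]].
have r0 : (0 < ek k)%N by rewrite lt0n; apply: contra kr => /eqP ->; rewrite dvdn0.
have /andP[k1' k2'] := hk k (ltn_ord k).
have ne : (d1 + ek k == d1)%N = false by rewrite -[X in (_ == X)%N]addn0 eqn_add2l gtn_eqF.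
rewrite /g1 /g2 k1' k2' ne addKn /=.
move: hin; case: (B2 _) => /= [_|]; last by rewrite orbF => ->; rewrite /= mul1r mul0r subr0 pnatr_eq0 -lt0n.
by rewrite andbF mul0r mul1r sub0r oppr_eq0 pnatr_eq0 -lt0n.
Qed.

End Generic.

(** * Evaluation of convergent series *)

Section Evaluation.
Local Open Scope classical_set_scope.
Variable K : numClosedFieldType.
(** Completeness and, below, the Archimedean property in the only form in which they enter: through
    geometric bounds. For the complex numbers they are [complex_complete] and
    [complex_archimedean]. *)
Hypothesis Kcomplete : forall (a : nat -> K) (A q : K), 0 <= A -> 0 <= q -> q < 1 ->
  (forall n, `|a n| <= A * q ^+ n) -> cvgn (fun N => \sum_(n < N) a n).
Hypothesis Karch : forall (x B q : K), 0 <= q -> q < 1 -> (forall n, `|x| <= B * q ^+ n) -> x = 0.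
Implicit Types (a b f : ps K) (s t z w : K).
Local Notation nm := (psnorm (@absnorm K)).

Definition ev a z : K := limn (fun N => \sum_(n < N) a n * z ^+ n).

Lemma psnorm_ge0 s a A : 0 < s -> nm s a A -> 0 <= A.
Proof. by move=> s0 hA; exact: (subnorm_ge0 (subnorm_abs2 s0) hA). Qed.

Lemma psnorm_term s a A z n : 0 < s -> nm s a A -> `|a n * z ^+ n| <= A * (`|z| / s) ^+ n.
Proof.
move=> s0 hA; rewrite normrM normrX expr_div_n [leRHS]mulrCA [leRHS]mulrC ler_wpM2r ?exprn_ge0 //.
exact: psnorm_coef hA.
Qed.

Lemma ratio_lt1 s z : 0 < s -> `|z| < s -> 0 <= `|z| / s < 1.
Proof. by move=> s0 zs; rewrite divr_ge0 ?(ltW s0) //= ltr_pdivrMr // mul1r. Qed.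

Lemma ev_cvg s a A z : 0 < s -> nm s a A -> `|z| < s ->
  (fun N => \sum_(n < N) a n * z ^+ n) @ \oo --> ev a z.
Proof.
move=> s0 hA zs; have /andP[q0 q1] := ratio_lt1 s0 zs.
have := Kcomplete (psnorm_ge0 s0 hA) q0 q1 (fun n => psnorm_term z n s0 hA).
by [].
Qed.

Lemma ev_eq (u : nat -> K) a z l : u @ \oo --> l -> (forall N, \sum_(n < N) a n * z ^+ n = u N) -> ev a z = l.
Proof.
move=> hu e; rewrite /ev (_ : (fun N => _) = u); last by apply/funext.
exact: cvg_lim hu.
Qed.

Lemma cvg_norm_le (u : nat -> K) l A : u @ \oo --> l -> (forall n, `|u n| <= A) -> `|l| <= A.
Proof.
move=> hu hA; apply/ler_addgt0Pr => e e0.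
have /cvgrPdist_lt/(_ e e0) [n _ /(_ n (leqnn n)) h] := hu.
rewrite -[l](subrK (u n)) (le_trans (ler_normD _ _)) // addrC lerD //; exact: ltW.
Qed.

Lemma ev_le s a A z : 0 < s -> nm s a A -> `|z| < s -> `|ev a z| <= A.
Proof.
move=> s0 hA zs; apply: cvg_norm_le (ev_cvg s0 hA zs) _ => n.
have [c [hc hcA]] := hA n; apply: le_trans hcA; apply: (le_trans (ler_norm_sum _ _ _)).
apply: ler_sum => i _; rewrite normrM normrX; apply: ler_pM; rewrite ?exprn_ge0 //; first exact: hc.
by rewrite lerXn2r ?nnegrE // ltW.
Qed.

Lemma psnorm_shift s a A : 0 < s -> nm s a A -> nm s (psshift a) (A / s).
Proof.
move=> s0 hA n; have [c [hc hcA]] := hA n.+1; exists (fun k => c k.+1); split=> [k hk|]; first exact: hc.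
rewrite ler_pdivlMr // mulr_suml; apply: le_trans hcA; rewrite big_ord_recl /=.
rewrite -[leLHS]add0r lerD //; first by rewrite mulr1 (le_trans _ (hc 0%N _)).
by apply: ler_sum => i _; rewrite -mulrA -exprSr.
Qed.

Lemma ev_shift s a A z : 0 < s -> nm s a A -> `|z| < s ->
  ev a z = a 0%N + z * ev (psshift a) z.
Proof.
move=> s0 hA zs; have h := ev_cvg s0 (psnorm_shift s0 hA) zs.
have hu : (fun N => a 0%N + z * \sum_(n < N) psshift a n * z ^+ n) @ \oo --> a 0%N + z * ev (psshift a) z.
  by apply: cvgD; [exact: cvg_cst|apply: cvgMr].
have e N : \sum_(n < N.+1) a n * z ^+ n = a 0%N + z * \sum_(n < N) psshift a n * z ^+ n.
  rewrite big_ord_recl expr0 mulr1 mulr_sumr; congr (_ + _); apply: eq_bigr => i _.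
  by rewrite /= /bump /= add1n exprS mulrCA.
have := ev_cvg s0 hA zs; rewrite -(cvg_shiftS _) => h'.
have : (fun N => a 0%N + z * \sum_(n < N) psshift a n * z ^+ n) @ \oo --> ev a z.
  by rewrite (_ : (fun N => _) = [sequence \sum_(n < N.+1) a n * z ^+ n]_N) //; apply/funext => N /=; rewrite e.
by move=> h''; exact: (cvg_unique _ h'' hu).
Qed.

Lemma evD s a b A B z : 0 < s -> nm s a A -> nm s b B -> `|z| < s -> ev (a + b) z = ev a z + ev b z.
Proof.
move=> s0 hA hB zs; apply: (ev_eq (cvgD (ev_cvg s0 hA zs) (ev_cvg s0 hB zs))) => N.
rewrite [RHS](_ : _ = \sum_(n < N) a n * z ^+ n + \sum_(n < N) b n * z ^+ n) // -big_split.
by apply: eq_bigr => i _; rewrite psD mulrDl.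
Qed.

Lemma evZ s a A c z : 0 < s -> nm s a A -> `|z| < s -> ev (psC c * a) z = c * ev a z.
Proof.
move=> s0 hA zs; apply: (@ev_eq (fun N => c * \sum_(n < N) a n * z ^+ n)).
  by apply: cvgMr; exact: ev_cvg zs.
by move=> N; rewrite mulr_sumr; apply: eq_bigr => i _; rewrite psCM mulrA.
Qed.

Lemma evC c z : ev (psC c) z = c.
Proof.
have e N : \sum_(n < N.+1) psC c n * z ^+ n = c.
  by rewrite big_ord_recl expr0 mulr1 big1 ?addr0 // => i _; rewrite mul0r.
apply: cvg_lim => //; rewrite -(cvg_shiftS _).
by rewrite (_ : [sequence _]_N = fun=> c) //; [exact: cvg_cst|apply/funext => N /=; exact: e].
Qed.

Lemma evX s a A z : 0 < s -> nm s a A -> `|z| < s -> ev (psX * a) z = z * ev a z.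
Proof.
move=> s0 hA zs.
have hX : nm s (psX * a) (s * A).
  apply: (subnorm_M (subnorm_abs2 s0)) => //; move=> n; exists (fun k => psX k); split=> [k _|].
    by rewrite /absnorm /psX normr_nat.
  case: n => [|[|n]]; rewrite ?big_ord0 ?big_ord_recl ?big_ord0 ?(ltW s0) //=.
    by rewrite mul0r add0r (ltW s0).
  by rewrite big1 /= ?addr0 ?mul0r ?add0r ?mul1r // => i _; rewrite mul0r.
rewrite (ev_shift s0 hX zs) psXM0 add0r; congr (_ * ev _ z).
by apply/funext => n; exact: psXMS.
Qed.

(* The same remainder argument proves all functional equations below: an expression D(a), bounded
   by the norm of a, with D(a) = w D(a') for a = a(0) + X a', vanishes when |w| < t. *)
Lemma remainder_zero (D : ps K -> K) t w B : 0 < t -> `|w| < t ->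
  (forall a A, nm t a A -> `|D a| <= B * A) ->
  (forall a A, nm t a A -> D a = w * D (psshift a)) ->
  forall a A, nm t a A -> D a = 0.
Proof.
move=> t0 wt hB hD a A hA; have /andP[q0 q1] := ratio_lt1 t0 wt.
apply: (@Karch _ (B * A) (`|w| / t)) => // n.
elim: n a A hA => [|n IH] a A hA; first by rewrite expr0 mulr1; exact: hB.
rewrite (hD a A hA) normrM (le_trans (ler_wpM2l (normr_ge0 w) (IH _ _ (psnorm_shift t0 hA)))) //.
by rewrite exprS le_eqVlt; apply/orP; left; apply/eqP; field; rewrite gt_eqF.
Qed.

Lemma evM s a b A B z : 0 < s -> nm s a A -> nm s b B -> `|z| < s -> ev (a * b) z = ev a z * ev b z.
Proof.
move=> s0 hA hB zs; apply/eqP; rewrite -subr_eq0; apply/eqP.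
have hs := subnorm_abs2 s0.
apply: (@remainder_zero (fun a => ev (a * b) z - ev a z * ev b z) s z (2 * B)) hA => // {}a {}A hA.
  rewrite (le_trans (ler_normB _ _)) // normrM -mulrA mulr_natl mulr2n lerD //.
    by rewrite mulrC; apply: ev_le zs => //; exact: (subnorm_M hs).
  by rewrite [leRHS]mulrC ler_pM //; exact: ev_le zs.
have hA' := psnorm_shift s0 hA; have hAB' := subnorm_M hs hA' hB.
have e : a * b = psC (a 0%N) * b + psX * (psshift a * b) by rewrite {1}(ps_shiftE a) mulrDl mulrA.
have h1 : nm s (psC (a 0%N) * b) (`|a 0%N| * B) by apply: (subnorm_M hs) => //; apply: psnorm_C => //; exact: lexx.
have h2 : nm s (psX * (psshift a * b)) (A * B + `|a 0%N| * B).
  have -> : psX * (psshift a * b) = a * b + - (psC (a 0%N) * b) by rewrite e addrC addKr.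
  by apply: (subnorm_D hs); [exact: (subnorm_M hs)|exact: (subnorm_N hs)].
rewrite e (evD s0 h1 h2 zs) (evZ _ s0 hB zs) (evX s0 hAB' zs) (ev_shift s0 hA zs); ring.
Qed.

Lemma psnorm_X s : 0 < s -> nm s psX s.
Proof.
move=> s0 n; exists (fun k => psX k); split=> [k _|]; first by rewrite /absnorm /psX normr_nat.
case: n => [|[|n]]; rewrite ?big_ord0 ?big_ord_recl ?big_ord0 ?(ltW s0) //=.
  by rewrite mul0r add0r (ltW s0).
by rewrite big1 /= ?addr0 ?mul0r ?add0r ?mul1r // => i _; rewrite mul0r.
Qed.

Lemma ev_psX z : ev psX z = z.
Proof.
have s0 : 0 < `|z| + 1 by rewrite ltr_wpDl.
have zs : `|z| < `|z| + 1 by rewrite ltrDl.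
have h1 : nm (`|z| + 1) 1 1 := subnorm_1 (subnorm_abs2 s0).
by rewrite -[psX]mulr1 (evX s0 h1 zs) -(rmorph1 (@psC K)) evC mulr1.
Qed.

Lemma ev_scomp s t f a A z : 0 < s -> 0 < t -> f 0%N = 0 -> nm s f t -> nm t a A -> `|z| < s ->
  `|ev f z| < t /\ ev (scomp f a) z = ev a (ev f z).
Proof.
move=> s0 t0 f0 hf hA zs; have hs := subnorm_abs2 s0.
have wt : `|ev f z| < t.
  rewrite (ev_shift s0 hf zs) f0 add0r normrM.
  apply: (le_lt_trans (ler_wpM2l (normr_ge0 z) (ev_le s0 (psnorm_shift s0 hf) zs))).
  by rewrite mulrCA gtr_pMr // ltr_pdivrMr // mul1r.
have hf' : nm s (psv f) t by rewrite psv_id.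
split=> //; apply/eqP; rewrite -subr_eq0; apply/eqP.
apply: (@remainder_zero (fun a => ev (scomp f a) z - ev a (ev f z)) t (ev f z) 2) hA => // {}a {}A hA.
  rewrite (le_trans (ler_normB _ _)) // mulr_natl mulr2n lerD //; last exact: ev_le wt.
  by apply: ev_le zs => //; exact: psnorm_scomp.
have hA' := psnorm_shift t0 hA; have hS := psnorm_scomp s0 hf' hA'.
have h1 : nm s (psC (a 0%N)) `|a 0%N| by apply: psnorm_C => //; exact: lexx.
rewrite {1}(ps_shiftE a) rmorphD rmorphM /= scompC scompX psv_id //.
by rewrite (evD s0 h1 (subnorm_M hs hf hS) zs) evC (evM s0 hf hS zs) (ev_shift t0 hA wt); ring.
Qed.

(** With a = a_0 + X a', the difference is (z - w) a'(z) + w (a'(z) - a'(w)). As a' has norm at most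
    A / s and |w| <= s / 2, a crude bound loses half of its error at each unfolding; the constant 2
    A / s solves c = A / s + c / 2. *)
Lemma ev_lipschitz s a A z w : 0 < s -> nm s a A -> 2 * `|z| <= s -> 2 * `|w| <= s ->
  `|ev a z - ev a w| <= 2 * A / s * `|z - w|.
Proof.
move=> s0 hA zs ws.
have lt_s (x : K) : 2 * `|x| <= s -> `|x| < s.
  move=> h; have [->|x0] := eqVneq x 0; first by rewrite normr0.
  apply: lt_le_trans h; rewrite ltr_pMl; [exact: ltr1n|by rewrite normr_gt0].
have zs' := lt_s z zs; have ws' := lt_s w ws.
have A0 := psnorm_ge0 s0 hA.
have H n : forall a A, nm s a A -> `|ev a z - ev a w| <= 2 * A / s * `|z - w| + 2 * A * 2^-1 ^+ n.
  elim: n {A0} => [|n IH] {}a {}A {}hA; have A0 := psnorm_ge0 s0 hA.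
    rewrite expr0 mulr1 -[leLHS]add0r lerD ?mulr_ge0 ?invr_ge0 ?(ltW s0) //.
    by rewrite (le_trans (ler_normB _ _)) // mulr_natl mulr2n lerD //; [exact: ev_le zs'|exact: ev_le ws'].
  have hA' := psnorm_shift s0 hA.
  rewrite (ev_shift s0 hA zs') (ev_shift s0 hA ws').
  have -> : a 0%N + z * ev (psshift a) z - (a 0%N + w * ev (psshift a) w) =
     (z - w) * ev (psshift a) z + w * (ev (psshift a) z - ev (psshift a) w) by ring.
  rewrite (le_trans (ler_normD _ _)) // !normrM.
  have e1 : `|z - w| * `|ev (psshift a) z| <= `|z - w| * (A / s).
    by rewrite ler_wpM2l //; exact: ev_le zs'.
  have e2 := ler_wpM2l (normr_ge0 w) (IH _ _ hA').
  apply: (le_trans (lerD e1 e2)).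
  set X := 2 * (A / s) / s * `|z - w| + _.
  have X0 : 0 <= X by rewrite addr_ge0 ?mulr_ge0 ?invr_ge0 ?exprn_ge0 ?invr_ge0 ?(ltW s0).
  have e3 : `|w| * X <= s / 2 * X.
    by rewrite ler_wpM2r // ler_pdivlMr // mulrC.
  apply: (le_trans (lerD (lexx _) e3)).
  by rewrite le_eqVlt; apply/orP; left; apply/eqP; rewrite /X exprS; field; rewrite gt_eqF.
apply/ler_addgt0Pr => e e0; have [n hn] : exists n, 2 * A * 2^-1 ^+ n <= e.
  apply: contrapT => hne; have : e = 0.
    apply: (@Karch _ (2 * A) 2^-1); rewrite ?invr_ge0 ?invf_lt1 ?ltr1n // => n.
    have p0 : 0 <= 2 * A * 2^-1 ^+ n by rewrite !mulr_ge0 ?exprn_ge0 ?invr_ge0.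
    rewrite (gtr0_norm e0) real_leNgt; [|exact: gtr0_real|exact: ger0_real].
    by apply/negP => h; apply: hne; exists n; exact: ltW.
  by move=> z0; move: e0; rewrite z0 ltxx.
by apply: (le_trans (H n a A hA)); rewrite lerD2l.
Qed.

End Evaluation.

(** * The contact inequality *)

Section Contact.
Variable K : numClosedFieldType.
Hypothesis Kcomplete : forall (a : nat -> K) (A q : K), 0 <= A -> 0 <= q -> q < 1 ->
  (forall n, `|a n| <= A * q ^+ n) -> cvgn (fun N => \sum_(n < N) a n).
Hypothesis Karch : forall (x B q : K), 0 <= q -> q < 1 -> (forall n, `|x| <= B * q ^+ n) -> x = 0.
Implicit Types (a f : ps K) (r s t z w : K).
Local Notation nm := (psnorm (@absnorm K)).

Lemma ev_psXn z n : ev (psX ^+ n) z = z ^+ n.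
Proof.
have s0 : 0 < `|z| + 1 by rewrite ltr_wpDl.
have zs : `|z| < `|z| + 1 by rewrite ltrDl.
have hX := psnorm_X s0.
elim: n => [|n IH]; first by rewrite !expr0 -(rmorph1 (@psC K)) evC.
rewrite !exprS (evM Kcomplete Karch s0 hX (subnorm_X (subnorm_abs2 s0) n hX) zs) IH.
by rewrite (ev_psX Kcomplete).
Qed.

Lemma ev_ordge a m : convergent a -> ordge m a -> exists s A (g : ps K),
  [/\ 0 < s, nm s g A, g 0%N = a m & forall z, `|z| < s -> ev a z = z ^+ m * ev g z].
Proof.
move=> ca oa; pose g : ps K := fun n => a (n + m)%N.
have /convergentP [s [A [s0 hA]]] : convergent g := convergent_shift m ca.
exists s, A, g; split=> // z zs; rewrite (ordgeP oa) -/g.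
by rewrite (evM Kcomplete Karch s0 (subnorm_X (subnorm_abs2 s0) m (psnorm_X s0)) hA zs) ev_psXn.
Qed.

Lemma ev_upper a m : convergent a -> ordge m a ->
  exists r B, [/\ 0 < r, 0 <= B & forall z, `|z| < r -> `|ev a z| <= B * `|z| ^+ m].
Proof.
move=> ca oa; have [s [A [g [s0 hA _ h]]]] := ev_ordge ca oa.
exists s, A; split=> // [|z zs]; first exact: psnorm_ge0 hA.
rewrite h // normrM normrX mulrC ler_wpM2r ?exprn_ge0 //.
exact: (ev_le Kcomplete s0 hA zs).
Qed.

Lemma ev_lower a m : convergent a -> isord m a ->
  exists r B, [/\ 0 < r, 0 < B & forall z, `|z| < r -> B * `|z| ^+ m <= `|ev a z|].
Proof.
move=> ca [oa am]; have [s [A [g [s0 hA g0 h]]]] := ev_ordge ca oa.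
have A0 := psnorm_ge0 s0 hA.
have G0 : 0 < `|a m| by rewrite normr_gt0.
have A1 : 0 < 2 * (A + 1) by rewrite mulr_gt0 // ltr_wpDl.
(* Within this radius the non-constant part of g is at most |z| A / s, hence at most half of the
   leading coefficient. *)
have q0 : 0 < s * (`|a m| / (2 * (A + 1))) by rewrite mulr_gt0 // divr_gt0.
have [r [r0 rs rr]] := min_pos s0 q0.
exists r, (`|a m| / 2); split=> //; first by rewrite divr_gt0.
move=> z zr.
have zs : `|z| < s by exact: lt_le_trans rs.
rewrite h // normrM normrX mulrC ler_wpM2l ?exprn_ge0 //.
rewrite (ev_shift Kcomplete s0 hA zs) g0.
have e1 : `|z * ev (psshift g) z| <= `|a m| / 2.
  rewrite normrM; have := ev_le Kcomplete s0 (psnorm_shift s0 hA) zs => h1.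
  apply: (le_trans (ler_pM _ _ (ltW (lt_le_trans zr rr)) h1)) => //.
  have -> : s * (`|a m| / (2 * (A + 1))) * (A / s) = `|a m| / 2 * (A / (A + 1)).
    by field; rewrite !gt_eqF // ltr_wpDl.
  rewrite ler_piMr ?divr_ge0 // ler_pdivrMr ?ltr_wpDl // mul1r lerDl //.
have e2 : `|a m| - `|z * ev (psshift g) z| <= `|a m + z * ev (psshift g) z|.
  by rewrite -[X in _ <= `|_ + X|]opprK -(normrN (z * _)) lerB_dist.
apply: le_trans e2; rewrite lerBrDr (le_trans (lerD (lexx _) e1)) //.
by rewrite -splitr.
Qed.

Lemma subrXX_norm (z w rho : K) n : `|z| <= rho -> `|w| <= rho ->
  `|z ^+ n - w ^+ n| <= n%:R * rho ^+ n.-1 * `|z - w|.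
Proof.
move=> hz hw; have r0 : 0 <= rho := le_trans (normr_ge0 _) hz.
rewrite subrXX normrM mulrC ler_wpM2r // (le_trans (ler_norm_sum _ _ _)) //.
have -> : n%:R * rho ^+ n.-1 = \sum_(i < n) rho ^+ n.-1 by rewrite sumr_const card_ord mulr_natl.
apply: ler_sum => i _; rewrite normrM !normrX.
have -> : rho ^+ n.-1 = rho ^+ (n.-1 - i) * rho ^+ i.
  by rewrite -exprD subnK // -ltnS (leq_trans (ltn_ord i)) // leqSpred.
by apply: ler_pM; rewrite ?exprn_ge0 // lerXn2r ?nnegrE.
Qed.

(** The integrated form of the fact that the derivative has order at least m - 1; the factor
    rho^(m-1) is what the contact inequality needs. *)
Lemma ev_lipschitz_ordge a m : (0 < m)%N -> convergent a -> ordge m a ->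
  exists r B, [/\ 0 < r, 0 <= B & forall z w rho, `|z| <= rho -> `|w| <= rho -> rho < r ->
    `|ev a z - ev a w| <= B * rho ^+ m.-1 * `|z - w|].
Proof.
move=> m0 ca oa; have [s [A [g [s0 hA _ h]]]] := ev_ordge ca oa.
have A0 := psnorm_ge0 s0 hA.
exists (s / 2), (m%:R * A + A); split; rewrite ?divr_gt0 ?addr_ge0 ?mulr_ge0 // => z w rho hz hw hr.
have r0 : 0 <= rho := le_trans (normr_ge0 _) hz.
have hr2 : 2 * rho <= s by rewrite mulrC -ler_pdivlMr // ltW.
have hs : rho < s by apply: (lt_trans hr); rewrite ltr_pdivrMr // ltr_pMr // ltr1n.
have zs := le_lt_trans hz hs; have ws := le_lt_trans hw hs.
rewrite !h //.
have -> : z ^+ m * ev g z - w ^+ m * ev g w =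
  (z ^+ m - w ^+ m) * ev g z + w ^+ m * (ev g z - ev g w) by ring.
rewrite (le_trans (ler_normD _ _)) // !normrM !mulrDl; apply: lerD.
  apply: (le_trans (ler_pM _ _ (subrXX_norm m hz hw) (ev_le Kcomplete s0 hA zs))) => //.
  by rewrite le_eqVlt; apply/orP; left; apply/eqP; ring.
have e1 : `|w ^+ m| <= rho ^+ m.-1 * rho.
  by rewrite normrX -exprSr prednK // lerXn2r ?nnegrE.
have e2 := ev_lipschitz Kcomplete Karch s0 hA (le_trans (ler_wpM2l _ hz) hr2) (le_trans (ler_wpM2l _ hw) hr2).
apply: (le_trans (ler_pM _ _ e1 (e2 _ _))) => //.
have -> : rho ^+ m.-1 * rho * (2 * A / s * `|z - w|) = A * rho ^+ m.-1 * `|z - w| * (2 * rho / s).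
  by field; rewrite gt_eqF.
by rewrite ler_piMr ?mulr_ge0 ?exprn_ge0 // ler_pdivrMr // mul1r.
Qed.

Lemma ev_rotps a e : `|e| = 1 -> convergent a ->
  exists2 r, 0 < r & forall z, `|z| < r -> ev (rotps e a) z = ev a (e * z).
Proof.
move=> e1 /convergentP [s [A [s0 hA]]]; exists s => // z zs.
have hX : nm s (psC e * psX) s.
  rewrite -[X in nm _ _ X]mul1r; apply: (subnorm_M (subnorm_abs2 s0)); last exact: psnorm_X.
  by apply: psnorm_C => //; rewrite /absnorm e1.
have f0 : (psC e * psX) 0%N = 0 :> K by rewrite psCM mulr0.
have [_ ->] := ev_scomp Kcomplete Karch s0 s0 f0 hX hA zs.
by rewrite (evZ Kcomplete _ s0 (psnorm_X s0) zs) (ev_psX Kcomplete).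
Qed.

Lemma uniform_ratio n (P Q : nat -> K -> K) :
  (forall j, (j < n)%N -> exists r B, [/\ 0 < r, 0 <= B &
     forall z, `|z| < r -> `|P j z| <= B * `|Q j z|]) ->
  exists r B, [/\ 0 < r, 0 <= B & forall j z, (j < n)%N -> `|z| < r -> `|P j z| <= B * `|Q j z|].
Proof.
elim: n => [|n IH] h; first by exists 1, 0.
have [r [B [r0 B0 hr]]] := IH (fun j hj => h j (ltnW hj)).
have [r' [B' [r'0 B'0 hr']]] := h n (ltnSn n).
have [x [x0 xr xr']] := min_pos r0 r'0.
exists x, (B + B'); split=> // [|j z]; first exact: addr_ge0.
rewrite ltnS leq_eqVlt => /orP[/eqP -> zx|jn zx].
  by apply: (le_trans (hr' z (lt_le_trans zx xr'))); rewrite ler_wpM2r // lerDr.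
by apply: (le_trans (hr j z jn (lt_le_trans zx xr))); rewrite ler_wpM2r // lerDl.
Qed.

Section Roots.
Variables (n : nat) (e : K).
Hypotheses (n_gt0 : (0 < n)%N) (prim_e : n.-primitive_root e).

Lemma norm_prim_root j : `|e ^+ j| = 1.
Proof.
rewrite normrX; have -> : `|e| = 1; last by rewrite expr1n.
by apply/eqP; rewrite -(pexpr_eq1 n_gt0 (normr_ge0 e)) -normrX (prim_expr_order prim_e) normr1.
Qed.

Lemma subrXn_prod t s : t ^+ n - s ^+ n = \prod_(l < n) (t - e ^+ l * s).
Proof.
have [->|s0] := eqVneq s 0.
  rewrite expr0n gtn_eqF // subr0 (eq_bigr (fun=> t)) ?prodr_const ?card_ord // => l _.
  by rewrite mulr0 subr0.
have h : (t / s) ^+ n - 1 = \prod_(l < n) (t / s - e ^+ l).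
  have := congr1 (fun p : {poly K} => p.[t / s]) (factor_Xn_sub_1 prim_e).
  rewrite big_mkord horner_prod !hornerE => <-.
  by apply: eq_bigr => l _; rewrite !hornerE.
have -> : t ^+ n - s ^+ n = s ^+ n * ((t / s) ^+ n - 1).
  by rewrite mulrBr mulr1 -exprMn mulrCA divff // mulr1.
have -> : s ^+ n = \prod_(l < n) s by rewrite prodr_const card_ord.
rewrite h -big_split; apply: eq_bigr => l _ /=.
by rewrite mulrBr mulrCA divff // mulr1 mulrC.
Qed.

Lemma root_gap : exists2 c, 0 < c & forall i j, (i < n)%N -> (j < n)%N -> i != j -> c <= `|e ^+ i - e ^+ j|.
Proof.
have [c c0 hc] : exists2 c : K, 0 < c & forall d, (0 < d < n)%N -> c <= `|e ^+ d - 1|.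
  have hd : forall d, (0 < d < n)%N -> 0 < `|e ^+ d - 1|.
    move=> d /andP[d0 dn]; rewrite normr_gt0 subr_eq0 -(prim_order_dvd prim_e).
    by apply/negP => /dvdn_leq; rewrite d0 leqNgt dn => /(_ isT).
  elim: (n) hd => [|k IH] hd; first by exists 1 => // d; rewrite ltn0 andbF.
  have [|c c0 hc] := IH; first by move=> d /andP[d0 dk]; rewrite hd // d0 ltnW.
  case: (posnP k) => [->|k0].
    by exists 1 => // d /andP[d0]; rewrite ltnS leqNgt d0.
  have [x [x0 xc xk]] := min_pos c0 (hd k (introT andP (conj k0 (ltnSn k)))).
  exists x => // d /andP[d0]; rewrite ltnS leq_eqVlt => /orP[/eqP -> //|dk].
  by apply: (le_trans xc); rewrite hc // d0.
exists c => // i j hi hj; rewrite neq_ltn => /orP[lt_ij|lt_ij].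
  have -> : e ^+ i - e ^+ j = - (e ^+ i * (e ^+ (j - i) - 1)).
    by rewrite mulrBr -exprD subnKC ?mulr1 ?opprB // ltnW.
  by rewrite normrN normrM norm_prim_root mul1r hc // subn_gt0 lt_ij (leq_ltn_trans (leq_subr _ _)).
have -> : e ^+ i - e ^+ j = e ^+ j * (e ^+ (i - j) - 1).
  by rewrite mulrBr -exprD subnKC ?mulr1 // ltnW.
by rewrite normrM norm_prim_root mul1r hc // subn_gt0 lt_ij (leq_ltn_trans (leq_subr _ _)).
Qed.

(** If some e^j s is within (c/2)|s| of t, the gap c|s| between the e^i s keeps the others away. If
    none is, every e^l s is at distance at least (c/2)|s| from t, and j = 0 will do; that case
    produces the 6 in the constant c / (c + 6). *)
Lemma nearest_root : exists2 c, 0 < c & forall t s, exists2 j, (j < n)%N &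
  forall l, (l < n)%N -> l != j -> c * (`|t - e ^+ j * s| + `|s|) <= `|t - e ^+ l * s|.
Proof.
have [c c0 hc] := root_gap.
have c6 : 0 < c + 6 by rewrite addr_gt0.
exists (c / (c + 6)); first by rewrite divr_gt0.
move=> t s; have [[j jn hj]|hne] := pselect (exists2 j, (j < n)%N & 2 * `|t - e ^+ j * s| <= c * `|s|).
  exists j => // l ln lj; rewrite mulrAC ler_pdivrMr //.
  have h1 : c * `|s| <= `|t - e ^+ l * s| + `|t - e ^+ j * s|.
    apply: (le_trans (ler_wpM2r (normr_ge0 s) (hc l j ln jn lj))).
    have e1 : (e ^+ l - e ^+ j) * s = (t - e ^+ j * s) - (t - e ^+ l * s) by ring.
    by rewrite -normrM e1 [leRHS]addrC ler_normB.
  have h2 : c * `|s| <= 2 * `|t - e ^+ l * s|.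
    rewrite -(lerD2r (2 * `|t - e ^+ j * s|)) (le_trans (lerD (lexx _) hj)) //.
    by rewrite -[leRHS]mulrDr -[leLHS]mulr2n -[leLHS]mulr_natl ler_wpM2l.
  have h3 : c * `|t - e ^+ j * s| <= c * `|t - e ^+ l * s|.
    rewrite ler_wpM2l ?(ltW c0) // -(ler_pM2l (ltr0n K 2 : 0 < 2%:R :> K)).
    exact: le_trans hj h2.
  rewrite mulrDr; apply: (le_trans (lerD h3 h2)).
  set X := `|t - e ^+ l * s|; have -> : X * (c + 6) = c * X + 2 * X + 4 * X by ring.
  by rewrite lerDl mulr_ge0 // /X normr_ge0.
have hne' l : (l < n)%N -> c * `|s| <= 2 * `|t - e ^+ l * s|.
  move=> ln; apply: ltW; rewrite real_ltNge ?ger0_real ?mulr_ge0 ?(ltW c0) //.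
  by apply/negP => h; apply: hne; exists l.
exists 0%N => // l ln l0; rewrite expr0 mul1r mulrAC ler_pdivrMr //.
have h1 : `|t - s| <= `|t - e ^+ l * s| + 2 * `|s|.
  have -> : t - s = (t - e ^+ l * s) + (e ^+ l * s - s) by ring.
  rewrite (le_trans (ler_normD _ _)) // lerD2l (le_trans (ler_normB _ _)) //.
  by rewrite normrM norm_prim_root mul1r mulr_natl mulr2n.
have h2 : c * (`|t - s| + `|s|) <= c * `|t - e ^+ l * s| + 3 * (c * `|s|).
  rewrite (_ : c * _ + 3 * _ = c * (`|t - e ^+ l * s| + 2 * `|s| + `|s|)); last by ring.
  by rewrite ler_wpM2l ?(ltW c0) // lerD2r.
apply: (le_trans h2); have h3 := hne' l ln.
have h4 : 3 * (c * `|s|) <= 3 * (2 * `|t - e ^+ l * s|) by rewrite ler_wpM2l.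
apply: (le_trans (lerD (lexx _) h4)).
by rewrite le_eqVlt; apply/orP; left; apply/eqP; ring.
Qed.

(** Let u = e^j s be nearest to t and rho = |t - u| + |s|. The other factors of t^n - s^n are at
    least c rho, so rho^(n-1) |t - u| is bounded by |t^n - s^n|; by order at least n, so are the
    changes of F and H from t to u. From u to s, the contact orders bound the change of H by that of
    F. *)
Theorem contact_inequality (F H : ps K) (m : nat -> nat) : convergent F -> convergent H ->
  ordge n F -> ordge n H ->
  (forall j, (0 < j < n)%N -> isord (m j) (rotps (e ^+ j) F - F) /\ ordge (m j) (rotps (e ^+ j) H - H)) ->
  exists r B, [/\ 0 < r, 0 <= B & forall t s, `|t| < r -> `|s| < r ->
    `|ev H t - ev H s| <= B * (`|t ^+ n - s ^+ n| + `|ev F t - ev F s|)].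
Proof.
move=> cF cH oF oH hm.
have crot a j : convergent a -> convergent (rotps (e ^+ j) a).
  by move=> ca; apply: convergent_scomp ca; apply: convergentM; [exact: convergentC|exact: convergentX].
have evB a j : convergent a -> exists2 r, 0 < r & forall z, `|z| < r ->
    ev (rotps (e ^+ j) a - a) z = ev a (e ^+ j * z) - ev a z.
  move=> ca; have [r r0 hr] := ev_rotps (norm_prim_root j) ca.
  have [s [A [B [s0 hA hB]]]] := convergent_common (crot a j ca) ca.
  have [x [x0 xr xs]] := min_pos r0 s0; exists x => // z zx.
  have zs := lt_le_trans zx xs.
  rewrite (evD Kcomplete s0 hA (subnorm_N (subnorm_abs2 s0) hB) zs) hr ?(lt_le_trans zx) //.
  by rewrite -[- a]mulN1r -(rmorph1 (@psC K)) -rmorphN (evZ Kcomplete _ s0 hB zs) mulN1r.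
have [r1 [B1 [r10 B10 h1]]] : exists r B, [/\ 0 < r, 0 <= B & forall j z, (j < n)%N -> `|z| < r ->
    `|ev H (e ^+ j * z) - ev H z| <= B * `|ev F (e ^+ j * z) - ev F z|].
  apply: (@uniform_ratio n (fun j z => ev H (e ^+ j * z) - ev H z) (fun j z => ev F (e ^+ j * z) - ev F z)).
  move=> j jn; case: (posnP j) => [->|j0].
    by exists 1, 0; split=> // z _; rewrite expr0 mul1r !subrr normr0 mul0r.
  have [iF gH] := hm j (introT andP (conj j0 jn)).
  have cHj : convergent (rotps (e ^+ j) H - H) by apply/convergentD/convergentN/cH/crot.
  have cFj : convergent (rotps (e ^+ j) F - F) by apply/convergentD/convergentN/cF/crot.
  have [x [X [x0 X0 hX]]] := ev_upper cHj gH; have [y [Y [y0 Y0 hY]]] := ev_lower cFj iF.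
  have [u u0 hu] := evB H j cH; have [v v0 hv] := evB F j cF.
  have [a [a0 ax ay]] := min_pos x0 y0; have [b [b0 bu bv]] := min_pos u0 v0.
  have [c [c0 ca cb]] := min_pos a0 b0.
  exists c, (X / Y); split=> // [|z zc]; first by rewrite divr_ge0 // ltW.
  have za := lt_le_trans zc ca; have zb := lt_le_trans zc cb.
  rewrite -hu ?(lt_le_trans zb) // -hv ?(lt_le_trans zb) //.
  apply: (le_trans (hX z (lt_le_trans za ax))); rewrite -mulrA ler_wpM2l //.
  by rewrite mulrC ler_pdivlMr // mulrC hY // (lt_le_trans za).
have [rF [LF [rF0 LF0 hF]]] := ev_lipschitz_ordge n_gt0 cF oF.
have [rH [LH [rH0 LH0 hH]]] := ev_lipschitz_ordge n_gt0 cH oH.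
have [c c0 hc] := nearest_root.
have [x [x0 xF xH]] := min_pos rF0 rH0.
have x3 : 0 < x / 3 by rewrite divr_gt0.
have [r [r0 rx rr1]] := min_pos x3 r10.
pose D := (c ^+ n.-1)^-1.
have D0 : 0 <= D by rewrite invr_ge0 exprn_ge0 // ltW.
exists r, (LH * D + B1 * LF * D + B1); split=> // [|t s tr sr].
  by rewrite !addr_ge0 ?mulr_ge0.
have [j jn hj] := hc t s; set u := e ^+ j * s.
have us : `|u| = `|s| by rewrite normrM norm_prim_root mul1r.
set rho := `|t - u| + `|s|.
have urho : `|u| <= rho by rewrite us /rho lerDr.
have trho : `|t| <= rho by rewrite /rho -us -{1}(subrK u t) ler_normD.
have rhox : rho < x.
  have : rho < r + r + r.
    rewrite /rho ltrD // (le_lt_trans (ler_normB _ _)) // us ltrD //.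
  move=> /lt_le_trans; apply; have -> : x = x / 3 + x / 3 + x / 3 by field.
  by rewrite !lerD.
have rho0 : 0 <= rho := le_trans (normr_ge0 _) urho.
have hD : rho ^+ n.-1 * `|t - u| <= D * `|t ^+ n - s ^+ n|.
  rewrite mulrC ler_pdivlMl ?exprn_gt0 // subrXn_prod (bigD1 (Ordinal jn)) //= normrM -/u.
  rewrite mulrCA ler_wpM2l // -exprMn normr_prod.
  have -> : (c * rho) ^+ n.-1 = \prod_(l < n | l != Ordinal jn) (c * rho).
    by rewrite prodr_const cardC1 card_ord.
  apply: ler_prod => l lj; rewrite mulr_ge0 ?(ltW c0) //=; exact: hj.
have eF : `|ev F t - ev F u| <= LF * D * `|t ^+ n - s ^+ n|.
  by apply: (le_trans (hF t u rho trho urho (lt_le_trans rhox xF))); rewrite -!mulrA ler_wpM2l.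
have eH : `|ev H t - ev H u| <= LH * D * `|t ^+ n - s ^+ n|.
  by apply: (le_trans (hH t u rho trho urho (lt_le_trans rhox xH))); rewrite -!mulrA ler_wpM2l.
have eu : `|ev H u - ev H s| <= B1 * (`|ev F t - ev F s| + LF * D * `|t ^+ n - s ^+ n|).
  apply: (le_trans (h1 j s jn (lt_le_trans sr rr1))); rewrite ler_wpM2l // -/u.
  have -> : ev F u - ev F s = (ev F t - ev F s) - (ev F t - ev F u) by ring.
  by rewrite (le_trans (ler_normB _ _)) // lerD2l.
have -> : ev H t - ev H s = (ev H t - ev H u) + (ev H u - ev H s) by ring.
apply: (le_trans (ler_normD _ _)); apply: (le_trans (lerD eH eu)).
set d := `|t ^+ n - s ^+ n|; set f := `|ev F t - ev F s|.
rewrite -subr_ge0 (_ : _ - _ = B1 * d + (LH * D + B1 * LF * D) * f); last by ring.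
have d0 : 0 <= d by exact: normr_ge0.
have f0 : 0 <= f by exact: normr_ge0.
by rewrite addr_ge0 // mulr_ge0 // addr_ge0 // !mulr_ge0.
Qed.

End Roots.
End Contact.

(** * Lipschitz extensions and shears *)

Section Shears.
Local Open Scope classical_set_scope.
Variable K : numClosedFieldType.
Hypothesis Kcomplete : forall (a : nat -> K) (A q : K), 0 <= A -> 0 <= q -> q < 1 ->
  (forall n, `|a n| <= A * q ^+ n) -> cvgn (fun N => \sum_(n < N) a n).
Hypothesis Ksup : forall (S : set K) (x0 B : K), S x0 -> (forall x, S x -> x \is Num.real) ->
  (forall x, S x -> x <= B) ->
  exists m, (forall x, S x -> x <= m) /\ forall b, (forall x, S x -> x <= b) -> m <= b.
Implicit Types (p q x y : K * K) (B : K).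

Definition dist2 p q : K := `|p.1 - q.1| + `|p.2 - q.2|.

Lemma dist2_ge0 p q : 0 <= dist2 p q. Proof. exact: addr_ge0. Qed.
Lemma dist2pp p : dist2 p p = 0. Proof. by rewrite /dist2 !subrr normr0 addr0. Qed.
Lemma dist2C p q : dist2 p q = dist2 q p.
Proof. by rewrite /dist2 distrC (distrC p.2). Qed.
Lemma dist2_triangle p q x : dist2 p q <= dist2 p x + dist2 x q.
Proof. by rewrite /dist2 addrACA lerD // ler_distD. Qed.

(** McShane's extension e(x) = sup over p in X of h(p) - B dist(x, p). *)
Lemma mcshane_real (X : set (K * K)) (h : K * K -> K) B p0 : 0 <= B -> X p0 ->
  (forall p, X p -> h p \is Num.real) ->
  (forall p q, X p -> X q -> `|h p - h q| <= B * dist2 p q) ->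
  exists e : K * K -> K, [/\ forall p, X p -> e p = h p & forall p q, `|e p - e q| <= B * dist2 p q].
Proof.
move=> B0 Xp0 hr hL.
have hle p q : X p -> X q -> h p <= h q + B * dist2 p q.
  move=> Xp Xq; rewrite -lerBlDl (le_trans _ (hL p q Xp Xq)) // real_ler_norm // realB ?hr //.
have dr p q : B * dist2 p q \is Num.real by rewrite realM ?ger0_real // dist2_ge0.
have tri x p q : B * dist2 p q <= B * dist2 p x + B * dist2 x q.
  by rewrite -mulrDr ler_wpM2l // dist2_triangle.
have /choice[e he] : forall x, exists m, (forall p, X p -> h p - B * dist2 x p <= m) /\
    forall b, (forall p, X p -> h p - B * dist2 x p <= b) -> m <= b.
  move=> x; have [] := @Ksup [set h p - B * dist2 x p | p in X] (h p0 - B * dist2 x p0) (h p0 + B * dist2 x p0).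
  - by exists p0.
  - by move=> _ [p Xp <-]; rewrite realB ?hr.
  - move=> _ [p Xp <-]; rewrite lerBlDr; apply: (le_trans (hle p p0 Xp Xp0)).
    by rewrite -addrA lerD2l addrC (dist2C x p) tri.
  move=> m [ub lub]; exists m; split=> [p Xp|b hb]; first by apply: ub; exists p.
  by apply: lub => _ [p Xp <-]; exact: hb.
have er x : e x \is Num.real.
  have [h1 _] := he x; have := realB (hr p0 Xp0) (dr x p0).
  by rewrite (ger_real (h1 p0 Xp0)).
have half x y : e x - e y <= B * dist2 x y.
  rewrite lerBlDl; apply: (proj2 (he x)) => p Xp.
  apply: le_trans (lerD ((proj1 (he y)) p Xp) (lexx _)).
  rewrite -addrA lerD2l -lerBlDl opprK addrC lerBlDr (dist2C x y); exact: tri.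
exists e; split=> [p Xp|x y].
  apply: le_anti; apply/andP; split; last by have := proj1 (he p) p Xp; rewrite dist2pp mulr0 subr0.
  by apply: (proj2 (he p)) => q Xq; rewrite lerBlDr (dist2C p q) hle.
rewrite real_ler_norml ?realB // half andbT lerNl opprB (dist2C x y); exact: half.
Qed.

Lemma mcshane (X : set (K * K)) (h : K * K -> K) B p0 : 0 <= B -> X p0 ->
  (forall p q, X p -> X q -> `|h p - h q| <= B * dist2 p q) ->
  exists e : K * K -> K, [/\ forall p, X p -> e p = h p & forall p q, `|e p - e q| <= 2 * B * dist2 p q].
Proof.
move=> B0 Xp0 hL.
have [|p q Xp Xq|u [uX uL]] := @mcshane_real X (fun p => 'Re (h p)) B p0 B0 Xp0.
- by move=> p _; exact: Creal_Re.
- rewrite -raddfB; exact: le_trans (leif_normC_Re_Creal _).1 (hL p q Xp Xq).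
have [|p q Xp Xq|v [vX vL]] := @mcshane_real X (fun p => 'Im (h p)) B p0 B0 Xp0.
- by move=> p _; exact: Creal_Im.
- rewrite -raddfB; apply: le_trans (hL p q Xp Xq).
  rewrite -normrN -ReMil -[leRHS]mul1r -normCi -normrM; exact: (leif_normC_Re_Creal _).1.
exists (fun p => u p + 'i * v p); split=> [p Xp|p q]; first by rewrite uX ?vX // -Crect.
have -> : u p + 'i * v p - (u q + 'i * v q) = (u p - u q) + 'i * (v p - v q) by ring.
rewrite (le_trans (ler_normD _ _)) // normrM normCi mul1r -mulrA mulr_natl mulr2n.
exact: lerD (uL p q) (vL p q).
Qed.

Lemma lipschitz_continuous (f : K * K -> K) B :
  (forall p q, `|f p - f q| <= B * dist2 p q) -> continuous f.
Proof.
move=> fL p; apply/cvgrPdist_lt => e e0.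
have B1 : 0 < `|B| + 1 by rewrite ltr_wpDl.
have d0 : 0 < e / (2 * (`|B| + 1)) by rewrite divr_gt0 // mulr_gt0.
have h1 : (fun q : K * K => q.1) q @[q --> p] --> p.1 by exact: cvg_fst.
have h2 : (fun q : K * K => q.2) q @[q --> p] --> p.2 by exact: cvg_snd.
move/cvgrPdist_lt/(_ _ d0): h1 => h1; move/cvgrPdist_lt/(_ _ d0): h2 => h2.
near=> q.
have q1 : `|p.1 - q.1| < e / (2 * (`|B| + 1)) by near: q.
have q2 : `|p.2 - q.2| < e / (2 * (`|B| + 1)) by near: q.
have : dist2 p q < e / (`|B| + 1).
  apply: (lt_le_trans (ltrD q1 q2)); rewrite le_eqVlt; apply/orP; left; apply/eqP.
  by field; rewrite gt_eqF.
rewrite ltr_pdivlMr // => h; apply: le_lt_trans h.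
rewrite (le_trans (fL p q)) //; have := dist2_ge0 p q => hd.
have hb : B * dist2 p q <= `|B| * dist2 p q.
  have : B * dist2 p q \is Num.real by exact: ger0_real (le_trans (normr_ge0 _) (fL p q)).
  by move=> /real_ler_norm h; apply: (le_trans h); rewrite normrM (ger0_norm hd).
by rewrite (le_trans hb) // mulrC ler_wpM2l // lerDl.
Unshelve. all: by end_near.
Qed.

(** Global homeomorphisms rather than germs, so that chains of them compose without shrinking
    domains. *)
Definition homeo2 (psi : K * K -> K * K) : Prop :=
  exists psi', [/\ cancel psi psi', cancel psi' psi, continuous psi, continuous psi' & psi (0, 0) = (0, 0)].

Lemma homeo2_id : homeo2 id.
Proof. by exists id; split=> // x; exact: cvg_id. Qed.

Lemma homeo2_comp psi1 psi2 : homeo2 psi1 -> homeo2 psi2 -> homeo2 (psi1 \o psi2).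
Proof.
move=> [a [a1 a2 a3 a4 a5]] [b [b1 b2 b3 b4 b5]]; exists (b \o a); split.
- exact: (can_comp a1 b1).
- exact: (can_comp b2 a2).
- by move=> x; apply: continuous_comp; [exact: b3|exact: a3].
- by move=> x; apply: continuous_comp; [exact: a4|exact: b4].
- by rewrite /= b5.
Qed.

Lemma homeo2_inv psi : homeo2 psi -> exists2 psi', homeo2 psi' & cancel psi psi'.
Proof.
move=> [a [a1 a2 a3 a4 a5]]; exists a => //; exists psi; split=> //.
by rewrite -a5 a1.
Qed.

Lemma contraction_fixpoint (g : K -> K) : (forall y z : K, `|g y - g z| <= `|y - z| / 2) -> exists y : K, g y = y.
Proof.
move=> gL; pose u n := iter n g 0.
have step n : `|u n.+1 - u n| <= `|g 0| * (2^-1) ^+ n.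
  elim: n => [|n IH]; first by rewrite expr0 mulr1 /u /= subr0.
  by rewrite (le_trans (gL _ _)) // exprSr mulrA ler_wpM2r // invr_ge0.
have c : cvgn (fun N => \sum_(n < N) (u n.+1 - u n)).
  by apply: (Kcomplete _ _ _ step); rewrite ?invr_ge0 ?invf_lt1 ?ltr1n.
have e N : \sum_(n < N) (u n.+1 - u n) = u N.
  by elim: N => [|N IH]; rewrite ?big_ord0 // big_ord_recr IH /= addrC subrK.
rewrite (_ : (fun N => _) = u) in c; last by apply/funext.
have [l hl] : exists l : K, u @ \oo --> l by exists (limn u : K).
exists l; apply/eqP; rewrite -subr_eq0 -normr_le0; apply/ler_addgt0Pr => d d0; rewrite add0r.
have d2 : 0 < d / 2 by rewrite divr_gt0.
have /cvgrPdist_lt/(_ _ d2) [n _ hn] := hl.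
have h1 := hn n (leqnn n); have h2 := hn n.+1 (leqnSn n).
have -> : g l - l = (g l - g (u n)) - (l - u n.+1) by rewrite /u /=; ring.
rewrite (le_trans (ler_normB _ _)) // [leRHS]splitr lerD ?(ltW h2) //.
by rewrite (le_trans (gL _ _)) // ler_pM2r ?invr_gt0 // (le_trans (ltW h1)) // ler_pdivrMr // mulrC ler_pMl // ler1n.
Qed.

(** Inverting the shear over (x, y') means solving y = y' - e(x, y), a fixed point of a map with
    Lipschitz constant 1/2; the solution is Lipschitz with constant 2 in (x, y'). *)
Lemma shear_homeo (e : K * K -> K) : e (0, 0) = 0 ->
  (forall p q, `|e p - e q| <= dist2 p q / 2) -> homeo2 (fun p => (p.1, p.2 + e p)).
Proof.
move=> e0 eL.
have /choice[v hv] : forall p : K * K, exists y : K, p.2 - e (p.1, y) = y.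
  move=> p; apply: contraction_fixpoint => y z.
  have -> : p.2 - e (p.1, y) - (p.2 - e (p.1, z)) = - (e (p.1, y) - e (p.1, z)) by ring.
  by rewrite normrN; apply: (le_trans (eL _ _)); rewrite /dist2 /= subrr normr0 add0r.
have uniq p (y : K) : p.2 - e (p.1, y) = y -> y = v p.
  move=> hy; apply/eqP; rewrite -subr_eq0 -normr_le0.
  have : `|y - v p| <= `|y - v p| / 2.
    have {1}-> : y - v p = - (e (p.1, y) - e (p.1, v p)) by rewrite -{1}hy -{1}hv; ring.
    by rewrite normrN; apply: (le_trans (eL _ _)); rewrite /dist2 /= subrr normr0 add0r.
  by rewrite {1}[`|_|]splitr gerDl => h; rewrite -(pmulr_lle0 (x := 2^-1)) ?invr_gt0 // mulrC.
have vL p q : `|v p - v q| <= 2 * dist2 p q.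
  have h : `|v p - v q| <= `|p.2 - q.2| + (`|p.1 - q.1| + `|v p - v q|) / 2.
    have {1}-> : v p - v q = (p.2 - q.2) - (e (p.1, v p) - e (q.1, v q)) by rewrite -{1}hv -{1}[v q]hv; ring.
    by rewrite (le_trans (ler_normB _ _)) // lerD2l; exact: eL.
  have h2 : `|v p - v q| / 2 <= `|p.2 - q.2| + `|p.1 - q.1| / 2.
    by move: h; rewrite mulrDl addrA {1}[`|v p - v q|]splitr lerD2r.
  have h3 : `|v p - v q| <= 2 * (`|p.2 - q.2| + `|p.1 - q.1| / 2) by rewrite mulrC -ler_pdivrMr.
  apply: (le_trans h3); rewrite ler_wpM2l // addrC lerD2r ler_pdivrMr // ler_peMr ?ler1n //.
have cpair (g : K * K -> K) B : (forall p q, `|g p - g q| <= B * dist2 p q) -> continuous (fun p => (p.1, g p)).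
  move=> gL p; have h1 : (fun q : K * K => q.1) q @[q --> p] --> p.1 by exact: cvg_fst.
  exact: (cvg_pair h1 (lipschitz_continuous gL (x := p))).
exists (fun p => (p.1, v p)); split.
- move=> [x y] /=; congr (_, _); apply/esym/uniq => /=; ring.
- move=> [x y] /=; congr (_, _); by rewrite -{1}hv /= subrK.
- apply: (cpair (fun p => p.2 + e p) 2) => p q.
  have -> : p.2 + e p - (q.2 + e q) = (p.2 - q.2) + (e p - e q) by ring.
  rewrite (le_trans (ler_normD _ _)) // mulr_natl mulr2n lerD ?lerDr //.
  by apply: (le_trans (eL p q)); rewrite ler_pdivrMr // ler_peMr ?ler1n ?dist2_ge0.
- exact: cpair vL.
- by rewrite /= e0 addr0.
Qed.

End Shears.

(** * Topological triviality of families with constant contact orders *)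

Section Deformation.
Local Open Scope classical_set_scope.
Variable K : numClosedFieldType.
Hypothesis Kcomplete : forall (a : nat -> K) (A q : K), 0 <= A -> 0 <= q -> q < 1 ->
  (forall n, `|a n| <= A * q ^+ n) -> cvgn (fun N => \sum_(n < N) a n).
Hypothesis Karch : forall (x B q : K), 0 <= q -> q < 1 -> (forall n, `|x| <= B * q ^+ n) -> x = 0.
Hypothesis Ksup : forall (S : set K) (x0 B : K), S x0 -> (forall x, S x -> x \is Num.real) ->
  (forall x, S x -> x <= B) ->
  exists m, (forall x, S x -> x <= m) /\ forall b, (forall x, S x -> x <= b) -> m <= b.
Variables (n : nat) (e : K).
Hypotheses (n_gt0 : (0 < n)%N) (prim_e : n.-primitive_root e).
Implicit Types (F H : ps K) (t : K).

Lemma ev_at0 F : convergent F -> F 0%N = 0 -> ev F 0 = 0.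
Proof.
move=> /convergentP [s [A [s0 hA]]] F0.
by rewrite (ev_shift Kcomplete s0 hA) ?normr0 // F0 mul0r addr0.
Qed.

(* H is extended to the plane as a Lipschitz function of (t^n, F(t)). *)
Lemma shear_along F H : convergent F -> convergent H -> F 0%N = 0 -> H 0%N = 0 ->
  (exists r B, [/\ 0 < r, 0 <= B & forall t s, `|t| < r -> `|s| < r ->
    `|ev H t - ev H s| <= B * (`|t ^+ n - s ^+ n| + `|ev F t - ev F s|)]) ->
  exists2 eta : K, 0 < eta & forall mu : K, `|mu| < eta -> exists2 psi, homeo2 psi &
    exists2 r : K, 0 < r & forall t, `|t| < r -> psi (t ^+ n, ev F t) = (t ^+ n, ev F t + mu * ev H t).
Proof.
move=> cF cH F0 H0 [r [B [r0 B0 hB]]].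
have /choice[h hh] : forall p : K * K, exists v : K,
    forall t, `|t| < r -> p = (t ^+ n, ev F t) -> v = ev H t.
  move=> p; have [[t tr ->]|hne] := pselect (exists2 t, `|t| < r & p = (t ^+ n, ev F t)).
    exists (ev H t) => s sr [e1 e2]; apply/eqP; rewrite -subr_eq0 -normr_le0.
    by apply: (le_trans (hB t s tr sr)); rewrite e1 e2 !subrr normr0 addr0 mulr0.
  by exists 0 => t tr et; case: hne; exists t.
pose X : set (K * K) := [set p | exists2 t, `|t| < r & p = (t ^+ n, ev F t)].
have hX t : `|t| < r -> h (t ^+ n, ev F t) = ev H t by move=> tr; exact: hh.
have z0 : (0, 0) = (0 ^+ n, ev F 0) :> K * K by rewrite expr0n gtn_eqF // ev_at0.
have r00 : `|0 : K| < r by rewrite normr0.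
have X0 : X (0, 0) by exists 0.
have [|d [dX dL]] := @mcshane K Ksup X h B (0, 0) B0 X0.
  by move=> _ _ [t tr ->] [s sr ->]; rewrite !hX //; exact: hB.
(* The extension d is Lipschitz with constant 2 B, so |mu| < 1 / (4 (B + 1)) brings mu d below the
   constant 1/2 of [shear_homeo]. *)
have B1 : 0 < 4 * (B + 1) by rewrite mulr_gt0 // ltr_wpDl.
exists (4 * (B + 1))^-1; first by rewrite invr_gt0.
move=> mu hmu; exists (fun p => (p.1, p.2 + mu * d p)).
  apply: (shear_homeo Kcomplete) => [|p q].
    by rewrite dX // z0 hX // ev_at0 // mulr0.
  rewrite -mulrBr normrM; apply: (le_trans (ler_pM _ _ (ltW hmu) (dL p q))) => //.
  have -> : (4 * (B + 1))^-1 * (2 * B * dist2 p q) = dist2 p q / 2 * (B / (B + 1)).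
    by field; rewrite gt_eqF // ltr_wpDl.
  by rewrite ler_piMr ?divr_ge0 ?dist2_ge0 // ler_pdivrMr ?ltr_wpDl // mul1r lerDl.
by exists r => // t tr; rewrite /= dX ?hX //; exists t.
Qed.

Variables (F0 F1 : ps K) (m : nat -> nat).
Hypotheses (cF0 : convergent F0) (cF1 : convergent F1) (oF0 : ordge n F0) (oF1 : ordge n F1).
Hypothesis mF0 : forall j, (0 < j < n)%N -> isord (m j) (rotps (e ^+ j) F0 - F0).
Hypothesis mF1 : forall j, (0 < j < n)%N -> isord (m j) (rotps (e ^+ j) F1 - F1).

Let a j := (rotps (e ^+ j) F0 - F0) (m j).
Let b j := (rotps (e ^+ j) F1 - F1) (m j).
Let H := F1 - F0.
Let Fam (mu : K) := F0 + psC mu * H.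

(* The path u + i kappa u (1 - u) joins 0 to 1; for a suitable slope kappa no member of the
   family along it loses a contact order. *)
Definition arc (kappa : nat) (u : K) : K := u + 'i * (kappa%:R * (u * (1 - u))).

Lemma arc_real (kappa : nat) (u : K) : u \is Num.real -> kappa%:R * (u * (1 - u)) \is Num.real.
Proof. by move=> ur; rewrite realM ?realn // realM // realB // real1. Qed.

(** Pigeonhole: each j excludes at most one parameter, which is neither 0 nor 1 since a_j and b_j
    are nonzero, and arcs of different slopes meet only at 0 and 1. If all n + 1 slopes failed,
    their indices j would inject into a set of n elements. *)
Lemma arc_avoids : exists kappa, forall j u, (0 < j < n)%N -> u \is Num.real ->
  a j + arc kappa u * (b j - a j) != 0.
Proof.
apply: contrapT => hne.
have /choice[f hf] : forall k : 'I_n.+1, exists ju : 'I_n * K, [/\ (0 < ju.1)%N, ju.2 \is Num.real &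
    a ju.1 + arc k ju.2 * (b ju.1 - a ju.1) = 0].
  move=> k; apply: contrapT => h; apply: hne; exists k => j u /andP[j0 jn] ur.
  by apply/eqP => h0; apply: h; exists (Ordinal jn, u).
have inj : injective (fun k => (f k).1).
  move=> k l /= ekl; have [j0 uk hk] := hf k; have [_ ul hl] := hf l.
  rewrite -ekl in hl; move: j0 uk ul hk hl; set j := (f k).1; set u := (f k).2; set v := (f l).2.
  move=> j0 ur vr hk hl.
  have jn : (0 < j < n)%N by rewrite j0 ltn_ord.
  have a0 : a j != 0 := (mF0 jn).2.
  have b0 : b j != 0 := (mF1 jn).2.
  have ba : b j - a j != 0.
    by apply: contraNneq a0 => ba; rewrite -hk ba mulr0 addr0.
  have e1 : arc k u = arc l v.
    by apply: (mulIf ba); apply: (addrI (a j)); rewrite hk hl.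
  have euv : u = v by rewrite -(Re_rect ur (arc_real k ur)) -(Re_rect vr (arc_real l vr)) [_ + _]e1.
  have := Im_rect vr (arc_real l vr); rewrite -[_ + _]e1 Im_rect ?arc_real // -euv.
  have [u0|u0] := eqVneq (u * (1 - u)) 0.
    move: hk; rewrite /arc u0 !mulr0 addr0; move/eqP: u0; rewrite mulf_eq0 subr_eq0 => /orP[/eqP ->|/eqP <-].
      by rewrite mul0r addr0 => h; rewrite h eqxx in a0.
    by rewrite mul1r addrC subrK => h; rewrite h eqxx in b0.
  by move=> /(mulIf u0)/eqP; rewrite eqr_nat => /eqP h; apply: val_inj.
by have := leq_card _ inj; rewrite !card_ord ltnn.
Qed.

Let equiv (x y : K) := exists2 psi, homeo2 psi & exists2 r : K, 0 < r & forall t, `|t| < r ->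
  psi (t ^+ n, ev F0 t + x * ev H t) = (t ^+ n, ev F0 t + y * ev H t).

Lemma equiv_refl x : equiv x x.
Proof. by exists id; [exact: homeo2_id|exists 1]. Qed.

Lemma equiv_sym x y : equiv x y -> equiv y x.
Proof.
move=> [psi hp [r r0 hr]]; have [psi' hp' c] := homeo2_inv hp.
by exists psi' => //; exists r => // t tr; rewrite -hr // c.
Qed.

Lemma equiv_trans x y z : equiv x y -> equiv y z -> equiv x z.
Proof.
move=> [psi hp [r r0 hr]] [chi hc [s s0 hs]]; exists (chi \o psi); first exact: homeo2_comp.
have [w [w0 wr ws]] := min_pos r0 s0.
by exists w => // t tw; rewrite /= hr ?hs // (lt_le_trans tw).
Qed.

(** The hypothesis keeps the contact orders of the member at x equal to m_j, while those of H are at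
    least m_j. Hence [contact_inequality] makes H Lipschitz along that member, and the shear by y -
    x reaches the member at y. *)
Lemma equiv_near (x : K) : (forall j, (0 < j < n)%N -> a j + x * (b j - a j) != 0) ->
  exists2 eta : K, 0 < eta & forall y : K, `|y - x| < eta -> equiv x y.
Proof.
move=> hx.
have cH : convergent H by apply/convergentD/convergentN/cF0/cF1.
have cx : convergent (Fam x) by apply/convergentD/convergentM/cH/convergentC/cF0.
have oH : ordge n H by exact: ordgeB.
have ox : ordge n (Fam x) by apply/ordgeD/ordgeMr/oH/oF0.
have z (G : ps K) : ordge n G -> G 0%N = 0 by move=> oG; exact: oG.
have hm j : (0 < j < n)%N -> isord (m j) (rotps (e ^+ j) (Fam x) - Fam x) /\
    ordge (m j) (rotps (e ^+ j) H - H).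
  move=> hj; have [g0 _] := mF0 hj; have [g1 _] := mF1 hj.
  have E (i : nat) : (rotps (e ^+ j) (Fam x) - Fam x) i = (rotps (e ^+ j) F0 - F0) i +
      x * ((rotps (e ^+ j) F1 - F1) i - (rotps (e ^+ j) F0 - F0) i).
    by rewrite !psB !rotpsE /Fam !psD !psCM /H !psB; ring.
  split; first split.
  - by move=> i im; rewrite E g0 ?g1 // subrr mulr0 addr0.
  - by rewrite E hx.
  - move=> i im; have := g1 i im; have := g0 i im; rewrite !psB !rotpsE => h0 h1.
    rewrite [LHS](_ : _ = (((e ^+ j) ^+ i * F1 i - F1 i) - ((e ^+ j) ^+ i * F0 i - F0 i))).
      by rewrite h0 h1 subrr.
    by rewrite /H !psB; ring.
have [eta eta0 he] := shear_along cx cH (z _ ox) (z _ oH)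
  (contact_inequality Kcomplete Karch n_gt0 prim_e cx cH ox oH hm).
have [s [A [D [s0 hA hD]]]] := convergent_common cF0 cH.
have evFam (y t : K) : `|t| < s -> ev (Fam y) t = ev F0 t + y * ev H t.
  move=> ts; have hC : psnorm (@absnorm K) s (psC y * H) (`|y| * D).
    by apply: (subnorm_M (subnorm_abs2 s0)) => //; apply: psnorm_C => //; exact: lexx.
  by rewrite (evD Kcomplete s0 hA hC ts) (evZ Kcomplete _ s0 hD ts).
exists eta => // y hy; have [psi hp [r r0 hr]] := he _ hy; exists psi => //.
have [w [w0 wr ws]] := min_pos r0 s0; exists w => // t tw.
have ts := lt_le_trans tw ws; have := hr t (lt_le_trans tw wr); rewrite evFam // => ->.
by congr (_, _); ring.
Qed.

Lemma arc_lipschitz (kappa : nat) (u v : K) : 0 <= u <= 1 -> 0 <= v <= 1 ->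
  `|arc kappa u - arc kappa v| <= (1 + kappa%:R) * `|u - v|.
Proof.
move=> /andP[u0 u1] /andP[v0 v1].
have -> : arc kappa u - arc kappa v = (u - v) + 'i * (kappa%:R * ((u - v) * (1 - u - v))).
  by rewrite /arc; ring.
rewrite (le_trans (ler_normD _ _)) // [leRHS]mulrDl mul1r lerD2l !normrM normCi mul1r normr_nat.
rewrite ler_wpM2l // ler_piMr // real_ler_norml ?realB ?ger0_real //.
rewrite -addrA -opprD gerDl oppr_le0 addr_ge0 // andbT lerBrDr addrC lerBlDr lerD //.
Qed.

Theorem deformation_trivial : exists2 psi, homeo2 psi & exists2 r : K, 0 < r & forall t, `|t| < r ->
  psi (t ^+ n, ev F0 t) = (t ^+ n, ev F1 t).
Proof.
have [kappa hk] := arc_avoids.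
suff: equiv (arc kappa 0) (arc kappa 1).
  rewrite /arc subrr mul0r !mulr0 !addr0 => -[psi hp [r r0 hr]]; exists psi => //.
  have [s [A [D [s0 hA hD]]]] := convergent_common cF1 cF0.
  have [w [w0 wr ws]] := min_pos r0 s0; exists w => // t tw; have ts := lt_le_trans tw ws.
  have := hr t (lt_le_trans tw wr); rewrite mul0r addr0 mul1r => ->.
  rewrite (evD Kcomplete s0 hA (subnorm_N (subnorm_abs2 s0) hD) ts).
  have -> : ev (- F0) t = - ev F0 t.
    by rewrite -[- F0]mulN1r -(rmorph1 (@psC K)) -rmorphN (evZ Kcomplete _ s0 hD ts) mulN1r.
  by congr (_, _); ring.
have k1 : 0 < 1 + kappa%:R :> K by rewrite ltr_pwDl.
have nbh (u : K) : 0 <= u <= 1 -> exists2 d : K, 0 < d & forall v, 0 <= v <= 1 -> `|v - u| < d ->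
    equiv (arc kappa u) (arc kappa v).
  move=> hu; have [|eta eta0 he] := equiv_near (x := arc kappa u).
    by move=> j hj; apply: hk => //; case/andP: hu => u0 _; exact: ger0_real.
  exists (eta / (1 + kappa%:R)); first by rewrite divr_gt0.
  move=> v hv; rewrite ltr_pdivlMr // mulrC => h; apply: he.
  exact: le_lt_trans (arc_lipschitz kappa hv hu) h.
(* Compactness of the segment in supremum form: the neighbourhood of the supremum x of the reachable
   parameters shows that x is reachable and, if x < 1, that larger parameters are too. *)
pose S : set K := [set u | 0 <= u <= 1 /\ equiv (arc kappa 0) (arc kappa u)].
have S0 : S 0 by split; [rewrite lexx ler01|exact: equiv_refl].
have Sr u : S u -> u \is Num.real by move=> [/andP[u0 _] _]; exact: ger0_real.
have [] := Ksup S0 Sr (B := 1); first by move=> u [/andP[]].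
move=> x [ub lub].
have x01 : 0 <= x <= 1 by rewrite ub //= lub // => u [/andP[]].
have xr : x \is Num.real by case/andP: x01 => x0 _; exact: ger0_real.
have [d d0 hd] := nbh x x01; have dr : d \is Num.real by rewrite gtr0_real.
have Sx : equiv (arc kappa 0) (arc kappa x).
  have [u [hu eu] ud] : exists2 u, S u & x - d < u.
    apply: contrapT => h; have : x <= x - d.
      apply: lub => u Su; rewrite (real_leNgt (Sr u Su) (realB xr dr)); apply/negP => hu; apply: h.
      by exists u.
    by rewrite lerBrDr gerDl => /(lt_le_trans d0); rewrite ltxx.
  apply: (equiv_trans eu); apply/equiv_sym/hd => //.
  have ux : u <= x by apply: ub.
  by rewrite distrC ger0_norm ?subr_ge0 // ltrBlDr addrC -ltrBlDr.
have d2 : 0 < d / 2 by rewrite divr_gt0.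
have dd : d / 2 < d by rewrite ltr_pdivrMr // ltr_pMr // ltr1n.
have [le1|lt1] := real_leP (realD xr (gtr0_real d2)) (real1 K).
  have : x + d / 2 <= x.
    apply: ub; have h01 : 0 <= x + d / 2 <= 1.
      by rewrite le1 andbT addr_ge0 ?(ltW d2) //; case/andP: x01.
    split=> //; apply: (equiv_trans Sx); apply: hd => //.
    by rewrite addrC addKr gtr0_norm.
  by rewrite gerDl => /(lt_le_trans d2); rewrite ltxx.
apply: (equiv_trans Sx); apply: hd; first by rewrite ler01 lexx.
case/andP: x01 => _ x1; rewrite ger0_norm ?subr_ge0 // ltrBlDr addrC.
by apply: (lt_trans lt1); rewrite ltrD2l.
Qed.

End Deformation.

(** * Completeness, Archimedean property and suprema for the complex numbers *)

Section ComplexCompleteness.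
Local Open Scope classical_set_scope.
Local Open Scope complex_scope.
Variable R : realType.
Let K : numClosedFieldType := R[i].

Lemma cvg_real_complex (u : nat -> R) (l : R) : u @ \oo --> l ->
  ((fun n => (u n)%:C : K) : nat -> K) @ \oo --> (l%:C : K).
Proof.
move=> /cvgrPdist_lt hu; apply/cvgrPdist_lt => e e0.
have er : (complex.Re e)%:C = e by apply: RRe_real; exact: gtr0_real.
have e'0 : 0 < complex.Re e by rewrite -ltcR er.
have := hu _ e'0; apply: filterS => n h.
by rewrite -er -rmorphB normc_def /= expr0n addr0 sqrtr_sqr ltcR.
Qed.

Lemma cvg_geometric_majorant (y : nat -> R) (A q : R) : 0 <= A -> 0 <= q -> q < 1 ->
  (forall n, `|y n| <= A * q ^+ n) -> exists l : R, (fun N => \sum_(n < N) y n) @ \oo --> l.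
Proof.
move=> A0 q0 q1 hy.
have hg : cvgn (series (geometric A q)) by apply: is_cvg_geometric_series; rewrite ger0_norm.
have h1 : cvgn (series (fun n => `|y n|)).
  by apply: (series_le_cvg _ _ hy hg) => n //; rewrite /geometric /= mulr_ge0 ?exprn_ge0.
have h2 : cvgn (series y) by exact: (@normed_cvg R R^o y).
exists (limn (series y)).
rewrite (_ : (fun N => _) = series y); first by exact: h2.
by apply/funext => N; rewrite /series /= big_mkord.
Qed.

Lemma normc_ge_Im (z : R[i]) : `|complex.Im z|%:C <= `|z|.
Proof. by rewrite normc_def lecR -sqrtr_sqr ler_wsqrtr // lerDr sqr_ge0. Qed.

Lemma complex_complete (a : nat -> K) (A q : K) : 0 <= A -> 0 <= q -> q < 1 ->
  (forall n, `|a n| <= A * q ^+ n) -> cvgn (fun N => \sum_(n < N) a n).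
Proof.
move=> A0 q0 q1 ha.
have Ar : (complex.Re A)%:C = A by apply: RRe_real; exact: ger0_real.
have qr : (complex.Re q)%:C = q by apply: RRe_real; exact: ger0_real.
have A0' : 0 <= complex.Re A by rewrite -lecR Ar.
have q0' : 0 <= complex.Re q by rewrite -lecR qr.
have q1' : complex.Re q < 1 by rewrite -ltcR qr.
have hb n : A * q ^+ n = (complex.Re A * complex.Re q ^+ n)%:C by rewrite rmorphM rmorphXn /= Ar qr.
have [x hx] : exists x : R, (fun N => \sum_(n < N) complex.Re (a n)) @ \oo --> x.
  apply: (cvg_geometric_majorant (y := fun n => complex.Re (a n)) A0' q0' q1') => n.
  by rewrite -lecR -hb; exact: le_trans (normc_ge_Re _) (ha n).
have [y hy] : exists y : R, (fun N => \sum_(n < N) complex.Im (a n)) @ \oo --> y.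
  apply: (cvg_geometric_majorant (y := fun n => complex.Im (a n)) A0' q0' q1') => n.
  by rewrite -lecR -hb; exact: le_trans (normc_ge_Im _) (ha n).
have h := cvgD (cvg_real_complex hx) (cvgMr (cvg_real_complex hy) (a := 'i : K)).
apply/cvg_ex; exists ((x%:C : K) + 'i * (y%:C : K)).
rewrite (_ : (fun N => \sum_(n < N) a n) = (fun N => ((\sum_(n < N) complex.Re (a n))%:C : K) +
   'i * ((\sum_(n < N) complex.Im (a n))%:C : K))); first exact: h.
apply/funext => N; rewrite !rmorph_sum mulr_sumr -big_split; apply: eq_bigr => n _ /=.
by rewrite complexRe complexIm -Crect.
Qed.

Lemma complex_archimedean (x B q : K) : 0 <= q -> q < 1 -> (forall n, `|x| <= B * q ^+ n) -> x = 0.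
Proof.
move=> q0 q1 h.
have B0 : 0 <= B by have := h 0%N; rewrite expr0 mulr1; exact: le_trans.
have Br : (complex.Re B)%:C = B by apply: RRe_real; exact: ger0_real.
have qr : (complex.Re q)%:C = q by apply: RRe_real; exact: ger0_real.
have xr : (complex.Re `|x|)%:C = `|x| by apply: RRe_real; exact: normr_real.
have q0' : 0 <= complex.Re q by rewrite -lecR qr.
have q1' : complex.Re q < 1 by rewrite -ltcR qr.
apply/eqP; rewrite -normr_le0 -xr -[0]/(0%:C) lecR.
have hc : geometric (complex.Re B) (complex.Re q) @ \oo --> (0 : R).
  by apply: cvg_geometric; rewrite ger0_norm.
rewrite -(cvg_lim (@Rhausdorff R) hc); apply: limr_ge; first by apply/cvg_ex; exists 0.
apply: nearW => n; rewrite /geometric /= -lecR xr rmorphM rmorphXn /= Br qr; exact: h.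
Qed.

Lemma complex_sup (S : set K) (x0 B : K) : S x0 -> (forall x, S x -> x \is Num.real) ->
  (forall x, S x -> x <= B) ->
  exists m, (forall x, S x -> x <= m) /\ forall b, (forall x, S x -> x <= b) -> m <= b.
Proof.
move=> S0 Sr SB; pose T := [set complex.Re x | x in S].
have T0 : T !=set0 by exists (complex.Re x0), x0.
have sr x : S x -> (complex.Re x)%:C = x by move=> /Sr; exact: RRe_real.
have ubR b : (forall x, S x -> x <= b) -> exists2 c, b = c%:C & ubound T c.
  move=> hb; exists (complex.Re b).
    apply/esym/RRe_real; have := Sr _ S0; rewrite (ger_real (hb _ S0)).
    by [].
  by move=> _ [x Sx <-]; have := hb x Sx; rewrite lecE => /andP[].
have [c eB cT] := ubR B SB.
exists (sup T)%:C; split=> [x Sx|b /ubR [d -> dT]].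
  rewrite -(sr x Sx) lecR; apply: ub_le_sup; first by exists c.
  by exists x.
by rewrite lecR; exact: ge_sup.
Qed.

End ComplexCompleteness.

(** * Topological equivalence of nondegenerate germs *)

Section AnalyticHomeo.
Local Open Scope classical_set_scope.
Variable K : numClosedFieldType.
Hypothesis Kcomplete : forall (a : nat -> K) (A q : K), 0 <= A -> 0 <= q -> q < 1 ->
  (forall n, `|a n| <= A * q ^+ n) -> cvgn (fun N => \sum_(n < N) a n).
Hypothesis Karch : forall (x B q : K), 0 <= q -> q < 1 -> (forall n, `|x| <= B * q ^+ n) -> x = 0.
Implicit Types (f a h : ps K) (s t z : K).

Lemma ev_scomp_near f a : convergent f -> f 0%N = 0 -> convergent a ->
  exists2 s, 0 < s & forall z, `|z| < s -> ev (scomp f a) z = ev a (ev f z).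
Proof.
move=> cf f0 /convergentP [t [A [t0 hA]]]; have [s s0 hs] := psnorm_psv cf t0.
have hf : psnorm (@absnorm K) s f t by rewrite -(psv_id f0); exact: hs.
by exists s => // z zs; have [_ ->] := ev_scomp Kcomplete Karch s0 t0 f0 hf hA zs.
Qed.

Lemma ev_small f t : convergent f -> f 0%N = 0 -> 0 < t ->
  exists2 s, 0 < s & forall z, `|z| < s -> `|ev f z| < t.
Proof.
move=> cf f0 t0; have [s s0 hs] := psnorm_psv cf t0.
have hf : psnorm (@absnorm K) s f t by rewrite -(psv_id f0); exact: hs.
have h1 : psnorm (@absnorm K) t 1 1 := subnorm_1 (subnorm_abs2 t0).
by exists s => // z zs; have [] := ev_scomp Kcomplete Karch s0 t0 f0 hf h1 zs.
Qed.

Lemma ev_continuous f : convergent f ->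
  exists2 s, 0 < s & forall z, `|z| < s -> {for z, continuous (ev f)}.
Proof.
move=> /convergentP [s [A [s0 hA]]]; exists (s / 2); first by rewrite divr_gt0.
have A0 := psnorm_ge0 s0 hA.
have le_s z : `|z| < s / 2 -> 2 * `|z| <= s by rewrite ltr_pdivlMr // mulrC => /ltW.
move=> z zs; apply/(@cvgrPdist_lt _ _ _ (nbhs z)) => e e0.
pose B := 2 * A / s + 1.
have B0 : 0 < B by rewrite ltr_wpDl // divr_ge0 ?mulr_ge0 // ltW.
have d0 : 0 < e / B by rewrite divr_gt0.
have zs' : 0 < s / 2 - `|z| by rewrite subr_gt0.
have near_dist d : 0 < d -> \forall w \near z, `|z - w| < d.
  by move=> h; apply: (@cvgr_dist_lt _ _ _ (nbhs z) _ id z) => //; exact: cvg_id.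
near=> w.
have w1 : `|z - w| < e / B by near: w; exact: near_dist.
have w2 : `|z - w| < s / 2 - `|z| by near: w; exact: near_dist.
have ws : `|w| < s / 2.
  have -> : w = z - (z - w) by ring.
  by apply: (le_lt_trans (ler_normB _ _)); rewrite addrC -ltrBrDr.
apply: (le_lt_trans (ev_lipschitz Kcomplete Karch s0 hA (le_s z zs) (le_s w ws))).
apply: (@le_lt_trans _ _ (B * `|z - w|)); first by rewrite ler_wpM2r // lerDl.
by rewrite mulrC -ltr_pdivlMr.
Unshelve. all: by end_near.
Qed.

Lemma near_norm_lt (T : topologicalType) (g : T -> K) x r :
  {for x, continuous g} -> `|g x| < r -> \forall y \near x, `|g y| < r.
Proof.
move=> cg gr; have d0 : 0 < r - `|g x| by rewrite subr_gt0.
move/cvgrPdist_lt/(_ _ d0): cg; apply: filterS => y hy.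
have -> : g y = g x - (g x - g y) by ring.
by apply: (le_lt_trans (ler_normB _ _)); rewrite addrC -ltrBrDr.
Qed.

Lemma ev_homeo_germ h h' : convergent h -> convergent h' -> h 0%N = 0 -> h' 0%N = 0 ->
  scomp h h' = psX -> scomp h' h = psX -> homeo_germ (ev h) (0 : K).
Proof.
move=> ch ch' h0 h'0 e1 e2; split; first exact: (ev_at0 Kcomplete ch h0).
have [s1 s10 hs1] := ev_scomp_near ch h0 ch'.
have [s2 s20 hs2] := ev_scomp_near ch' h'0 ch.
have [s3 s30 hs3] := ev_continuous ch; have [s4 s40 hs4] := ev_continuous ch'.
have [x [x0 x1 x2]] := min_pos s10 s20; have [y [y0 y3 y4]] := min_pos s30 s40.
have [r [r0 rx ry]] := min_pos x0 y0.
have inv1 z : `|z| < r -> ev h' (ev h z) = z.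
  by move=> zr; rewrite -hs1 ?e1 ?(ev_psX Kcomplete) // (lt_le_trans zr) // (le_trans rx).
have inv2 z : `|z| < r -> ev h (ev h' z) = z.
  by move=> zr; rewrite -hs2 ?e2 ?(ev_psX Kcomplete) // (lt_le_trans zr) // (le_trans rx).
have c1 z : `|z| < r -> {for z, continuous (ev h)}.
  by move=> zr; apply: hs3; rewrite (lt_le_trans zr) // (le_trans ry).
have c2 z : `|z| < r -> {for z, continuous (ev h')}.
  by move=> zr; apply: hs4; rewrite (lt_le_trans zr) // (le_trans ry).
(* The double condition makes h map [U (ev h)] into [U (ev h')]: for w = h(z) both |w| < r and
   |h'(w)| = |z| < r hold. *)
pose U (g : K -> K) : set K := [set z | `|z| < r /\ `|g z| < r].
have oU g : (forall z, `|z| < r -> {for z, continuous g}) -> open (U g).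
  move=> cg; rewrite openE => z [zr gr]; apply: filterI; last exact: near_norm_lt (cg z zr) gr.
  by apply: (@near_norm_lt K id) zr; exact: cvg_id.
have z0 : `|0 : K| < r by rewrite normr0.
exists (U (ev h)), (U (ev h')), (ev h').
split; first exact: oU.
split; first exact: oU.
split; first by rewrite /U /= !(ev_at0 Kcomplete ch h0) z0.
split; first by rewrite /U /= !(ev_at0 Kcomplete ch' h'0) z0.
split; first by move=> z [zr hr]; split; [split=> //; rewrite inv1|exact: inv1].
split; first by move=> z [zr hr]; split; [split=> //; rewrite inv2|exact: inv2].
by split; apply: continuous_in_subspaceT => z /set_mem [zr _]; [exact: c1|exact: c2].
Qed.

Lemma homeo2_germ (psi : K * K -> K * K) : homeo2 psi -> homeo_germ psi (0, 0).
Proof.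
move=> [psi' [c1 c2 h1 h2 e0]]; split=> //; exists setT, setT, psi'.
do 2![split; first exact: openT]; do 2![split=> //].
by do 2![split; first by move=> x _; split=> //]; split; exact: continuous_subspaceT.
Qed.

End AnalyticHomeo.

Section TopologicalEquivalence.
Local Open Scope classical_set_scope.
Variable K : numClosedFieldType.
Hypothesis Kcomplete : forall (a : nat -> K) (A q : K), 0 <= A -> 0 <= q -> q < 1 ->
  (forall n, `|a n| <= A * q ^+ n) -> cvgn (fun N => \sum_(n < N) a n).
Hypothesis Karch : forall (x B q : K), 0 <= q -> q < 1 -> (forall n, `|x| <= B * q ^+ n) -> x = 0.
Hypothesis Ksup : forall (S : set K) (x0 B : K), S x0 -> (forall x, S x -> x \is Num.real) ->
  (forall x, S x -> x <= B) ->
  exists m, (forall x, S x -> x <= m) /\ forall b, (forall x, S x -> x <= b) -> m <= b.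

Definition germ_equiv (f1 f2 g1 g2 : ps K) := exists2 phi : K -> K, homeo_germ phi 0 &
  exists2 psi : K * K -> K * K, homeo2 psi &
    exists2 r : K, 0 < r & forall z, `|z| < r -> psi (ev f1 z, ev f2 z) = (ev g1 (phi z), ev g2 (phi z)).

Lemma germ_equiv_swap (f1 f2 g1 g2 : ps K) : germ_equiv f2 f1 g2 g1 -> germ_equiv f1 f2 g1 g2.
Proof.
move=> [phi hphi [psi hpsi [r r0 hr]]]; exists phi => //.
pose sw (p : K * K) : K * K := (p.2, p.1).
have hsw : homeo2 sw.
  have c : continuous sw.
    move=> p; have h1 : (fun q : K * K => q.2) q @[q --> p] --> p.2 by exact: cvg_snd.
    have h2 : (fun q : K * K => q.1) q @[q --> p] --> p.1 by exact: cvg_fst.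
    exact: cvg_pair h1 h2.
  by exists sw; split=> // -[].
exists (sw \o (psi \o sw)); first by do 2!apply: homeo2_comp => //.
by exists r => // z zr; rewrite /= /sw /= hr.
Qed.

Section OrderedGerms.
Variables (B1 B2 : pred nat) (d1 d2 : nat).
Hypotheses (hmin1 : forall b, B1 b -> (d1 <= b)%N) (hpos1 : (0 < d1)%N).
Hypotheses (hmin2 : forall b, B2 b -> (d2 <= b)%N) (hpos2 : (0 < d2)%N).
Hypothesis hgcd : forall k, (forall b, B1 b || B2 b -> (k %| b)%N) -> k = 1%N.

(** With f = (t^d1, F) after psi and g after chi equal to (t^d1, G), the plane homeomorphism from
    (t^d1, F) to (t^d1, G) carries f(z) to g(chi(psi(z))); so the change of parameter is chi after
    psi. *)
Lemma germ_equiv_ordered (f1 f2 g1 g2 : ps K) : (d1 <= d2)%N ->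
  convergent f1 -> convergent f2 -> convergent g1 -> convergent g2 ->
  supp B1 f1 -> supp B2 f2 -> supp B1 g1 -> supp B2 g2 ->
  f1 d1 != 0 -> f2 d2 != 0 -> g1 d1 != 0 -> g2 d2 != 0 ->
  nondegenerate B1 B2 d1 d2 f1 f2 -> nondegenerate B1 B2 d1 d2 g1 g2 ->
  germ_equiv f1 f2 g1 g2.
Proof.
move=> d12 cf1 cf2 cg1 cg2 sf1 sf2 sg1 sg2 nf1 nf2 ng1 ng2 ndf ndg.
have [e prim_e] := exists_prim_root K hpos1.
have [ek hek] := exists_contact hmin1 hmin2 hgcd.
have [phi [psi [F nf]]] := exists_normal_form hmin1 hpos1 hmin2 hpos2 cf1 cf2 sf1 sf2 nf1 nf2.
have [chi [xi [G ng]]] := exists_normal_form hmin1 hpos1 hmin2 hpos2 cg1 cg2 sg1 sg2 ng1 ng2.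
have mF := contact_nondegenerate hpos1 prim_e nf ndf hek.
have mG := contact_nondegenerate hpos1 prim_e ng ndg hek.
have oF := ordge_le d12 (nf_ord nf).1; have oG := ordge_le d12 (nf_ord ng).1.
have [Psi hPsi [r r0 hr]] := deformation_trivial Kcomplete Karch Ksup hpos1 prim_e
  (cvalP F) (cvalP G) oF oG mF mG.
have [cphi cpsi] := nf_conv nf; have [p0 q0] := nf_cst nf; have [i1 i2] := nf_inv nf.
have [cchi cxi] := nf_conv ng; have [p0' q0'] := nf_cst ng; have [i1' i2'] := nf_inv ng.
have cst (a b : ps K) : b 0%N = 0 -> scomp a b 0%N = 0 by move=> b0; rewrite scomp_0.
exists (ev (scomp psi chi)).
  apply: (@ev_homeo_germ K Kcomplete Karch _ (scomp xi phi));
    rewrite ?cst //; try exact: convergent_scomp.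
  - by rewrite -scompA [scomp chi _]scompA i2' scomp_id i1.
  - by rewrite -scompA [scomp phi _]scompA i2 scomp_id i1'.
exists Psi => //.
have Ef1 : f1 = scomp psi (psX ^+ d1) by rewrite -(nf_fst nf) scompA i1 scomp_id.
have Ef2 : f2 = scomp psi (cval F) by rewrite -(nf_snd nf) scompA i1 scomp_id.
have cXn : convergent (psX ^+ d1 : ps K) by rewrite -(nf_fst nf); exact: convergent_scomp.
have near1 a : convergent a -> exists2 s : K, 0 < s & forall z, `|z| < s -> ev (scomp psi a) z = ev a (ev psi z).
  by exact: (ev_scomp_near Kcomplete Karch cpsi q0).
have near2 a : convergent a -> exists2 s : K, 0 < s & forall z, `|z| < s -> ev (scomp chi a) z = ev a (ev chi z).
  by exact: (ev_scomp_near Kcomplete Karch cchi p0').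
have [s1 s10 h1] := near1 _ cXn; have [s2 s20 h2] := near1 _ (cvalP F); have [s3 s30 h3] := near1 _ cchi.
have [s4 s40 h4] := near2 _ cg1; have [s5 s50 h5] := near2 _ cg2.
have [x [x0 xs4 xs5]] := min_pos s40 s50; have [y [y0 yx yr]] := min_pos x0 r0.
have [s6 s60 h6] := ev_small Kcomplete Karch cpsi q0 y0.
have [a [a0 as1 as2]] := min_pos s10 s20; have [b [b0 bs3 bs6]] := min_pos s30 s60.
have [w [w0 wa wb]] := min_pos a0 b0.
exists w => // z zw; have za := lt_le_trans zw wa; have zb := lt_le_trans zw wb.
have ty := h6 z (lt_le_trans zb bs6); have tx := lt_le_trans ty yx.
rewrite {1}Ef1 {1}Ef2 (h1 _ (lt_le_trans za as1)) (h2 _ (lt_le_trans za as2)) (h3 _ (lt_le_trans zb bs3)).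
rewrite ev_psXn // hr ?(lt_le_trans ty) // -h4 ?(lt_le_trans tx) // -h5 ?(lt_le_trans tx) //.
by rewrite (nf_fst ng) (nf_snd ng) ev_psXn.
Qed.

End OrderedGerms.

Theorem nondegenerate_germ_equiv (B1 B2 : pred nat) (d1 d2 : nat)
  (hmin1 : forall b, B1 b -> (d1 <= b)%N) (hpos1 : (0 < d1)%N)
  (hmin2 : forall b, B2 b -> (d2 <= b)%N) (hpos2 : (0 < d2)%N)
  (hgcd : forall k, (forall b, B1 b || B2 b -> (k %| b)%N) -> k = 1%N) (f1 f2 g1 g2 : ps K) :
  convergent f1 -> convergent f2 -> convergent g1 -> convergent g2 ->
  supp B1 f1 -> supp B2 f2 -> supp B1 g1 -> supp B2 g2 ->
  f1 d1 != 0 -> f2 d2 != 0 -> g1 d1 != 0 -> g2 d2 != 0 ->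
  nondegenerate B1 B2 d1 d2 f1 f2 -> nondegenerate B1 B2 d1 d2 g1 g2 ->
  germ_equiv f1 f2 g1 g2.
Proof.
move=> cf1 cf2 cg1 cg2 sf1 sf2 sg1 sg2 nf1 nf2 ng1 ng2 ndf ndg.
have [d12|/ltnW d21] := leqP d1 d2.
  exact: (germ_equiv_ordered hmin1 hpos1 hmin2 hpos2 hgcd).
(* When d2 < d1 the coordinates are exchanged; nondegeneracy is symmetric in the two components. *)
have hgcd' k : (forall b, B2 b || B1 b -> (k %| b)%N) -> k = 1%N.
  by move=> h; apply: hgcd => b hb; apply: h; rewrite orbC.
have ndC (h1 h2 : ps K) : nondegenerate B1 B2 d1 d2 h1 h2 -> nondegenerate B2 B1 d2 d1 h2 h1.
  move=> nd k k1 kd2 kd1 r [hr [kr h]]; rewrite eq_sym; apply: (nd k k1 kd1 kd2 r).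
  by split; [rewrite orbC|split=> // s sr; rewrite orbC; exact: h].
apply/germ_equiv_swap/(germ_equiv_ordered hmin2 hpos2 hmin1 hpos1 hgcd') => //; exact: ndC.
Qed.

End TopologicalEquivalence.

Lemma nondeg0_topo_equiv (B1 B2 : pred nat) (d1 d2 : nat)
  (hmin1 : forall b, B1 b -> (d1 <= b)%N) (hpos1 : (0 < d1)%N)
  (hmin2 : forall b, B2 b -> (d2 <= b)%N) (hpos2 : (0 < d2)%N)
  (hgcd : forall k, (forall b, B1 b || B2 b -> (k %| b)%N) -> k = 1%N) f1 f2 g1 g2 :
  in_CB B1 f1 -> in_CB B2 f2 -> in_CB B1 g1 -> in_CB B2 g2 ->
  nondeg0 B1 B2 d1 d2 f1 f2 -> nondeg0 B1 B2 d1 d2 g1 g2 -> topo_equiv f1 f2 g1 g2.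
Proof.
move=> [cf1 sf1] [cf2 sf2] [cg1 sg1] [cg2 sg2] [nf1 [nf2 ndf]] [ng1 [ng2 ndg]].
have [phi hphi [psi hpsi [r r0 hr]]] :=
  @nondegenerate_germ_equiv C (@complex_complete Rdefinitions.R) (@complex_archimedean Rdefinitions.R)
    (@complex_sup Rdefinitions.R) B1 B2 d1 d2 hmin1 hpos1 hmin2 hpos2 hgcd f1 f2 g1 g2
    cf1 cf2 cg1 cg2 sf1 sf2 sg1 sg2 nf1 nf2 ng1 ng2 ndf ndg.
exists phi, psi; split=> //; split; first exact: homeo2_germ.
have h0 : `|0 : C| < r by rewrite normr0.
have c0 : {for (0 : C), continuous (fun z : C => z)} by exact: cvg_id.
by apply: filterS (near_norm_lt c0 h0) => z; exact: hr.
Qed.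

Theorem theorem1p1 (B1 B2 : pred nat) (d1 d2 : nat)
  (hd1 : B1 d1) (hmin1 : forall b, B1 b -> (d1 <= b)%N) (hpos1 : (0 < d1)%N)
  (hd2 : B2 d2) (hmin2 : forall b, B2 b -> (d2 <= b)%N) (hpos2 : (0 < d2)%N)
  (hgcd : forall k, (forall b, B1 b || B2 b -> (k %| b)%N) -> k = 1%N)
  (N : nat) (hN : forall r, (N <= r)%N -> jr B1 B2 d1 d2 r = 1%N) :
  let dB := deltaB B1 B2 d1 d2 N in
  (* 1) generic delta and Milnor number *)
  generic B1 B2 (fun f1 f2 =>
     exists n : nat, n%:R = dB /\ delta_is f1 f2 n /\ milnor_is f1 f2 (2 * n)%N)
  /\
  (* 2) characterization of delta = delta_B by 0-nondegeneracy *)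
  (forall f1 f2, in_CB B1 f1 -> in_CB B2 f2 -> f1 d1 != 0 -> f2 d2 != 0 ->
     ((exists n : nat, n%:R = dB /\ delta_is f1 f2 n) <->
        nondeg0 B1 B2 d1 d2 f1 f2) /\
     (~ nondeg0 B1 B2 d1 d2 f1 f2 ->
        forall n : nat, n%:R <= dB -> ~ codim1_le (pullback f1 f2) n))
  /\
  (* 3) all 0-nondegenerate germs supported at (B1,B2) are top. equivalent *)
  (forall f1 f2 g1 g2, in_CB B1 f1 -> in_CB B2 f2 -> in_CB B1 g1 -> in_CB B2 g2 ->
     nondeg0 B1 B2 d1 d2 f1 f2 -> nondeg0 B1 B2 d1 d2 g1 g2 ->
     topo_equiv f1 f2 g1 g2).
Proof.
move=> dB; split; last split.
- have [M [p [hp h]]] := nondeg0_generic hd1 hmin1 hpos1 hd2 hmin2 hpos2 hgcd.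
  exists M, p; split=> // f1 f2 i1 i2 pf.
  exact: (milnor_nondeg hd1 hmin1 hpos1 hd2 hmin2 hpos2 hgcd hN i1 i2 (h _ _ i1 i2 pf)).
- exact: (delta_characterization hd1 hmin1 hpos1 hd2 hmin2 hpos2 hgcd hN).
- exact: (nondeg0_topo_equiv hmin1 hpos1 hmin2 hpos2 hgcd).
Qed.
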